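(* Let $\mathscr{P}$ be an irreducible subfactor planar algebra and let $0\le\lambda\le 1$. Then for any $x\in\mathscr{P}_{2,\pm}$ the sequence of iterates $\{B_\lambda^n(x)\}_{n\ge1}$ of the block map $B_\lambda$ on $\mathscr{P}_{2,\pm}$ converges to $0$ or to a positive multiple of a biprojection. Moreover, for a nonzero $x\in\mathscr{P}_{2,\pm}$, $B_\lambda(x)=x$ if and only if $x$ is a positive multiple of a biprojection.
   Context: A subfactor planar algebra $\mathscr{P}=\{\mathscr{P}_{n,\pm}\}_{n\ge0}$ is a shaded planar $*$-algebra (in the sense of Jones) over $\mathbb{C}$ with all $\mathscr{P}_{n,\pm}$ finite dimensional, $\dim\mathscr{P}_{0,\pm}=1$, spherical, with positive definite trace forms. $\delta$ is the value of a closed loop. It is irreducible if $\dim\mathscr{P}_{1,\pm}=1$. The 2-box spaces $\mathscr{P}_{2,+},\mathscr{P}_{2,-}$ are finite-dimensional $C^*$-algebras under vertical composition, with identity $1$ (two vertical strings) and involution $x\mapsto x^*$ (vertical reflection). $tr_2$ is the unnormalized Markov trace (closing up the diagram), $tr_2(1)=\delta^2$. The string Fourier transform $\mathfrak{F}:\mathscr{P}_{2,\pm}\to\mathscr{P}_{2,\mp}$ is the linear bijection given by the clockwise one-string ($90^\circ$) rotation; $\mathfrak{F}(x)^*=\mathfrak{F}^{-1}(x^* )$. The contragredient is $\overline{x}=\mathfrak{F}^2(x)$. The coproduct (convolution) of $x,y\in\mathscr{P}_{2,\pm}$ is the element $x*y\in\mathscr{P}_{2,\pm}$ obtained by placing $x$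 to the left of $y$ and joining the top right string of $x$ to the top left string of $y$ and likewise at the bottom; equivalently $x*y=\mathfrak{F}(\mathfrak{F}^{-1}(x)\mathfrak{F}^{-1}(y))$. Norms: $\|x\|_p=tr_2(|x|^p)^{1/p}$ for $1\le p<\infty$, and $\|x\|_\infty$ is the operator norm. A projection $B\in\mathscr{P}_{2,\pm}$ is a biprojection if $\mathfrak{F}(B)$ is a multiple of a projection. Block maps: for nonzero $x\in\mathscr{P}_{2,\pm}$, $$B_{cm}(x)=\frac{\delta^2}{\|x\|_1\|x\|_2^2}(\overline{x^*}*x)(\overline{x}*x^* ),\qquad B_{mc}(x)=\frac{\delta}{\|x\|_\infty\|x\|_2^2}(\overline{x}\,\overline{x^*})*(x^*x),$$ and $B_\lambda=\lambda B_{cm}+(1-\lambda)B_{mc}$ for $0\le\lambda\le1$; by convention $B_\lambda(0)=0$. $B_\lambda^n$ is the $n$-fold iterate. *)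

(* Defs.v *)
From HB Require Import structures.
From mathcomp Require Import all_boot all_order all_algebra zify.
From mathcomp Require Import complex.
From mathcomp Require Import all_classical all_reals all_analysis.
From Stdlib Require Import Relations.

Set Implicit Arguments.
Unset Strict Implicit.
Unset Printing Implicit Defensive.

Import Order.TTheory GRing.Theory Num.Theory.
Import numFieldNormedType.Exports.

(** * Shaded planar tangles up to planar isotopy

    A box of colour [(n, s)] has [2n] boundary points, numbered clockwise from
    the marked interval, and the marked interval lies in a region of shade [s]
    ([true] is +, unshaded; [false] is -, shaded).  The interval number [i]
    precedes the point number [i]; a box without boundary points has a single
    interval.

    The isotopy class of a tangle is recorded as a finite plane map: its
    strands (strings and closed loops), its regions, the strand ending at every
    boundary point, the region containing every boundary interval, and the
    region on either side of every strand.  The boundary components are indexed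
    by [option D]: [Some d] is the inner disc [d], and [None] the outer disc. *)

Definition color : Type := nat * bool.

Definition npts (c : color) : nat := c.1.*2.

Notation point c := 'I_(npts c).
Notation interval c := 'I_((npts c).-1.+1).

Definition before (c : color) (i : point c) : interval c := inZp i.
Definition after (c : color) (i : point c) : interval c := inZp i.+1.

Definition bcolor (D : finType) (dc : D -> color) (c : color) (v : option D) :=
  oapp dc c v.

Record pretangle (D : finType) (dc : D -> color) (c : color) := Pretangle {
  strand : finType;
  region : finType;
  strand_at : forall v : option D, point (bcolor dc c v) -> strand;
  region_at : forall v : option D, interval (bcolor dc c v) -> region;
  side : strand -> bool -> region;
  shade : region -> bool }.

Arguments strand_at {D dc c} p v i.
Arguments region_at {D dc c} p v i.

Section Pretangle.
Context (D : finType) (dc : D -> color) (c : color) (T : pretangle dc c).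

(* The shade on the left of the string starting at a boundary point, as seen
   when moving along the string away from that point.  The string starting at
   [i] has the interval [before i] on its left if the disc is an inner one, and
   [after i] if it is the outer disc. *)
Definition left_shade (v : option D) (i : point (bcolor dc c v)) : bool :=
  ~~ v (+) (bcolor dc c v).2 (+) odd i.

Definition adjacent : rel (region T) :=
  fun r r' => [exists e, exists b, (side e b == r) && (side e (~~ b) == r')].

Definition incident : rel (option D + strand T) := fun x y =>
  match x, y with
  | inl v, inr e | inr e, inl v => [exists i, strand_at T v i == e]
  | _, _ => false
  end.

(* A strand with endpoints has exactly two of them, and these see opposite
   shades on their left; a strand without endpoints is a closed loop.

   [planar_euler] is Euler's formula V - E + F = 1 + K on the sphere obtained by
   collapsing the outer disc and the inner discs to vertices.  The number of
   strings is E = \sum_v n_v; a closed loop is one component, and contributes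
   nothing to V - E. *)
Record is_planar : Prop := IsPlanar {
  planar_shade : forall v i, shade (region_at T v i) = (bcolor dc c v).2 (+) odd i;
  planar_side : forall (e : strand T) b, shade (side e b) = b;
  planar_before : forall v i,
    region_at T v (before i) = side (strand_at T v i) ((bcolor dc c v).2 (+) odd i);
  planar_after : forall v i,
    region_at T v (after i) = side (strand_at T v i) (~~ ((bcolor dc c v).2 (+) odd i));
  planar_ends_inj : forall v w i j, strand_at T v i = strand_at T w j ->
    left_shade i = left_shade j -> v = w /\ i = j :> nat;
  planar_ends : forall v i, exists w j,
    strand_at T w j = strand_at T v i /\ left_shade j = ~~ left_shade i;
  planar_connected : forall r r', connect adjacent r r';
  planar_euler :
    #|{: option D}| + #|region T| =
      1 + n_comp incident predT + \sum_(v : option D) (bcolor dc c v).1 }.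

End Pretangle.

Record tangle (D : finType) (dc : D -> color) (c : color) := Tangle {
  pretangle_of :> pretangle dc c;
  tangle_planar : is_planar pretangle_of }.

(** ** Isotopy, reflection and gluing of tangles *)

Section Isotopy.
Context (D D' : finType) (dc : D -> color) (c c' : color) (f : D' -> D).
Context (T' : tangle (dc \o f) c') (T : tangle dc c).
Context (phi : strand T' -> strand T) (rho : region T' -> region T).

(* Same diagram away from the outer disc, the disc [d] of [T'] being the disc
   [f d] of [T]. *)
Definition inner_match : Prop :=
  [/\ bijective phi, bijective rho,
      forall d i, strand_at T (Some (f d)) i = phi (strand_at T' (Some d) i),
      forall d i, region_at T (Some (f d)) i = rho (region_at T' (Some d) i) &
      forall e b, side (phi e) b = rho (side e b)].
End Isotopy.

Definition isotopic (D D' : finType) (dc : D -> color) (c : color) (f : D' -> D)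
    (T' : tangle (dc \o f) c) (T : tangle dc c) : Prop :=
  exists phi rho,
    [/\ inner_match phi rho,
        forall i, strand_at T None i = phi (strand_at T' None i) &
        forall i, region_at T None i = rho (region_at T' None i)].

(* Closed diagrams that become isotopic on the sphere: the outer disc may lie in
   different regions. *)
Definition sphere_isotopic (D : finType) (dc : D -> color) (s s' : bool)
    (T' : tangle dc (0, s')) (T : tangle dc (0, s)) : Prop :=
  exists phi rho, @inner_match D D dc (0, s) (0, s') id T' T phi rho.

(* The image of a tangle under a reflection of the plane. *)
Definition mirror (D : finType) (dc : D -> color) (c : color)
    (T T' : tangle dc c) : Prop :=
  exists (phi : strand T -> strand T') (rho : region T -> region T'),
    [/\ bijective phi, bijective rho,
        forall v i, strand_at T' v (rev_ord i) = phi (strand_at T v i),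
        forall v i, region_at T' v (Zp_opp i) = rho (region_at T v i) &
        forall e b, side (phi e) b = rho (side e b)].

Definition is_identity (c : color) (T : tangle (fun _ : unit => c) c) : Prop :=
  (forall i, strand_at T (Some tt) i = strand_at T None i) /\
  (forall e, exists i, e = strand_at T None i).

Section Gluing.
Context (D : finType) (dc : D -> color) (c : color) (T : tangle dc c).
Context (E : D -> finType) (ec : forall d, E d -> color).
Context (S : forall d, tangle (@ec d) (dc d)).

Inductive strand_seam :
    strand T + {d : D & strand (S d)} -> strand T + {d : D & strand (S d)} -> Prop :=
  StrandSeam d (i : point (dc d)) :
    strand_seam (inl (strand_at T (Some d) i))
                (inr (Tagged (fun d => strand (S d)) (strand_at (S d) None i))).

Inductive region_seam :
    region T + {d : D & region (S d)} -> region T + {d : D & region (S d)} -> Prop :=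
  RegionSeam d (i : interval (dc d)) :
    region_seam (inl (region_at T (Some d) i))
                (inr (Tagged (fun d => region (S d)) (region_at (S d) None i))).

Definition quotient_by (A B : Type) (e : A -> A -> Prop) (q : A -> B) : Prop :=
  (forall b, exists a, q a = b) /\
  (forall a a', q a = q a' <-> clos_refl_sym_trans A e a a').

Definition glue_color (u : {d : D & E d}) : color := ec (tagged u).

(* [U] is obtained from [T] by filling every inner disc [d] with [S d]: its
   strands and regions are those of [T] and of the [S d], identified along the
   boundaries of the inner discs of [T]. *)
Definition glued (U : tangle glue_color c) : Prop :=
  exists (phi : strand T + {d : D & strand (S d)} -> strand U)
         (rho : region T + {d : D & region (S d)} -> region U),
    [/\ quotient_by strand_seam phi,
        quotient_by region_seam rho,
        (forall i, strand_at U None i = phi (inl (strand_at T None i))) /\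
        (forall i, region_at U None i = rho (inl (region_at T None i))),
        (forall u i, strand_at U (Some u) i =
           phi (inr (Tagged (fun d => strand (S d))
                            (strand_at (S (tag u)) (Some (tagged u)) i)))) /\
        (forall u i, region_at U (Some u) i =
           rho (inr (Tagged (fun d => region (S d))
                            (region_at (S (tag u)) (Some (tagged u)) i)))) &
        (forall e b, side (phi (inl e)) b = rho (inl (side e b))) /\
        (forall d (e : strand (S d)) b,
           side (phi (inr (Tagged (fun d => strand (S d)) e))) b =
           rho (inr (Tagged (fun d => region (S d)) (side e b))))].

End Gluing.

(** ** The tangles used below *)

Section Components.
Context (A : finType) (e : rel A) (e_sym : connect_sym e).

Lemma n_comp_label (K : finType) (lab : A -> K) :
    (forall k, exists x, lab x = k) ->
    (forall x y, connect e x y = (lab x == lab y)) ->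
  n_comp e predT = #|K|.
Proof.
move=> lab_surj labE; pose g x := lab x.
have inj : {in predI (roots e) predT &, injective g}.
  move=> x y /andP[/eqP rx _] /andP[/eqP ry _] gxy.
  suff: fingraph.root e x = fingraph.root e y by rewrite rx ry.
  by apply/(fingraph.rootP e_sym); rewrite labE -/(g x) gxy.
rewrite /n_comp_mem -(card_in_image inj); apply: eq_card => k.
transitivity true => //; apply/fintype.imageP; have [x <-] := lab_surj k; exists (fingraph.root e x); last first.
  by apply/eqP; rewrite /g -labE connect_root.
by rewrite !inE /= roots_root.
Qed.

Lemma n_comp_connected (x0 : A) :
  (forall x, connect e x0 x) -> n_comp e predT = 1.
Proof.
move=> x0P; rewrite (@n_comp_label unit (fun=> tt)) ?card_unit //.
  by case; exists x0.
by move=> x y; rewrite eqxx (connect_trans _ (x0P y)) // e_sym.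
Qed.
End Components.

Lemma big_option (D : finType) (F : option D -> nat) :
  \sum_(v : option D) F v = F None + \sum_(d : D) F (Some d).
Proof.
rewrite (bigD1 None) //=; congr (_ + _).
rewrite (reindex_omap Some id) /=; first by apply: eq_bigl => d; rewrite eqxx.
by case.
Qed.

Section PlanarLemmas.
Context (D : finType) (dc : D -> color) (c : color) (T : pretangle dc c).

Lemma incident_sym : connect_sym (@incident _ _ _ T).
Proof. by apply: sym_connect_sym => -[x|x] [y|y]. Qed.

Lemma adjacent_sym : connect_sym (@adjacent _ _ _ T).
Proof.
apply: sym_connect_sym => r r'; apply/existsP/existsP => -[e /existsP[b H]];
  by exists e; apply/existsP; exists (~~ b); rewrite negbK andbC.
Qed.

Lemma adjacent1 (e : strand T) b : connect (@adjacent _ _ _ T) (side e b) (side e (~~ b)).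
Proof.
by apply: connect1; apply/existsP; exists e; apply/existsP; exists b; rewrite !eqxx.
Qed.

Lemma incident1 v i : connect (@incident _ _ _ T) (inl v) (inr (strand_at T v i)).
Proof. by apply: connect1; apply/existsP; exists i. Qed.

Lemma incident1' v i : connect (@incident _ _ _ T) (inr (strand_at T v i)) (inl v).
Proof. by rewrite incident_sym incident1. Qed.

Lemma connected_from (r0 : region T) :
  (forall r, connect (@adjacent _ _ _ T) r0 r) ->
  forall r r', connect (@adjacent _ _ _ T) r r'.
Proof. by move=> H r r'; apply: (connect_trans _ (H r')); rewrite adjacent_sym. Qed.
End PlanarLemmas.

Arguments incident_sym {D dc c} T x y.
Arguments adjacent_sym {D dc c} T x y.
Arguments adjacent1 {D dc c} T e b.
Arguments incident1 {D dc c} T v i.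
Arguments incident1' {D dc c} T v i.



Lemma closed_no_point (s : bool) (v : option void)
  (i : point (bcolor (of_void color) (0, s) v)) : False.
Proof. by case: v i => [[]|] []. Qed.

(* Empty tangle *)
Definition empty_pre (s : bool) : @pretangle void (of_void color) (0, s) := {|
  strand := void;
  region := unit;
  strand_at := fun v => match v return point (bcolor (of_void color) (0, s) v) -> void with
    | Some d => fun _ => d
    | None => fun i => False_rect void (notF (ltn_ord i)) end;
  region_at := fun _ _ => tt;
  side := fun e _ => match e with end;
  shade := fun _ => s |}.

Lemma empty_planar s : is_planar (empty_pre s).
Proof.
apply: IsPlanar.
- by case=> [[]|] // i; rewrite ord1 addbF.
- by [].
- by move=> v i; case: (closed_no_point i).
- by move=> v i; case: (closed_no_point i).
- by move=> v w i; case: (closed_no_point i).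
- by move=> v i; case: (closed_no_point i).
- by case=> [] []; exact: connect0.
rewrite (@n_comp_connected _ _ (incident_sym (empty_pre s)) (inl None)).
  by rewrite card_option !card_unit card_void big_option big1 // => -[].
by case=> [[[]|]|[]]; exact: connect0.
Qed.

Definition empty_tangle s := Tangle (empty_planar s).

(* A single closed loop. *)
Definition loop_pre (s : bool) : @pretangle void (of_void color) (0, s) := {|
  strand := unit;
  region := bool;
  strand_at := fun _ _ => tt;
  region_at := fun _ _ => s;
  side := fun _ b => b;
  shade := fun b => b |}.

Lemma loop_planar s : is_planar (loop_pre s).
Proof.
apply: IsPlanar.
- by case=> [[]|] // i; rewrite ord1 addbF.
- by [].
- by move=> v i; case: (closed_no_point i).
- by move=> v i; case: (closed_no_point i).
- by move=> v w i; case: (closed_no_point i).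
- by move=> v i; case: (closed_no_point i).
- by apply: (@connected_from _ _ _ (loop_pre s) true) => -[]; [exact: connect0|exact: (adjacent1 (loop_pre s) tt true)].
have nc : forall b, ~~ connect (@incident _ _ _ (loop_pre s)) (inl None) (inr b).
  move=> b; apply/negP => /connectP[[|[v|e] p] //=].
    by case/andP => /existsP[[]].
rewrite (@n_comp_label _ _ (incident_sym (loop_pre s)) bool (fun x => if x is inl _ then true else false)).
- by rewrite /= card_option !card_bool card_void big_option big1 // => -[].
- by case; [exists (inl None)|exists (inr tt)].
have nc' b : ~~ connect (@incident _ _ _ (loop_pre s)) (inr b) (inl None).
  by rewrite (incident_sym (loop_pre s)).
by move=> [[[]|]|[]] [[[]|]|[]] /=;
  rewrite ?connect0 ?(negbTE (nc _)) ?(negbTE (nc' _)).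
Qed.

Definition loop_tangle s := Tangle (loop_planar s).

(* In a box drawn as a rectangle, with the marked interval on the left, the
   points [0, ..., n-1] are on the top side from left to right, and
   [n, ..., 2n-1] are on the bottom side from right to left.  [column] is the
   column of a point, and [gap] the column of an interval: the gap [g] is the
   one on the left of the column [g]. *)
Lemma column_subproof n (p : 'I_(n.*2)) : (if p < n then p : nat else n.*2 - p.+1) < n.
Proof. by case: ifP => // /negbT; have := ltn_ord p;  lia. Qed.

Definition column n (p : 'I_(n.*2)) : 'I_n := Ordinal (column_subproof p).

Definition gap n (j : 'I_(n.*2.-1.+1)) : 'I_n.+1 :=
  inord (if j <= n then j : nat else n.*2 - j).

Lemma gapE n (j : 'I_(n.*2.-1.+1)) : gap j = (if j <= n then j : nat else n.*2 - j) :> nat.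
Proof. by rewrite inordK //; case: j => j /=;  case: ifP; lia. Qed.

#[local] Arguments before : simpl never.
#[local] Arguments after : simpl never.

Lemma beforeE c (i : point c) : before i = i :> nat.
Proof. by rewrite /before /= modn_small // prednK //; case: i => i /=; case: (npts c). Qed.

Lemma afterE c (i : point c) : after i = (if i.+1 < npts c then i.+1 else 0) :> nat.
Proof.
have e : (npts c).-1.+1 = npts c by case: i => i /=; case: (npts c).
rewrite /after /= e; case: ltnP => [/modn_small //|le].
have -> : i.+1 = npts c by apply/eqP; rewrite eqn_leq ltn_ord le.
by rewrite modnn.
Qed.

Lemma odd_double_subS n p : p < n.*2 -> odd (n.*2 - p.+1) = ~~ odd p.
Proof. by move=> lp; rewrite oddB // odd_double. Qed.

Lemma odd_double_sub n p : p <= n.*2 -> odd (n.*2 - p) = odd p.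
Proof. by move=> lp; rewrite oddB // odd_double. Qed.

Lemma gap_before n s (p : point (n, s)) :
  gap (before p : 'I_(n.*2.-1.+1)) = column p + (n <= p) :> nat.
Proof.
rewrite gapE (beforeE p) /=; case: p => p; rewrite /npts /= => lp.
by case: (ltnP p n) => h; case: (leqP p n) => h'; lia.
Qed.

Lemma gap_after n s (p : point (n, s)) :
  gap (after p : 'I_(n.*2.-1.+1)) = column p + (p < n) :> nat.
Proof.
rewrite gapE (afterE p) /=; case: p => p; rewrite /npts /= => lp.
by case: (ltnP p n) => h; case: (ltnP p.+1 n.*2) => h' /=; rewrite ?leq0n; try case: ifP; lia.
Qed.

Lemma odd_column n (p : 'I_(n.*2)) : odd (column p) = (n <= p) (+) odd p.
Proof. by rewrite /=; case: ltnP => // h; rewrite odd_double_subS. Qed.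

Lemma odd_gap n (j : 'I_(n.*2.-1.+1)) : odd (gap j) = odd j.
Proof.
by rewrite gapE; case: leqP => // _; rewrite odd_double_sub //; case: j => j /=; lia.
Qed.

Lemma column_inj n (p q : 'I_(n.*2)) :
  column p = column q -> (p < n) = (q < n) -> p = q.
Proof.
move=> /(congr1 (@nat_of_ord _)) /= h e; apply: ord_inj; move: h; rewrite e.
move: e; case: p => p /= lp; case: q => q /= lq.
by case: (ltnP p n); case: (ltnP q n); lia.
Qed.

Lemma column_rev n (p : 'I_(n.*2)) : column (rev_ord p) = column p.
Proof.
apply: ord_inj; case: p => p lp /=.
by case: (ltnP p n); case: (ltnP (n.*2 - p.+1) n); lia.
Qed.

(* The closure of a box, joining its point [i] to its point [2n-1-i] around its
   right hand side. *)
Definition trace_pre (n : nat) (s : bool) :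
    @pretangle unit (fun _ => (n, s)) (0, s) := {|
  strand := 'I_n;
  region := 'I_n.+1;
  strand_at := fun v =>
    match v return point (bcolor (fun _ : unit => (n, s)) (0, s) v) -> 'I_n with
    | Some _ => fun p => column p
    | None => fun i => False_rect _ (notF (ltn_ord i)) end;
  region_at := fun v =>
    match v return interval (bcolor (fun _ : unit => (n, s)) (0, s) v) -> 'I_n.+1 with
    | Some _ => fun j => gap j
    | None => fun _ => ord0 end;
  side := fun k b => inord (if b == s (+) odd k then k : nat else k.+1);
  shade := fun g => s (+) odd g |}.

Lemma trace_planar n s : is_planar (trace_pre n s).
Proof.
have sideE (k : 'I_n) b : @side _ _ _ (trace_pre n s) k b =
    k + (b != s (+) odd k) :> nat.
  rewrite /= inordK; first by case: eqP; lia.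
  by case: k => k lk /=; case: eqP; lia.
apply: IsPlanar.
- by case=> [[]|] /= j; rewrite ?ord1 ?addbF // odd_gap.
- move=> k b; rewrite /shade /= -/(side (p := trace_pre n s) k b) [X in odd X]sideE.
  by rewrite oddD oddb; case: b (s) (odd k) => [] [] [].
- case=> [[]|] p; last by case: p.
  apply: ord_inj; rewrite [RHS]sideE [LHS]gap_before; congr (_ + _).
  by rewrite odd_column; case: (leqP n p) => _; case: (s) (odd p) => [] [].
- case=> [[]|] p; last by case: p.
  apply: ord_inj; rewrite [RHS]sideE [LHS]gap_after; congr (_ + _).
  by rewrite odd_column; case: (ltnP p n) => _; case: (s) (odd p) => [] [].
- case=> [[]|] [[]|] p q; try by [case: p | case: q].
  rewrite /left_shade /= => e o; split=> //; congr (nat_of_ord _).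
  apply: (column_inj e); have := congr1 (odd \o @nat_of_ord n) e; rewrite /= !odd_column.
  by move/addbI: o => ->; case: (ltnP p n); case: (ltnP q n); case: (odd q).
- case=> [[]|] p; last by case: p.
  exists (Some tt), (rev_ord p); split; first exact: column_rev.
  by rewrite /left_shade /= odd_double_subS ?addbN //; case: p.
- apply: (@connected_from _ _ _ (trace_pre n s) ord0) => -[g].
  elim: g => [|g IHg] lg; first by rewrite (_ : Ordinal lg = ord0) ?connect0 //; apply: ord_inj.
  apply: (connect_trans (IHg (ltnW lg))).
  have := adjacent1 (trace_pre n s) (Ordinal (lg : g < n)) (s (+) odd g).
  congr (connect _ _ _); apply: ord_inj; rewrite [LHS]sideE /= ?eqxx ?addn0 //.
  by case: (s (+) odd g); rewrite addn1.
rewrite (@n_comp_label _ _ (incident_sym (trace_pre n s)) bool (fun x => if x is inl None then true else false)).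
- by rewrite /= card_option card_unit card_ord big_option big_const card_unit card_bool /= addn0; lia.
- by case; [exists (inl None)|exists (inl (Some tt))].
have colS (k : 'I_n) : exists p, column p = k.
  have lk : k < n.*2 by case: k => k /=; lia.
  by exists (Ordinal lk); apply: ord_inj => /=; rewrite ltn_ord.
have nc x : connect (@incident _ _ _ (trace_pre n s)) (inl None) x -> x = inl None.
  case/connectP => [[|[v|e] p] //= /andP[/existsP[[]]]] //.
have ok x : x != inl None -> connect (@incident _ _ _ (trace_pre n s)) (inl (Some tt)) x.
  case: x => [[[]|]|k] // _; rewrite ?connect0 //.
  by have [p <-] := colS k; exact: (incident1 (trace_pre n s) (Some tt)).
move=> x y.
have labE (z : option unit + 'I_n) : (if z is inl None then true else false) = (z == inl None).
  by case: z => [[]|].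
rewrite !labE; have [->|nx] := eqVneq x (inl None).
  by rewrite eq_sym eqb_id; apply/idP/eqP => [/nc //|->]; exact: connect0.
have [->|ny] := eqVneq y (inl None).
  apply/negP; rewrite (incident_sym (trace_pre n s)) => /nc E.
  by rewrite E eqxx in nx.
by apply: connect_trans (ok _ ny); rewrite (incident_sym (trace_pre n s)) ok.
Qed.

Definition trace_tangle n s := Tangle (trace_planar n s).

(* Two boxes stacked vertically, [true] being the one on top.  A strand is
   located by its column and its level: [Some true] for the top, [None] for the
   middle, [Some false] for the bottom.  The gaps [0] and [n] are single regions
   running along all levels; every other gap consists of three regions. *)
Definition mul_level (v : option bool) (up : bool) : option bool :=
  match v with
  | None => Some up
  | Some true => if up then Some true else None
  | Some false => if up then None else Some false
  end.

Definition mul_strand n v (p : 'I_(n.*2)) : 'I_n * option bool :=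
  (column p, mul_level v (p < n)).

Definition mul_gap n (g : nat) (l : option bool) : 'I_n.+1 + 'I_n.-1 * bool :=
  if l is Some b then
    if (if 0 < g then insub g.-1 : option 'I_n.-1 else None) is Some k
    then inr (k, b) else inl (inord g)
  else inl (inord g).

Definition mul_region n v (j : 'I_(n.*2.-1.+1)) : 'I_n.+1 + 'I_n.-1 * bool :=
  mul_gap n (gap j) (mul_level v (j <= n)).

Definition mul_pre (n : nat) (s : bool) :
    @pretangle bool (fun _ => (n, s)) (n, s) := {|
  strand := ('I_n * option bool)%type;
  region := ('I_n.+1 + 'I_n.-1 * bool)%type;
  strand_at := fun v =>
    match v return point (bcolor (fun _ : bool => (n, s)) (n, s) v) -> 'I_n * option bool with
    | Some b => mul_strand (Some b) | None => mul_strand None end;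
  region_at := fun v =>
    match v return interval (bcolor (fun _ : bool => (n, s)) (n, s) v) -> 'I_n.+1 + 'I_n.-1 * bool with
    | Some b => mul_region (Some b) | None => mul_region None end;
  side := fun e b =>
    mul_gap n (if b == s (+) odd e.1 then e.1 : nat else e.1.+1) e.2;
  shade := fun r =>
    match r with inl g => s (+) odd g | inr (k, _) => s (+) ~~ odd k end |}.

Lemma mul_gapE n g l l' : g <= n -> (0 < g < n -> l = l') ->
  mul_gap n g l = mul_gap n g l'.
Proof.
move=> gn h; case: (boolP (0 < g < n)) => [/h -> //|h'].
have e : (if 0 < g then insub g.-1 : option 'I_n.-1 else None) = None.
  by case: ifP => // g0; rewrite insubF //; lia.
by case: l {h} => [b|]; case: l' => [b'|] //=; rewrite e.
Qed.

Lemma mul_gap_in n g b (k : 'I_n.-1) : g = k.+1 -> mul_gap n g (Some b) = inr (k, b).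
Proof. by move=> -> /=; rewrite valK. Qed.

Lemma mul_shade n s g l : g <= n -> shade (p := mul_pre n s) (mul_gap n g l) = s (+) odd g.
Proof.
move=> gn; case: l => [b|] /=; last by rewrite inordK.
case: ifP => g0; last by rewrite /= inordK.
case: insubP => [k _ /= ->|_] /=; last by rewrite inordK.
by congr (_ (+) _); rewrite -oddS prednK.
Qed.

Lemma mul_planar n s : is_planar (mul_pre n s).
Proof.
have sideE (k : 'I_n) l b : @side _ _ _ (mul_pre n s) (k, l) b =
    mul_gap n (k + (b != s (+) odd k)) l.
  by rewrite /=; case: eqP; rewrite ?addn0 ?addn1.
have sh v (j : 'I_(n.*2.-1.+1)) :
    shade (p := mul_pre n s) (mul_region v j) = s (+) odd j.
  by rewrite mul_shade ?odd_gap // -ltnS.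
have bef v (p : point (n, s)) : mul_region v (before p : 'I_(n.*2.-1.+1)) =
    @side _ _ _ (mul_pre n s) (mul_strand v p) (s (+) odd p).
  rewrite sideE /mul_region gap_before odd_column.
  have -> : s (+) odd p != s (+) ((n <= p) (+) odd p) = (n <= p).
    by case: (n <= p) (s) (odd p) => [] [] [].
  rewrite (beforeE p); apply: mul_gapE; first by rewrite -gap_before -ltnS.
  case: p => p; rewrite /npts /= => lp; case: (ltnP p n) => h; case: (leqP p n) => h';
    rewrite ?addn0 ?addn1; by [|move=> ?; exfalso; lia].
have aft v (p : point (n, s)) : mul_region v (after p : 'I_(n.*2.-1.+1)) =
    @side _ _ _ (mul_pre n s) (mul_strand v p) (~~ (s (+) odd p)).
  rewrite sideE /mul_region gap_after odd_column.
  have -> : ~~ (s (+) odd p) != s (+) ((n <= p) (+) odd p) = (p < n).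
    by rewrite ltnNge; case: (n <= p) (s) (odd p) => [] [] [].
  rewrite (afterE p); apply: mul_gapE; first by rewrite -gap_after -ltnS.
  case: p => p; rewrite /npts /= => lp; case: (ltnP p n) => h; case: (ltnP p.+1 n.*2) => h';
    rewrite ?addn0 ?addn1 //; rewrite ?(leq0n n); try case: (leqP p.+1 n) => h''; by [|move=> ?; exfalso; lia].
have ls v (p : point (bcolor (fun _ : bool => (n, s)) (n, s) v)) :
    left_shade p = ~~ v (+) s (+) odd p by case: v p.
have rv (p : 'I_(n.*2)) : (rev_ord p < n) = (n <= p).
  by case: p => p lp /=; lia.
apply: IsPlanar.
- by case=> [v|] j; exact: sh.
- case=> k l b; rewrite sideE mul_shade; last by case: k => k lk /=; case: eqP; lia.
  by rewrite oddD oddb; case: b (s) (odd k) => [] [] [].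
- by case=> [v|] p; exact: bef.
- by case=> [v|] p; exact: aft.
- have inj v w (p q : 'I_(n.*2)) : mul_strand v p = mul_strand w q ->
      ~~ v (+) s (+) odd p = ~~ w (+) s (+) odd q -> v = w /\ p = q :> nat.
    case=> ecol elev; have := congr1 odd ecol; rewrite -/(nat_of_ord (column p)).
    rewrite -/(nat_of_ord (column q)) !odd_column => ho hs.
    have ec : column p = column q by apply: ord_inj.
    suff [-> e] : v = w /\ (p < n) = (q < n) by split=> //; rewrite (column_inj ec e).
    move: ho hs elev; rewrite [p < n]ltnNge [q < n]ltnNge.
    by case: v => [[]|]; case: w => [[]|];
      case: (n <= p); case: (n <= q); case: (s); case: (odd p); case: (odd q).
  move=> v w p q; rewrite !ls.
  by case: v p => [v|] p; case: w q => [w|] q; exact: inj.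
- have par v (p : 'I_(n.*2)) : exists w (q : 'I_(n.*2)),
      mul_strand w q = mul_strand v p /\
      ~~ w (+) s (+) odd q = ~~ (~~ v (+) s (+) odd p).
    case: (boolP (if v is Some b then b (+) (p < n) else false)) => h.
      exists (if v is Some b then Some (~~ b) else None), (rev_ord p); split.
        rewrite /mul_strand column_rev; congr (_, _); rewrite rv leqNgt.
        by case: v h => [[]|] //=; case: (p < n).
      rewrite /= odd_double_subS //.
      by case: v h => [[]|] //=; case: (s); case: (odd p).
    exists (if v is Some b then None else Some (p < n)), p; split.
      rewrite /mul_strand; congr (_, _).
      by case: v h => [[]|] //=; case: (p < n).
    by case: v h => [[]|] //=; case: (s); case: (odd p).
  case=> [v|] p.
    have [[w|] [q [e1 e2]]] := par (Some v) p; [exists (Some w), q | exists None, q];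
      by split=> //; rewrite !ls.
  have [[w|] [q [e1 e2]]] := par None p; [exists (Some w), q | exists None, q];
    by split=> //; rewrite !ls.
- have adj (k : 'I_n) l : connect (@adjacent _ _ _ (mul_pre n s))
      (mul_gap n k l) (mul_gap n k.+1 l).
    have := adjacent1 (mul_pre n s) (k, l) (s (+) odd k).
    by rewrite !sideE eqxx addn0; case: (s (+) odd k); rewrite addn1.
  have all g l : g <= n -> connect (@adjacent _ _ _ (mul_pre n s))
      (mul_gap n 0 None) (mul_gap n g l).
    elim: g => [|g IHg] lg; first by rewrite (@mul_gapE n 0 l None) ?connect0.
    exact: connect_trans (IHg (ltnW lg)) (adj (Ordinal lg) l).
  apply: (@connected_from _ _ _ (mul_pre n s) (mul_gap n 0 None)) => -[g|[k b]].
    by have := all g None; rewrite /= inord_val; apply; rewrite -ltnS.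
  by rewrite -(@mul_gap_in n k.+1 b k) //; apply: all; case: k => k /=; lia.
have cardE : #|{: option bool}| + #|region (mul_pre n s)| = 3 + (n.+1 + n.-1 * 2).
  by rewrite /= card_option card_sum card_prod !card_ord card_bool.
have sumE : \sum_(v : option bool) (bcolor (fun _ : bool => (n, s)) (n, s) v).1 = n + n.*2.
  by rewrite big_option big_const card_bool /=; lia.
rewrite cardE sumE.
case: (posnP n) => n0.
  have e0 : strand (mul_pre n s) -> False by case; rewrite n0 => -[].
  have noc x y : connect (@incident _ _ _ (mul_pre n s)) x y = (x == y).
    apply/idP/eqP => [/connectP[[|z p] //=]|->]; last exact: connect0.
    by case: x => [v|e]; [case: z => [w|e]; [|case: (e0 e)]|case: (e0 e)].
  rewrite (@n_comp_label _ _ (incident_sym (mul_pre n s)) (option bool)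
    (fun x => if x is inl v then v else None)).
  - by rewrite card_option card_bool; lia.
  - by move=> v; exists (inl v).
  - by move=> [v|e] [w|f]; [rewrite noc|case: (e0 f)|case: (e0 e)|case: (e0 e)].
rewrite (@n_comp_connected _ _ (incident_sym (mul_pre n s)) (inl None)); first by lia.
have n0' : 0 < n.*2 by lia.
have up (k : 'I_n) : exists2 p : 'I_(n.*2), column p = k & p < n.
  have lk : k < n.*2 by case: k => k /=; lia.
  by exists (Ordinal lk); [apply: ord_inj; rewrite /= ltn_ord|exact: ltn_ord k].
have dn (k : 'I_n) : exists2 p : 'I_(n.*2), column p = k & n <= p.
  by have [p <- ?] := up k; exists (rev_ord p); rewrite ?column_rev // leqNgt rv -ltnNge.
have step v (p : 'I_(n.*2)) :
    connect (@incident _ _ _ (mul_pre n s)) (inl v) (inr (mul_strand v p)).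
  by case: v => [v|]; [exact: (incident1 (mul_pre n s) (Some v))
                      |exact: (incident1 (mul_pre n s) None)].
have step' v (p : 'I_(n.*2)) :
    connect (@incident _ _ _ (mul_pre n s)) (inr (mul_strand v p)) (inl v).
  by rewrite (incident_sym (mul_pre n s)).
have top (k : 'I_n) b :
    connect (@incident _ _ _ (mul_pre n s)) (inl None) (inr (k, Some b)).
  case: b.
    have [p <- h] := up k; have := step None p; by rewrite /mul_strand h.
  have [p <- h] := dn k; have := step None p; by rewrite /mul_strand ltnNge h.
have box b : connect (@incident _ _ _ (mul_pre n s)) (inl None) (inl (Some b)).
  apply: connect_trans (top (Ordinal n0) b) _.
  case: b.
    have [p <- h] := up (Ordinal n0); have := step' (Some true) p; by rewrite /mul_strand h.
  have [p <- h] := dn (Ordinal n0); have := step' (Some false) p; by rewrite /mul_strand ltnNge h.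
case=> [[b|]|[k [b|]]] //; rewrite ?connect0 //.
apply: connect_trans (box true) _.
have [p <- h] := dn k; have := step (Some true) p; by rewrite /mul_strand ltnNge h.
Qed.

Definition mul_tangle n s := Tangle (mul_planar n s).

(* Rotation of a 2-box by 90 degrees clockwise: the point [i] of the inner disc
   is joined to the point [i+1] of the outer disc. *)
Definition rot_pre (s t : bool) : @pretangle unit (fun _ => (2, s)) (2, t) := {|
  strand := 'I_4;
  region := 'I_4;
  strand_at := fun v =>
    match v return point (bcolor (fun _ : unit => (2, s)) (2, t) v) -> 'I_4 with
    | Some _ => fun p => p
    | None => fun p => inZp (p + 3) end;
  region_at := fun v =>
    match v return interval (bcolor (fun _ : unit => (2, s)) (2, t) v) -> 'I_4 with
    | Some _ => fun j => j
    | None => fun j => inZp (j + 3) end;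
  side := fun e b => if b == s (+) odd e then e else inZp e.+1;
  shade := fun r => s (+) odd r |}.

Lemma rot_planar s t : t = ~~ s -> is_planar (rot_pre s t).
Proof.
move=> ->; apply: IsPlanar.
- by case=> [[]|] [[|[|[|[|]]]] ?] //=; case: (s).
- by case=> [[|[|[|[|]]]] ?] //= [] /=; case: (s).
- by case=> [[]|] [[|[|[|[|]]]] ?] //; case: (s); apply: ord_inj.
- by case=> [[]|] [[|[|[|[|]]]] ?] //; case: (s); apply: ord_inj.
- move=> v w i j /(congr1 (@nat_of_ord 4)); rewrite /left_shade.
  by case: v i => [[]|] [[|[|[|[|]]]] ?] //; case: w j => [[]|] [[|[|[|[|]]]] ?] //;
    case: (s).
- case=> [[]|] p; [exists None, (inZp p.+1) | exists (Some tt), (inZp (p + 3))];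
    case: p => [[|[|[|[|]]]] ?] //; split; try exact: ord_inj; by case: (s).
- apply: (@connected_from _ _ _ (rot_pre s (~~ s)) ord0).
  have step (e : 'I_4) : connect (@adjacent _ _ _ (rot_pre s (~~ s))) e (inZp e.+1).
    have := adjacent1 (rot_pre s (~~ s)) e (s (+) odd e).
    by rewrite /= eqxx; case: (s (+) odd e).
  have all k : connect (@adjacent _ _ _ (rot_pre s (~~ s))) ord0 (inZp k).
    elim: k => [|k IHk]; first by rewrite (_ : inZp 0 = ord0) ?connect0 //; apply: ord_inj.
    apply: connect_trans IHk _; have := step (inZp k); congr (connect _ _ _).
    by apply: ord_inj => /=; rewrite -[in LHS]addn1 -[in RHS]addn1 modnDml.
  by move=> r; rewrite -(valZpK r).
rewrite (@n_comp_connected _ _ (incident_sym (rot_pre s (~~ s))) (inl None)).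
  by rewrite /= card_option card_unit card_ord big_option big_const card_unit.
have str e : connect (@incident _ _ _ (rot_pre s (~~ s))) (inl (Some tt)) (inr e).
  exact: (incident1 (rot_pre s (~~ s)) (Some tt) e).
have out : connect (@incident _ _ _ (rot_pre s (~~ s))) (inl (Some tt)) (inl None).
  exact: connect_trans (str _) (incident1' (rot_pre s (~~ s)) None ord0).
move=> x; apply: (@connect_trans _ _ (inl (Some tt))).
  by rewrite (incident_sym (rot_pre s (~~ s))).
by case: x => [[[]|]|e].
Qed.

Definition rot_tangle s t (st : t = ~~ s) := Tangle (rot_planar st).

(* Two 2-boxes side by side, [true] being the one on the left, whose top right
   (resp. bottom right) point is joined to the top left (resp. bottom left)
   point of the other.  [inr true] and [inr false] are the upper and the lower
   inner strings, and [None] is the region between the two boxes. *)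
Definition i4 (k : nat) : 'I_4 := inZp k.

Definition coprod_strand (b : bool) (p : 'I_4) : 'I_4 + bool :=
  match b, val p with
  | true, 1 => inr true
  | true, 2 => inr false
  | false, 0 => inr true
  | false, 3 => inr false
  | _, _ => inl p
  end.

Definition coprod_region (b : bool) (j : 'I_4) : option 'I_4 :=
  match b, val j with
  | true, 2 | false, 0 => None
  | _, _ => Some j
  end.

Definition coprod_pre (s : bool) : @pretangle bool (fun _ => (2, s)) (2, s) := {|
  strand := ('I_4 + bool)%type;
  region := option 'I_4;
  strand_at := fun v =>
    match v return point (bcolor (fun _ : bool => (2, s)) (2, s) v) -> 'I_4 + bool with
    | Some b => coprod_strand b
    | None => fun p => inl p end;
  region_at := fun v =>
    match v return interval (bcolor (fun _ : bool => (2, s)) (2, s) v) -> option 'I_4 with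
    | Some b => coprod_region b
    | None => fun j => Some j end;
  side := fun e b =>
    match e with
    | inl p => Some (if b == s (+) odd p then p else inZp p.+1)
    | inr up => if b == s then None else Some (if up then i4 1 else i4 3)
    end;
  shade := fun r => if r is Some j then s (+) odd j else s |}.

Lemma coprod_planar s : is_planar (coprod_pre s).
Proof.
apply: IsPlanar.
- by case=> [[]|] [[|[|[|[|]]]] ?] //=; case: (s).
- by case=> [[[|[|[|[|]]]] ?]|[]] //= [] /=; case: (s).
- by case=> [[]|] [[|[|[|[|]]]] ?] //; case: (s) => /=; do ?[congr Some; exact: ord_inj].
- by case=> [[]|] [[|[|[|[|]]]] ?] //; case: (s) => /=; do ?[congr Some; exact: ord_inj].
- move=> v w i j; rewrite /left_shade.
  by case: v i => [[]|] [[|[|[|[|]]]] ?] //; case: w j => [[]|] [[|[|[|[|]]]] ?] //;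
    case: (s).
- case=> [[]|] [[|[|[|[|]]]] ?] //.
  all: try by exists None; eexists (Ordinal _); split;
    [congr inl; exact: ord_inj|case: (s)].
  + by exists (Some false), (i4 0); split=> //; case: (s).
  + by exists (Some false), (i4 3); split=> //; case: (s).
  + by exists (Some true), (i4 1); split=> //; case: (s).
  + by exists (Some true), (i4 2); split=> //; case: (s).
  + by exists (Some true), (i4 0); split; [congr inl; exact: ord_inj|case: (s)].
  + by exists (Some false), (i4 1); split; [congr inl; exact: ord_inj|case: (s)].
  + by exists (Some false), (i4 2); split; [congr inl; exact: ord_inj|case: (s)].
  + by exists (Some true), (i4 3); split; [congr inl; exact: ord_inj|case: (s)].
- apply: (@connected_from _ _ _ (coprod_pre s) (Some ord0)).
  have step (e : 'I_4) : connect (@adjacent _ _ _ (coprod_pre s)) (Some e) (Some (inZp e.+1)).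
    have := adjacent1 (coprod_pre s) (inl e) (s (+) odd e).
    by rewrite /= eqxx; case: (s (+) odd e).
  have all k : connect (@adjacent _ _ _ (coprod_pre s)) (Some ord0) (Some (inZp k)).
    elim: k => [|k IHk]; first by rewrite (_ : inZp 0 = ord0) ?connect0 //; apply: ord_inj.
    apply: connect_trans IHk _; have := step (inZp k); congr (connect _ _ (Some _)).
    by apply: ord_inj => /=; rewrite -[in LHS]addn1 -[in RHS]addn1 modnDml.
  case=> [r|]; first by rewrite -(valZpK r).
  apply: connect_trans (all 1) _.
  by have := adjacent1 (coprod_pre s) (inr true) (~~ s); rewrite /=; case: (s).
rewrite (@n_comp_connected _ _ (incident_sym (coprod_pre s)) (inl None)).
  by rewrite /= !card_option card_bool card_ord big_option big_const card_bool.
have str e : connect (@incident _ _ _ (coprod_pre s)) (inl None) (inr (inl e)).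
  exact: (incident1 (coprod_pre s) None e).
have box b : connect (@incident _ _ _ (coprod_pre s)) (inl None) (inl (Some b)).
  apply: connect_trans (str (if b then i4 0 else i4 1)) _.
  by case: b; [exact: (incident1' (coprod_pre s) (Some true) (i4 0))
              |exact: (incident1' (coprod_pre s) (Some false) (i4 1))].
case=> [[b|]|[e|b]]; [exact: box|exact: connect0|exact: str|].
apply: connect_trans (box true) _.
by case: b; [exact: (incident1 (coprod_pre s) (Some true) (i4 1))
            |exact: (incident1 (coprod_pre s) (Some true) (i4 2))].
Qed.

Definition coprod_tangle s := Tangle (coprod_planar s).

(** * Planar algebras *)

Local Open Scope ring_scope.
Local Open Scope complex_scope.
Local Open Scope classical_set_scope.

Record planarAlgebra (R : realType) := PlanarAlgebra {
  box :> color -> vectType R[i];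
  act : forall (D : finType) (dc : D -> color) (c : color),
    tangle dc c -> (forall d, box (dc d)) -> box c;
  act_multilinear : forall (D : finType) (dc : D -> color) (c : color)
    (T : tangle dc c) (v : forall d, box (dc d)) (d : D) (a : R[i]) (x y : box (dc d)),
    act T (@dfwith D (fun e => box (dc e)) v d (a *: x + y)) = 
      a *: act T (@dfwith D (fun e => box (dc e)) v d x) +
      act T (@dfwith D (fun e => box (dc e)) v d y);
  act_isotopic : forall (D D' : finType) (dc : D -> color) (c : color) (f : D' -> D)
    (T' : tangle (dc \o f) c) (T : tangle dc c),
    bijective f -> isotopic T' T ->
    forall v : (forall d, box (dc d)), act T' (fun d' => v (f d')) = act T v;
  act_identity : forall (c : color) (T : tangle (fun _ : unit => c) c),
    is_identity T -> forall x : box c, act T (fun _ => x) = x;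
  act_glued : forall (D : finType) (dc : D -> color) (c : color) (T : tangle dc c)
    (E : D -> finType) (ec : forall d, E d -> color)
    (S : forall d, tangle (ec d) (dc d)) (U : tangle (glue_color ec) c),
    glued T S U ->
    forall v : (forall d e, box (ec d e)),
      act U (fun u => v (tag u) (tagged u)) = act T (fun d => act (S d) (v d));
  star : forall c, box c -> box c;
  star_semilinear : forall c (a : R[i]) (x y : box c),
    star (a *: x + y) = conjc a *: star x + star y;
  starK : forall c, involutive (@star c);
  act_mirror : forall (D : finType) (dc : D -> color) (c : color) (T T' : tangle dc c),
    mirror T T' ->
    forall v : (forall d, box (dc d)), star (act T v) = act T' (fun d => star (v d)) }.

Arguments act {R} p {D dc c} T v.
Arguments star {R p c} x.

Section Operations.
Context (R : realType) (P : planarAlgebra R).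

Definition empty_box (s : bool) : P (0, s)%N :=
  act P (empty_tangle s) (fun d : void => match d with end).

(* The scalar [a] such that [x = a *: empty_box s], when [P (0, s)] has
   dimension 1. *)
Definition scalar_of (s : bool) (x : P (0, s)%N) : R[i] :=
  coord [tuple empty_box s] ord0 x.

Definition loop_value : R[i] :=
  scalar_of (act P (loop_tangle true) (fun d : void => match d with end)).

(* In the product [mul x y], the box [y] is on top of [x]: this is the order for
   which [coprod x y] is the Fourier transform of the product of the inverse
   Fourier transforms of [x] and [y], in this order. *)
Definition mul (n : nat) (s : bool) (x y : P (n, s)) : P (n, s) :=
  act P (mul_tangle n s) (fun top : bool => if top then y else x).

Definition tr (n : nat) (s : bool) (x : P (n, s)) : R[i] :=
  scalar_of (act P (trace_tangle n s) (fun _ : unit => x)).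

Definition fourier_to (s t : bool) (st : t = ~~ s) (x : P (2, s)) : P (2, t) :=
  act P (rot_tangle st) (fun _ : unit => x).

Definition fourier (s : bool) : P (2, s) -> P (2, ~~ s) := fourier_to (erefl (~~ s)).

Definition contragredient (s : bool) (x : P (2, s)) : P (2, s) :=
  fourier_to (esym (negbK s)) (fourier x).

Definition coprod (s : bool) (x y : P (2, s)) : P (2, s) :=
  act P (coprod_tangle s) (fun left : bool => if left then x else y).

End Operations.

Record subfactorPlanarAlgebra (R : realType) := SubfactorPlanarAlgebra {
  planar_algebra_of :> planarAlgebra R;
  dim_closed : forall s, \dim {: planar_algebra_of (0, s)} = 1%N;
  spherical : forall (D : finType) (dc : D -> color) (s s' : bool)
    (T' : tangle dc (0, s')) (T : tangle dc (0, s)),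
    sphere_isotopic T' T ->
    forall v : (forall d, planar_algebra_of (dc d)),
      scalar_of (act planar_algebra_of T' v) = scalar_of (act planar_algebra_of T v);
  trace_posdef : forall n s (x : planar_algebra_of (n, s)),
    x != 0 -> 0 < tr (mul (star x) x) }.

Definition irreducible (R : realType) (P : planarAlgebra R) : Prop :=
  forall s, \dim {: P (1, s)} = 1%N.

(** * Norms, biprojections and block maps *)

Section BlockMaps.
Context (R : realType) (P : subfactorPlanarAlgebra R) (s : bool).
Implicit Types x y p : P (2, s).

Definition positive x : Prop := exists y, x = mul (star y) y.

(* The positive square root of [x^* x]. *)
Definition modulus x : P (2, s) :=
  xget 0 [set a | positive a /\ mul a a = mul (star x) x].

(* [tr_2 (|x|^p)^(1/p)] for an integer [p >= 1]; only [p = 1] and [p = 2] are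
   needed. *)
Definition pnorm (p : nat) x : R :=
  complex.Re (tr (iter p.-1 (mul (modulus x)) (modulus x))) `^ (p%:R^-1).

(* The operator norm of the left multiplication by [x]. *)
Definition opnorm x : R :=
  sup [set pnorm 2 (mul x y) | y in [set y | pnorm 2 y <= 1]].

Definition block_cm x : P (2, s) :=
  (loop_value P ^+ 2 / (pnorm 1 x * pnorm 2 x ^+ 2)%:C) *:
  mul (coprod (contragredient (star x)) x) (coprod (contragredient x) (star x)).

Definition block_mc x : P (2, s) :=
  (loop_value P / (opnorm x * pnorm 2 x ^+ 2)%:C) *:
  coprod (mul (contragredient x) (contragredient (star x))) (mul (star x) x).

Definition block (lam : R) x : P (2, s) :=
  if x == 0 then 0 else lam%:C *: block_cm x + (1 - lam)%:C *: block_mc x.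

Definition converges_to (u : nat -> P (2, s)) x : Prop :=
  (fun n => pnorm 2 (u n - x)) @ \oo --> (0 : R).

End BlockMaps.

Definition projection (R : realType) (P : planarAlgebra R) (s : bool) (p : P (2, s)) : Prop :=
  mul p p = p /\ star p = p.

Definition biprojection (R : realType) (P : planarAlgebra R) (s : bool) (p : P (2, s)) : Prop :=
  projection p /\
  exists (a : R[i]) (q : P (2, ~~ s)), projection q /\ fourier p = a *: q.

Definition positive_multiple_of_biprojection
    (R : realType) (P : planarAlgebra R) (s : bool) (x : P (2, s)) : Prop :=
  exists (a : R) (p : P (2, s)), [/\ 0 < a, biprojection p & x = a%:C *: p].

(* Main.v *)
Require Import Defs.
From HB Require Import structures.
From mathcomp Require Import all_boot all_order all_algebra complex zify ring lra.
From mathcomp Require Import all_classical all_reals all_analysis.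
From Stdlib Require Import Relations.

(** Write [d] for the loop value, [F] for the string Fourier transform and [tau] for the
    trace, and call [x] bipositive if [x] and [F x] are both positive.  For such an [x]
    put [a = tau x], [b = tau (F x)] and [q = tau (x x)].

    Whatever [x] is, one step of the block map produces a bipositive element
    ([block_bipos]): products of an element and its adjoint are positive, and so are
    coproducts of those, because pairing them with [y y^*] gives the squared length of a
    three-box ([schur]).

    A bipositive [x] satisfies [x <= b / d], by the Cauchy-Schwarz inequality for two
    three-boxes built from a square root of [F x] ([young], [bipos_bound]), and the bound
    is attained at the Jones element, so it is the operator norm.  Therefore
    [(b / d) x - x x] is positive, of trace [eta / d] with [eta = a b - d q].  By the
    symmetry under [F], the same number controls [(a / d) F x - F x F x].  So
    [eta = 0] exactly when [x] and [F x] are multiples of projections, that is, when [x]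
    is a multiple of a biprojection.

    The argument rests on two inequalities for [eta].  On the one hand the block map
    [B] moves a bipositive [x] by at most a constant times [eta] ([block_error]), as the
    two defects are small and [B x] is built from [x x] and its dual.  On the other
    hand [eta <= b (a - a') + a (b - b')], where [a'] and [b'] belong to [B x] and are
    at most [a] and [b] ([block_decr]).  The fixed points follow at once: there [eta = 0].

    Along an orbit [a] and [b] decrease.  If one of them tends to zero then so does
    [q <= a b / d], and the limit is zero ([orbit_to0]).  Otherwise the constant is
    uniform, [eta] is summable, hence so are the steps, and the orbit converges to a
    bipositive element with [eta = 0] ([orbit_pos]).

    What this uses of planar algebras is a list of identities between concrete
    diagrams.  They hold because the diagrams are isotopic, which is decided by
    evaluation: tangles are coded by lists of numbers ([code]), substitution and
    reflection become programs on codes that agree with the action of tangles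
    ([ev_glue], [ev_mir]), and an isotopy between two codes, if there is one, can be
    read off from their boundary points ([sem_eq], [sem_sphere]). *)

Set Implicit Arguments.
Unset Strict Implicit.
Unset Printing Implicit Defensive.

Import Order.TTheory GRing.Theory Num.Theory.
Import numFieldNormedType.Exports.

Local Open Scope ring_scope.
Local Open Scope nat_scope.

(** * Computable codes of planar tangles *)

Notation bpt c := 'I_(npts c).
Notation bint c := 'I_((npts c).-1.+1).

Section Classes.
Context (T : eqType).

(** [lab] sends every node to the label of its class; an edge relabels one whole class. *)
Fixpoint merge (E : seq (T * T)) (lab : T -> T) : T -> T :=
  if E is (a, b) :: E' then
    let la := lab a in let lb := lab b in
    merge E' (fun x => let l := lab x in if l == la then lb else l)
  else lab.

Definition classes E : T -> T := merge E id.

Lemma classes_rel (Q : T -> T -> Prop) E :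
  (forall x, Q x x) -> (forall x y, Q x y -> Q y x) ->
  (forall x y z, Q x y -> Q y z -> Q x z) ->
  (forall a b, (a, b) \in E -> Q a b) -> forall x, Q x (classes E x).
Proof.
move=> Qr Qs Qt QE; rewrite /classes.
suff gen lab : (forall x, Q x (lab x)) -> forall x, Q x (merge E lab x) by exact: gen.
elim: E QE lab => [|[a b] E IH] QE lab Qlab //=; apply: IH => [a' b' H|x].
  by apply: QE; rewrite inE H orbT.
case: eqP => [e|_]; last exact: Qlab.
apply: (Qt _ _ _ (Qlab x)); rewrite e; apply: (Qt _ _ _ (Qs _ _ (Qlab a))).
by apply: (Qt _ _ _ _ (Qlab b)); apply: QE; rewrite inE eqxx.
Qed.

Lemma merge_eq E lab x y : lab x = lab y -> merge E lab x = merge E lab y.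
Proof. by elim: E lab => [|[a b] E IH] lab //= e; apply: IH; rewrite e. Qed.

Lemma classes_edge E a b : (a, b) \in E -> classes E a = classes E b.
Proof.
rewrite /classes; suff gen lab : (a, b) \in E -> merge E lab a = merge E lab b by exact: gen.
elim: E lab => [|[a' b'] E IH] lab //=; rewrite inE => /orP[/eqP[<- <-]|/IH //].
by apply: merge_eq; rewrite eqxx; case: eqP.
Qed.

(** Only nodes that some equivalence containing the edges relates can receive the
    same label; with [classes_edge], [classes E] decides the equivalence generated by
    [E]. *)
Lemma classes_sound (Q : T -> T -> Prop) E :
  (forall x, Q x x) -> (forall x y, Q x y -> Q y x) ->
  (forall x y z, Q x y -> Q y z -> Q x z) ->
  (forall a b, (a, b) \in E -> Q a b) ->
  forall x y, classes E x = classes E y -> Q x y.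
Proof.
move=> Qr Qs Qt QE x y e; apply: (Qt _ _ _ (classes_rel Qr Qs Qt QE x)).
by rewrite e; exact: (Qs _ _ (classes_rel Qr Qs Qt QE y)).
Qed.
End Classes.

(** A tangle with its strands, regions and discs numbered, so that every clause of
    planarity becomes a boolean that evaluates.  Row [0] of [strs] and [regs] describes
    the outer disc, row [d.+1] the inner disc [d].  Each inner disc carries a label, the
    number of the variable to be put there. *)
Record code := Code {
  ext : color;
  discs : seq (color * nat);
  strs : seq (seq nat);
  regs : seq (seq nat);
  sides : seq (nat * nat);
  shades : seq bool }.

Definition nstr C := size (sides C).
Definition nreg C := size (shades C).
Definition ndisc C := size (discs C).
Definition cols C := ext C :: unzip1 (discs C).
Definition col C v := nth (0, true) (cols C) v.
Definition dcol C d := (nth ((0, true), 0) (discs C) d).1.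
Definition dlab C d := (nth ((0, true), 0) (discs C) d).2.
Definition str C v i := nth 0 (nth [::] (strs C) v) i.
Definition reg C v j := nth 0 (nth [::] (regs C) v) j.
Definition sid C e (b : bool) := let p := nth (0, 0) (sides C) e in if b then p.1 else p.2.
Definition shd C r := nth true (shades C) r.

Lemma colS C d : d < ndisc C -> col C d.+1 = dcol C d.
Proof. by move=> h; rewrite /col /= (nth_map ((0, true), 0)). Qed.

Definition pts C v := iota 0 (npts (col C v)).
Definition ints C v := iota 0 (npts (col C v)).-1.+1.
Definition bnds C := iota 0 (ndisc C).+1.
(** The [left_shade] of a boundary point; [v == 0] is the outer disc. *)
Definition lsh C v i := (v == 0) (+) (col C v).2 (+) odd i.

(** The clauses of [is_planar], quantified over initial segments of [nat].  Connected
    components are counted as classes of the generated equivalence relation; the nodes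
    for Euler's formula are [inl v] for a disc and [inr e] for a strand. *)
Definition planarC C : bool :=
  [&& [&& 0 < nstr C, 0 < nreg C & all (fun v => all (fun i => str C v i < nstr C) (pts C v)) (bnds C)],
   all (fun v => all (fun j => (reg C v j < nreg C) && (shd C (reg C v j) == (col C v).2 (+) odd j))
        (ints C v)) (bnds C),
   all (fun e => all (fun b => (sid C e b < nreg C) && (shd C (sid C e b) == b)) [:: true; false])
        (iota 0 (nstr C)),
   all (fun v => all (fun i => let s := (col C v).2 (+) odd i in
        (reg C v i == sid C (str C v i) s) &&
        (reg C v (i.+1 %% (npts (col C v)).-1.+1) == sid C (str C v i) (~~ s))) (pts C v)) (bnds C),
   all (fun v => all (fun i => all (fun w => all (fun j =>
        if str C v i == str C w j then
          if lsh C v i == lsh C w j then (v == w) && (i == j) else true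
        else true) (pts C w)) (bnds C)) (pts C v)) (bnds C),
   all (fun v => all (fun i => has (fun w => has (fun j =>
        if str C w j == str C v i then lsh C w j == ~~ lsh C v i else false)
        (pts C w)) (bnds C)) (pts C v)) (bnds C),
   (let l := classes [seq (sid C e true, sid C e false) | e <- iota 0 (nstr C)] in
    all (fun r => l r == l 0) (iota 0 (nreg C))) &
   let l := classes (flatten [seq [seq (inl v, inr (str C v i)) | i <- pts C v] | v <- bnds C]) in
   (ndisc C).+1 + nreg C ==
     1 + size (undup (map l ([seq inl v | v <- bnds C] ++ [seq inr e | e <- iota 0 (nstr C)]))) +
     sumn [seq (col C v).1 | v <- bnds C] ].

Definition vix (D : Type) (idx : D -> nat) (v : option D) := if v is Some d then (idx d).+1 else 0.

(** Coded indices are sent to ordinals with [inord]; the size [n.-1.+1] is [n] for a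
    planar code, which has a strand and a region.  The map [idx] lets the discs of the
    tangle be indexed by any finite type. *)
Definition pre_of C (D : finType) (dc : D -> color) (c : color) (idx : D -> nat) : pretangle dc c := {|
  strand := 'I_(nstr C).-1.+1;
  region := 'I_(nreg C).-1.+1;
  strand_at := fun v i => inord (str C (vix idx v) i);
  region_at := fun v j => inord (reg C (vix idx v) j);
  side := fun e b => inord (sid C e b);
  shade := fun r => shd C r |}.

Record realizes C (D : finType) (dc : D -> color) (c : color) (idx : D -> nat) : Prop := Realizes {
  real_ext : c = ext C;
  real_col : forall d, dc d = dcol C (idx d);
  real_lt : forall d, idx d < ndisc C;
  real_inj : injective idx;
  real_surj : forall k, k < ndisc C -> exists d, idx d = k }.

Section Planar.
Context (C : code) (D : finType) (dc : D -> color) (c : color) (idx : D -> nat).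
Hypothesis (CP : planarC C) (R : realizes C dc c idx).
Notation T := (pre_of C dc c idx).
Notation vx := (vix idx).

Lemma bcolorE v : bcolor dc c v = col C (vx v).
Proof.
by case: v => [d|] /=; [rewrite colS ?(real_lt R) ?(real_col R)|rewrite (real_ext R)].
Qed.

Lemma vx_bnd v : vx v \in bnds C.
Proof. by rewrite mem_iota /=; case: v => [d|] //=; rewrite !ltnS (real_lt R). Qed.

Lemma vx_inj : injective vx.
Proof. by move=> [d|] [d'|] //= [] /(real_inj R) ->. Qed.

Lemma vx_surj k : k \in bnds C -> exists v, vx v = k.
Proof.
rewrite mem_iota /=; case: k => [|k] h; first by exists None.
by have [d <-] := real_surj R h; exists (Some d).
Qed.

Lemma pt_mem v (i : bpt (bcolor dc c v)) : (i : nat) \in pts C (vx v).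
Proof. by rewrite mem_iota /=; have := ltn_ord i; rewrite {2}bcolorE. Qed.

Lemma int_mem v (i : bint (bcolor dc c v)) : (i : nat) \in ints C (vx v).
Proof. by rewrite mem_iota /=; have := ltn_ord i; rewrite {2}bcolorE. Qed.

Lemma pt_of v k : k \in pts C (vx v) -> exists i : bpt (bcolor dc c v), i = k :> nat.
Proof. by rewrite mem_iota /= -bcolorE => h; exists (Ordinal h). Qed.

Lemma nstr_gt0 : 0 < nstr C. Proof. by case/and3P: CP => /and3P[]. Qed.
Lemma nreg_gt0 : 0 < nreg C. Proof. by case/and3P: CP => /and3P[]. Qed.

Lemma str_lt v k : k \in pts C (vx v) -> str C (vx v) k < nstr C.
Proof. by case/and3P: CP => /and3P[_ _ /allP/(_ _ (vx_bnd v))/allP h] _ _ /h. Qed.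

Lemma val_str v (i : bpt (bcolor dc c v)) : strand_at T v i = str C (vx v) i :> nat.
Proof. by rewrite /= inordK // prednK ?nstr_gt0 // str_lt ?pt_mem. Qed.

Lemma reg_ok v k : k \in ints C (vx v) -> (reg C (vx v) k < nreg C) /\
  shd C (reg C (vx v) k) = (col C (vx v)).2 (+) odd k.
Proof.
by case/and4P: CP => _ /allP/(_ _ (vx_bnd v))/allP h _ _ /h /andP[? /eqP].
Qed.

Lemma val_reg v (i : bint (bcolor dc c v)) : region_at T v i = reg C (vx v) i :> nat.
Proof. by have [h _] := reg_ok (int_mem i); rewrite /= inordK //; exact: leq_trans h (leqSpred _). Qed.

Lemma str_mem (e : strand T) : (e : nat) \in iota 0 (nstr C).
Proof. by rewrite mem_iota /= -{2}(prednK nstr_gt0); exact: ltn_ord. Qed.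

Lemma reg_mem (e : region T) : (e : nat) \in iota 0 (nreg C).
Proof. by rewrite mem_iota /= -{2}(prednK nreg_gt0); exact: ltn_ord. Qed.

Lemma sid_ok e b : e \in iota 0 (nstr C) -> (sid C e b < nreg C) /\ shd C (sid C e b) = b.
Proof.
case/and5P: CP => _ _ /allP h _ _ /h /allP/(_ b).
by rewrite !inE; case: b => /(_ isT)/andP[? /eqP].
Qed.

Lemma val_side (e : strand T) b : side e b = sid C e b :> nat.
Proof. by have [h _] := sid_ok b (str_mem e); rewrite /= inordK //; exact: leq_trans h (leqSpred _). Qed.

Lemma lshE v (i : bpt (bcolor dc c v)) : left_shade i = lsh C (vx v) i.
Proof. by rewrite /left_shade /lsh -[in RHS]bcolorE; case: v i. Qed.

Lemma pre_connected r r' : connect (@Defs.adjacent _ _ _ T) r r'.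
Proof.
move: r r'; apply: (@connected_from _ _ _ T ord0) => r.
have := CP; rewrite /planarC => /and5P[_ _ _ _ /and4P[_ _ /allP h _]].
have /eqP e := h _ (reg_mem r).
pose dec k : region T := inord k.
have -> : r = dec r by rewrite /dec inord_val.
have -> : ord0 = dec 0 by apply: ord_inj; rewrite inordK.
apply: (@classes_sound _ (fun a b => connect (@Defs.adjacent _ _ _ T) (dec a) (dec b)) _ _ _ _ _ _ _ (esym e)).
- by move=> x; exact: connect0.
- by move=> x y; rewrite (@adjacent_sym _ _ _ T).
- by move=> x y z; exact: connect_trans.
move=> a b /mapP[k km [-> ->]].
have kn : k < (nstr C).-1.+1 by move: km; rewrite mem_iota prednK ?nstr_gt0.
exact: (@adjacent1 _ _ _ T (Ordinal kn) true).
Qed.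

Lemma pre_euler : #|{: option D}| + #|region T| =
      1 + n_comp (@Defs.incident _ _ _ T) predT + \sum_(v : option D) (bcolor dc c v).1.
Proof.
have cD : #|D| = ndisc C.
  have inj : injective (fun d => Ordinal (real_lt R d)) by move=> d d' [] /(real_inj R).
  rewrite -[RHS]card_ord -(card_codom inj); apply: eq_card => -[k hk].
  have [d e] := real_surj R hk; apply/codomP; exists d; exact: ord_inj.
have := CP; rewrite /planarC => /and5P[_ _ _ _ /and4P[_ _ _]].
set l := classes _; set N := _ ++ _ => /eqP eu.
have -> : #|region T| = nreg C by rewrite /= card_ord prednK ?nreg_gt0.
rewrite card_option cD eu; congr (_ + _ + _); last first.
  rewrite (eq_bigr (fun v => (col C (vx v)).1)); last by move=> v _; rewrite bcolorE.
  rewrite big_option sumnE big_map.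
  have -> : bnds C = 0 :: [seq k.+1 | k <- iota 0 (ndisc C)] by rewrite /bnds /= -[1%N]addn0 iotaDl.
  rewrite big_cons big_map; congr (_ + _).
  rewrite -(big_image _ _ idx predT (fun k => (col C k.+1).1)) /=.
  apply: perm_big; apply: uniq_perm; rewrite ?iota_uniq ?(map_inj_uniq (real_inj R)) ?enum_uniq //.
  move=> k; rewrite mem_iota /= add0n; apply/idP/mapP => [h|[d _ ->]]; last exact: (real_lt R).
  by have [d <-] := real_surj R h; exists d; rewrite ?mem_enum.
pose enc (x : option D + strand T) : nat + nat :=
  match x with inl v => inl (vx v) | inr e => inr (e : nat) end.
have encN x : enc x \in N.
  rewrite mem_cat; apply/orP; case: x => [v|e]; [left|right].
    exact: map_f (vx_bnd v).
  exact: map_f (str_mem e).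
have encS a : a \in N -> exists x, enc x = a.
  rewrite mem_cat => /orP[] /mapP[k hk ->].
    by have [v <-] := vx_surj hk; exists (inl v).
  have kn : k < (nstr C).-1.+1 by move: hk; rewrite mem_iota prednK ?nstr_gt0.
  by exists (inr (Ordinal kn)).
pose U := undup (map l N).
have labP x : index (l (enc x)) U < size U by rewrite index_mem mem_undup map_f.
rewrite (@n_comp_label _ _ (@incident_sym _ _ _ T) 'I_(size U) (fun x => Ordinal (labP x))).
- by rewrite card_ord.
- case=> k hk; have := mem_nth (inl 0) hk; rewrite mem_undup => /mapP[a aN ea].
  have [x ex] := encS a aN; exists x; apply: ord_inj => /=.
  by rewrite ex -ea index_uniq // undup_uniq.
move=> x y; apply/idP/eqP => [|[] e].
  have step u w : Defs.incident u w -> l (enc u) = l (enc w).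
    have one v i : l (enc (inl v)) = l (enc (inr (strand_at T v i))).
      apply: classes_edge; apply/flatten_mapP; exists (vx v); first exact: vx_bnd.
      by apply/mapP; exists (i : nat); [exact: pt_mem|rewrite -val_str].
    by case: u w => [v|e] [w|f] //= /existsP[i /eqP <-]; rewrite (one _ i).
  move=> c1; apply: ord_inj; congr (index _ _); case/connectP: c1 => p.
  elim: p x => [|z p IH] x /= => [_ -> //|/andP[/step -> ]].
  exact: IH.
have {}e : l (enc x) = l (enc y).
  have mU z : l (enc z) \in U by rewrite mem_undup map_f.
  by rewrite -(nth_index (inl 0) (mU x)) e nth_index.
pose dec (a : nat + nat) : option D + strand T :=
  if pselect (exists x, enc x = a) is left h then projT1 (cid h) else inl None.
have encI : injective enc.
  by case=> [v|f] [w|g] //= [] => [/vx_inj -> //|/ord_inj -> //].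
have decK u : dec (enc u) = u.
  rewrite /dec; case: pselect => [h|[]]; last by exists u.
  exact: encI (projT2 (cid h)).
rewrite -(decK x) -(decK y).
apply: (@classes_sound _ (fun a b => connect (@Defs.incident _ _ _ T) (dec a) (dec b)) _ _ _ _ _ _ _ e).
- by move=> u; exact: connect0.
- by move=> u w; rewrite (@incident_sym _ _ _ T).
- by move=> u w z; exact: connect_trans.
move=> a b /flatten_mapP[k kb /mapP[i ip [-> ->]]].
have [v ev] := vx_surj kb; rewrite -ev in ip *; have [j ej] := pt_of ip.
rewrite -ej -[inl _]/(enc (inl v)) -val_str -[inr _]/(enc (inr (strand_at T v j))) !decK.
exact: (@incident1 _ _ _ T).
Qed.

Lemma planarP : is_planar T.
Proof.
have := CP; rewrite /planarC => /and5P[_ _ _ /allP ba /and4P[/allP inj /allP ends _ _]].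
have c2 v : (bcolor dc c v).2 = (col C (vx v)).2 by rewrite bcolorE.
apply: IsPlanar.
- move=> v j; have [_ h] := reg_ok (int_mem j); rewrite c2 -h.
  by rewrite -val_reg.
- move=> e b; have [_ h] := sid_ok b (str_mem e).
  by rewrite -{2}h -val_side.
- move=> v i; apply: ord_inj; rewrite val_reg val_side val_str c2 (beforeE i).
  by have /allP/(_ _ (pt_mem i))/andP[/eqP] := ba _ (vx_bnd v).
- move=> v i; apply: ord_inj; rewrite val_reg val_side val_str c2 /=.
  have /allP/(_ _ (pt_mem i))/andP[_ /eqP <-] := ba _ (vx_bnd v).
  by rewrite -[in RHS]bcolorE.
- move=> v w i j /(congr1 (@nat_of_ord _)); rewrite !val_str !lshE => /eqP e1 /eqP e2.
  have /allP/(_ _ (pt_mem i))/allP/(_ _ (vx_bnd w))/allP/(_ _ (pt_mem j)) := inj _ (vx_bnd v).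
  by rewrite e1 e2 => /andP[/eqP/vx_inj ? /eqP].
- move=> v i; have /allP/(_ _ (pt_mem i))/hasP[w wb /hasP[j jp]] := ends _ (vx_bnd v).
  have [w' ew] := vx_surj wb; rewrite -ew in jp *; have [j' ej] := pt_of jp.
  rewrite -ej; case: ifP => // /eqP e /eqP e'; exists w', j'; split.
    by apply: ord_inj; rewrite !val_str.
  by rewrite !lshE.
- exact: pre_connected.
- exact: pre_euler.
Qed.

Definition tangle_of := Tangle planarP.
End Planar.

(** * Evaluating codes, and deciding isotopy *)

Section Evaluation.
Context (R : realType) (P : planarAlgebra R).

(** An element of every box space at once.  Since the colours of the discs of a
    code are computed, a value avoids transporting an element of [P c] along an equality
    of colours; only its component at the right colour matters. *)
Definition value := forall c, P c.

Definition inj c (x : P c) : value := fun c' =>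
  if @eqP _ c c' is ReflectT e then eq_rect c (fun c => P c : Type) x c' e else 0%R.

(** Equality of colours is decidable, so the transport along [c = c] is the identity. *)
Lemma injE c (x : P c) : inj x c = x.
Proof. by rewrite /inj; case: eqP => // e; rewrite (eq_axiomK e). Qed.

Lemma std_realizes C : realizes C (fun d : 'I_(ndisc C) => dcol C d) (ext C) (fun d => d).
Proof. by apply: Realizes => //; [exact: ord_inj|move=> k h; exists (Ordinal h)]. Qed.

Definition ev C (vs : nat -> value) : P (ext C) :=
  if @idP (planarC C) is ReflectT h then
    act P (tangle_of h (std_realizes C)) (fun d : 'I_(ndisc C) => vs d (dcol C d))
  else 0%R.

Lemma evE C (h : planarC C) vs :
  ev C vs = act P (tangle_of h (std_realizes C)) (fun d : 'I_(ndisc C) => vs d (dcol C d)).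
Proof. by rewrite /ev; case: {-}_ / idP => // h'; rewrite (bool_irrelevance h h'). Qed.

Lemma ev_ext C vs vs' : (forall d, d < ndisc C -> vs d = vs' d) -> ev C vs = ev C vs'.
Proof.
move=> e; rewrite /ev; case: {-}_ / idP => // h; congr (act _ _ _).
by apply: functional_extensionality_dep => d; rewrite e.
Qed.

Lemma act_cast C (h : planarC C) (D : finType) (idx : D -> nat) (dc dc' : D -> color) c c'
    (r : realizes C dc c idx) (r' : realizes C dc' c' idx) (vs : nat -> value) :
  dc = dc' -> c = c' ->
  inj (act P (tangle_of h r) (fun d => vs (idx d) (dc d))) =
  inj (act P (tangle_of h r') (fun d => vs (idx d) (dc' d))).
Proof. by move=> e1 e2; subst; rewrite (Prop_irrelevance r r'). Qed.

(** The indexing type of the discs is immaterial, because the action is invariant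
    under isotopies that rename discs; this moves between [bool] or [unit] indices and
    ordinals. *)
Lemma act_realizes C (h : planarC C) (D : finType) (dc : D -> color) c idx
    (r : realizes C dc c idx) (vs : nat -> value) :
  inj (act P (tangle_of h r) (fun d => vs (idx d) (dc d))) = inj (ev C vs).
Proof.
have gP (k : 'I_(ndisc C)) : exists d, idx d == k by have [d <-] := real_surj r (ltn_ord k); exists d.
pose g k := xchoose (gP k); have gE k : idx (g k) = k by apply/eqP; exact: (xchooseP (gP k)).
have r0 : realizes C (dc \o g) c (fun k : 'I_(ndisc C) => k).
  apply: Realizes => //; first exact: (real_ext r).
  - by move=> d /=; rewrite (real_col r) gE.
  - exact: ord_inj.
  - by move=> k hk; exists (Ordinal hk).
have gb : bijective g.
  exists (fun d => Ordinal (real_lt r d)) => [k|d]; first by apply: ord_inj => /=; exact: gE.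
  by apply: (real_inj r); rewrite gE.
have iso : isotopic (f := g) (tangle_of h r0) (tangle_of h r).
  by exists id, id; split=> //; split; try (by exists id); move=> d i //=; rewrite gE.
rewrite -(act_isotopic gb iso) evE.
rewrite -(@act_cast C h _ _ _ _ _ _ r0 (std_realizes C) vs); last 2 first.
- by apply: functional_extensionality_dep => k /=; rewrite (real_col r) gE.
- exact: (real_ext r).
by congr (inj (act _ _ _)); apply: functional_extensionality_dep => k /=; rewrite gE.
Qed.

(** If every strand ends at some boundary component, there is at most one isotopy once
    the discs are matched: the strand at a boundary point must go to the strand at the
    matched point.  So the candidate is read off ([sphi], [srho]) and then tested. *)
Section Same.
Context (C C' : code) (f : seq nat).

Definition fvx v := if v is d.+1 then (nth 0 f d).+1 else 0.
Definition places : seq (nat * nat) := flatten [seq [seq (v, i) | i <- pts C v] | v <- bnds C].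
Definition flanks : seq (nat * bool) :=
  flatten [seq [seq (e, b) | b <- [:: true; false]] | e <- iota 0 (nstr C)].
(** The image of a strand is read at the first boundary point where it ends; the default
    [0] is right for a diagram that is a single closed loop. *)
Definition sphi e :=
  let k := find (fun p => str C p.1 p.2 == e) places in
  let (v, i) := nth (0, 0) places k in if k < size places then str C' (fvx v) i else 0.
(** The image of a region is read beside the first strand that borders it. *)
Definition srho r :=
  let (e, b) := nth (0, true) flanks (find (fun p => sid C p.1 p.2 == r) flanks) in
  sid C' (sphi e) b.

Definition bij_upto n m (g : nat -> nat) :=
  let s := [seq g i | i <- iota 0 n] in [&& n == m, uniq s & all (fun i => i < m) s].

Definition match_at v :=
  let v' := fvx v in
  all (fun i => str C' v' i == sphi (str C v i)) (pts C v) &&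
  all (fun j => reg C' v' j == srho (reg C v j)) (ints C v).

(** All conditions of [inner_match] for the candidate, with [f] matching the discs; the
    outer disc is left out, as [sphere_isotopic] asks. *)
Definition same_inner :=
  [&& ndisc C == ndisc C', perm_eq f (iota 0 (ndisc C)),
      all (fun d => dcol C d == dcol C' (nth 0 f d)) (iota 0 (ndisc C)),
      bij_upto (nstr C) (nstr C') sphi, bij_upto (nreg C) (nreg C') srho,
      all (fun d => match_at d.+1) (iota 0 (ndisc C)) &
      all (fun e => all (fun b => sid C' (sphi e) b == srho (sid C e b)) [:: true; false])
        (iota 0 (nstr C))].

Lemma bij_uptoP n m g : bij_upto n m g -> 0 < n ->
  bijective (fun i : 'I_n.-1.+1 => inord (g i) : 'I_m.-1.+1).
Proof.
case/and3P=> /eqP <- /mkseq_uniqP inj /allP lt n0.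
have le : n.-1.+1 <= n by rewrite prednK.
have iN (i : 'I_n.-1.+1) : i < n by exact: leq_trans (ltn_ord i) le.
have gl (i : 'I_n.-1.+1) : g i < n.-1.+1.
  by apply: leq_trans (leqSpred _); apply/lt/map_f; rewrite mem_iota iN.
apply: injF_bij => i j /(congr1 (@nat_of_ord _)); rewrite !inordK // => e.
by apply: ord_inj; apply: inj; rewrite ?inE.
Qed.

Lemma bij_upto_lt n m g i : bij_upto n m g -> i < n -> g i < m.
Proof. by case/and3P => _ _ /allP lt iN; apply/lt/map_f; rewrite mem_iota. Qed.

Section Inner.
Hypothesis (h : planarC C) (h' : planarC C') (s : same_inner).

Lemma same_realizes c' : c' = ext C' ->
  realizes C' (fun d : 'I_(ndisc C) => dcol C d) c' (fun d => nth 0 f d).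
Proof.
move=> ec; case/and5P: s => /eqP nd pf /allP cf _ _.
have sf : size f = ndisc C by rewrite (perm_size pf) size_iota.
have uf : uniq f by rewrite (perm_uniq pf) iota_uniq.
have mf k : (k \in f) = (k < ndisc C) by rewrite (perm_mem pf) mem_iota.
apply: Realizes => //.
- by move=> d; apply/eqP; apply: cf; rewrite mem_iota /=.
- by move=> d; rewrite -nd -mf mem_nth ?sf.
- by move=> d d' /eqP; rewrite nth_uniq ?sf // => /eqP /ord_inj.
- move=> k; rewrite -nd -mf => hk; have hi : index k f < ndisc C by rewrite -sf index_mem.
  by exists (Ordinal hi); rewrite /= nth_index.
Qed.

Definition iphi (e : 'I_(nstr C).-1.+1) : 'I_(nstr C').-1.+1 := inord (sphi e).
Definition irho (r : 'I_(nreg C).-1.+1) : 'I_(nreg C').-1.+1 := inord (srho r).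

Lemma same_str v i : v \in bnds C -> match_at v -> i \in pts C v ->
  inord (str C' (fvx v) i) = iphi (inord (str C v i)).
Proof.
move=> vb /andP[/allP m _] ip; have r := std_realizes C; have [u eu] := vx_surj r vb.
rewrite (eqP (m _ ip)) /iphi inordK //; rewrite -eu in ip *.
exact: leq_trans (str_lt h r ip) (leqSpred _).
Qed.

Lemma same_reg v j : v \in bnds C -> match_at v -> j \in ints C v ->
  inord (reg C' (fvx v) j) = irho (inord (reg C v j)).
Proof.
move=> vb /andP[_ /allP m] ip; have r := std_realizes C; have [u eu] := vx_surj r vb.
rewrite (eqP (m _ ip)) /irho inordK //; rewrite -eu in ip *.
have [l _] := reg_ok h r ip; exact: leq_trans l (leqSpred _).
Qed.

Lemma same_inner_match c c' (r : realizes C (fun d : 'I_(ndisc C) => dcol C d) c (fun d => d))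
    (r' : realizes C' (fun d : 'I_(ndisc C) => dcol C d) c' (fun d => nth 0 f d)) :
  @inner_match _ _ _ c' c id (tangle_of h r) (tangle_of h' r') iphi irho.
Proof.
have ns := nstr_gt0 h; have nr := nreg_gt0 h.
have := s; case/and5P => _ _ _ b1 /and3P[b2 /allP ma /allP sd].
have db (d : 'I_(ndisc C)) : d.+1 \in bnds C by rewrite mem_iota /= ltnS.
have md (d : 'I_(ndisc C)) : match_at d.+1 by apply: ma; rewrite mem_iota /=.
split; [exact: bij_uptoP|exact: bij_uptoP| | |].
- by move=> d i; apply: (same_str (db d) (md d)); rewrite mem_iota /= colS //; exact: ltn_ord i.
- by move=> d i; apply: (same_reg (db d) (md d)); rewrite mem_iota /= colS //; exact: ltn_ord i.
move=> e b; have em := str_mem h (e : strand (tangle_of h r)).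
have /eqP sE : sid C' (sphi e) b == srho (sid C e b).
  by have /allP/(_ b) := sd _ em; apply; case: b; rewrite !inE.
have eN : e < nstr C by move: em; rewrite mem_iota.
have rN : sid C e b < nreg C by have [] := sid_ok h b em.
apply: ord_inj; rewrite (val_side h' (iphi e) b) /iphi inordK; last first.
  exact: leq_trans (bij_upto_lt b1 eN) (leqSpred _).
rewrite sE /irho inordK (val_side h e) //.
exact: leq_trans (bij_upto_lt b2 rN) (leqSpred _).
Qed.
End Inner.

Definition same : bool := [&& same_inner, ext C == ext C' & match_at 0].

Lemma ev_same vs : planarC C -> planarC C' -> same ->
  inj (ev C (fun d => vs (nth 0 f d))) = inj (ev C' vs).
Proof.
move=> h h' /and3P[s /eqP ec m].
have r1 : realizes C (fun d : 'I_(ndisc C) => dcol C d) (ext C') (fun d => d).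
  by case: (std_realizes C) => *; apply: Realizes.
rewrite (evE h).
rewrite (@act_cast C h _ _ _ _ _ _ (std_realizes C) r1 (fun d => vs (nth 0 f d))) //.
rewrite -(act_realizes h' (same_realizes s (erefl (ext C')))); congr inj.
apply: (act_isotopic (f := id)) => //; first by exists id.
exists iphi, irho; split; first exact: same_inner_match.
- move=> i; apply: (same_str h (v := 0)) => //.
  by move: (nat_of_ord i) (ltn_ord i) => k; rewrite mem_iota /= -ec.
- move=> i; apply: (same_reg h (v := 0)) => //.
  by move: (nat_of_ord i) (ltn_ord i) => k; rewrite mem_iota /= -ec.
Qed.
End Same.

End Evaluation.

Lemma scalar_same (R : realType) (P : subfactorPlanarAlgebra R) C C' f s s'
    (vs : nat -> value P) : planarC C -> planarC C' -> same_inner C C' f ->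
  ext C = (0, s) -> ext C' = (0, s') ->
  scalar_of (inj (ev C (fun d => vs (nth 0 f d))) (0, s)) =
  scalar_of (inj (ev C' vs) (0, s')).
Proof.
move=> h h' sm e e'.
have r1 : realizes C (fun d : 'I_(ndisc C) => dcol C d) (0, s) (fun d => d).
  by case: (std_realizes C) => *; apply: Realizes.
rewrite -(act_realizes h r1) -(act_realizes h' (same_realizes sm (esym e'))) !injE.
apply: spherical; exists (@iphi C C' f), (@irho C C' f).
exact: same_inner_match.
Qed.

(** * Gluing codes *)

(** The disjoint union of the strands (or regions) of a tangle and of the tangles
    plugged into it, with a node [(0, e)] for strand [e] of the outer tangle and
    [(d.+1, e)] for strand [e] of the tangle in disc [d]. *)
Section Quotient.
Context (k : nat) (m : nat -> nat).
Hypothesis m_gt0 : forall j, j <= k -> 0 < m j.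

Definition nodes : seq (nat * nat) :=
  flatten [seq [seq (j, e) | e <- iota 0 (m j)] | j <- iota 0 k.+1].
(** One label for each class; the position of a label numbers the class. *)
Definition labels (E : seq ((nat * nat) * (nat * nat))) := undup (map (classes E) nodes).
Definition part E a := index (classes E a) (labels E).

Notation X := ('I_(m 0).-1.+1 + {d : 'I_k & 'I_(m d.+1).-1.+1})%type.

Definition node_of (x : X) : nat * nat :=
  match x with inl e => (0, e : nat) | inr u => ((tag u).+1, tagged u : nat) end.

Lemma node_of_inj : injective node_of.
Proof.
move=> [e|[d e]] [e'|[d' e']] //=; first by case=> /ord_inj ->.
by case=> /ord_inj ed; rewrite -ed in e' * => /ord_inj ->.
Qed.

Lemma mem_nodes j e : ((j, e) \in nodes) = (j <= k) && (e < m j).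
Proof.
apply/flatten_mapP/andP => [[j' + /mapP[e' + [-> ->]]]|[jk em]].
  by rewrite !mem_iota.
by exists j; [rewrite mem_iota|apply: map_f; rewrite mem_iota].
Qed.

Lemma node_of_mem x : node_of x \in nodes.
Proof.
case: x => [e|[d e]]; rewrite mem_nodes /=.
  by have := m_gt0 (leq0n k); case: (m 0) e => // n e _; exact: ltn_ord.
rewrite ltn_ord /=; have := m_gt0 (ltn_ord d).
by case: (m d.+1) e => // n e _; exact: ltn_ord.
Qed.

Lemma node_of_surj a : a \in nodes -> exists x, node_of x = a.
Proof.
case: a => [[|j] e]; rewrite mem_nodes => /andP[jk em].
  have em' : e < (m 0).-1.+1 by exact: leq_trans em (leqSpred _).
  by exists (inl (Ordinal em')).
have em' : e < (m j.+1).-1.+1 by exact: leq_trans em (leqSpred _).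
by exists (inr (Tagged (fun d : 'I_k => 'I_(m d.+1).-1.+1)
  (Ordinal em' : 'I_(m (Ordinal jk : 'I_k).+1).-1.+1))).
Qed.

Lemma part_lt E a : a \in nodes -> part E a < size (labels E).
Proof. by move=> h; rewrite index_mem mem_undup map_f. Qed.

(** Numbering the classes of the generated equivalence is the quotient demanded of a
    glued tangle. *)
Lemma part_quotient E (seam : X -> X -> Prop) :
  (forall x y, seam x y -> (node_of x, node_of y) \in E) ->
  (forall a b, (a, b) \in E -> exists x y, [/\ seam x y, node_of x = a & node_of y = b]) ->
  quotient_by seam (fun x => inord (part E (node_of x)) : 'I_(size (labels E)).-1.+1).
Proof.
move=> sE Es.
have pl x : part E (node_of x) < (size (labels E)).-1.+1.
  by exact: leq_trans (part_lt E (node_of_mem x)) (leqSpred _).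
split.
  case=> b hb; have h0 : 0 < size (labels E).
    have := node_of_mem (inl ord0); move/(map_f (classes E)); rewrite -mem_undup.
    by rewrite -/(labels E); case: (labels E).
  have hb' : b < size (labels E) by rewrite -(prednK h0).
  have := mem_nth (0, 0) hb'; rewrite mem_undup => /mapP[a aN ea].
  have [x ex] := node_of_surj aN; exists x; apply: ord_inj.
  by rewrite inordK //= /part ex -ea index_uniq // undup_uniq.
move=> x y; split=> [/(congr1 (@nat_of_ord _))|].
  rewrite !inordK // => e.
  have mU z : classes E (node_of z) \in labels E by rewrite mem_undup map_f ?node_of_mem.
  have {}e : classes E (node_of x) = classes E (node_of y).
    by rewrite -(nth_index (0, 0) (mU x)) -/(part _ _) e nth_index.
  pose dec a : X := if pselect (exists x, node_of x = a) is left h then projT1 (cid h) else inl ord0.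
  have decK u : dec (node_of u) = u.
    rewrite /dec; case: pselect => [h|[]]; last by exists u.
    exact: node_of_inj (projT2 (cid h)).
  rewrite -(decK x) -(decK y).
  apply: (@classes_sound _ (fun a b => clos_refl_sym_trans _ seam (dec a) (dec b)) _ _ _ _ _ _ _ e).
  - by move=> u; exact: rst_refl.
  - by move=> u w; exact: rst_sym.
  - by move=> u w z; exact: rst_trans.
  by move=> a b /Es[u [w [suw <- <-]]]; rewrite !decK; exact: rst_step.
move=> H; congr (inord (index _ _)); elim: H => {x y} [x y /sE|x|x y _ ->|x y z _ -> _ ->] //.
exact: classes_edge.
Qed.
End Quotient.

Section Glue.
Context (T : code) (Ss : seq code).

Definition piece j := if j is d.+1 then nth T Ss d else T.
Definition gdiscs := flatten
  [seq [seq (d, e) | e <- iota 0 (ndisc (piece d.+1))] | d <- iota 0 (ndisc T)].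
Definition sedges := flatten
  [seq [seq ((0, str T d.+1 i), (d.+1, str (piece d.+1) 0 i)) | i <- pts T d.+1]
  | d <- iota 0 (ndisc T)].
Definition redges := flatten
  [seq [seq ((0, reg T d.+1 i), (d.+1, reg (piece d.+1) 0 i)) | i <- ints T d.+1]
  | d <- iota 0 (ndisc T)].
Definition ns j := nstr (piece j).
Definition nr j := nreg (piece j).
Definition gphi := part (ndisc T) ns sedges.
Definition grho := part (ndisc T) nr redges.

(** Sides and shades of a class are read at its representative; [glue_ok] tests that the
    other members have the same sides. *)
Definition glueC : code :=
  let ls := labels (ndisc T) ns sedges in
  let lr := labels (ndisc T) nr redges in
  let cs := classes sedges in let cr := classes redges in
  let phi a := index (cs a) ls in let rho a := index (cr a) lr in {|
  ext := ext T;
  discs := [seq nth ((0, true), 0) (discs (piece p.1.+1)) p.2 | p <- gdiscs];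
  strs := [seq phi (0, str T 0 i) | i <- pts T 0] ::
    [seq [seq phi (p.1.+1, str (piece p.1.+1) p.2.+1 i) | i <- pts (piece p.1.+1) p.2.+1] | p <- gdiscs];
  regs := [seq rho (0, reg T 0 i) | i <- ints T 0] ::
    [seq [seq rho (p.1.+1, reg (piece p.1.+1) p.2.+1 i) | i <- ints (piece p.1.+1) p.2.+1] | p <- gdiscs];
  sides := [seq (rho (a.1, sid (piece a.1) a.2 true), rho (a.1, sid (piece a.1) a.2 false)) | a <- ls];
  shades := [seq shd (piece a.1) a.2 | a <- lr] |}.

Definition glue_ok (U : code) : bool :=
  all (fun d => ext (piece d.+1) == dcol T d) (iota 0 (ndisc T)) &&
  (let ls := labels (ndisc T) ns sedges in
  let lr := labels (ndisc T) nr redges in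
  let cs := classes sedges in let cr := classes redges in
  all (fun a => all (fun b => sid U (index (cs a) ls) b ==
      index (cr (a.1, sid (piece a.1) a.2 b)) lr) [:: true; false]) (nodes (ndisc T) ns)).

Hypothesis (hT : planarC T) (hS : all planarC Ss).
Hypothesis (hU : planarC glueC) (ok : glue_ok glueC).

Lemma piece_planar j : planarC (piece j).
Proof.
case: j => [|d] //=; case: (ltnP d (size Ss)) => h; last by rewrite nth_default.
by have /all_nthP/(_ d h) := hS.
Qed.

Lemma piece_ext d : d < ndisc T -> ext (piece d.+1) = dcol T d.
Proof. by move=> h; case/andP: ok => /allP h1 _; apply/eqP/h1; rewrite mem_iota. Qed.

Lemma mem_gdiscs d e : ((d, e) \in gdiscs) = (d < ndisc T) && (e < ndisc (piece d.+1)).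
Proof.
apply/flatten_mapP/andP => [[j' + /mapP[e' + [-> ->]]]|[jk em]].
  by rewrite !mem_iota.
by exists d; [rewrite mem_iota|apply: map_f; rewrite mem_iota].
Qed.

Notation D := {d : 'I_(ndisc T) & 'I_(ndisc (piece d.+1))}.
Notation ec := (fun d : 'I_(ndisc T) => fun e : 'I_(ndisc (piece d.+1)) => dcol (piece d.+1) e).

Definition gpair (u : D) : nat * nat := (tag u : nat, tagged u : nat).
Definition gidx (u : D) : nat := index (gpair u) gdiscs.

Lemma gpair_mem u : gpair u \in gdiscs.
Proof. by rewrite mem_gdiscs /= !ltn_ord. Qed.

Lemma gpair_inj : injective gpair.
Proof.
move=> [d e] [d' e'] [/ord_inj ed]; rewrite -ed in e' *.
by move=> /= /ord_inj ->.
Qed.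

Lemma ndisc_glue : ndisc glueC = size gdiscs.
Proof. by rewrite /ndisc size_map. Qed.

Lemma gidx_lt u : gidx u < size gdiscs. Proof. by rewrite index_mem gpair_mem. Qed.

Lemma nth_gidx u : nth (0, 0) gdiscs (gidx u) = gpair u.
Proof. by rewrite nth_index ?gpair_mem. Qed.

Lemma uniq_gdiscs : uniq gdiscs.
Proof.
apply: allpairs_uniq_dep; [exact: iota_uniq|by move=> d _; exact: iota_uniq|].
by move=> [d e] [d' e'] _ _ /= [-> ->].
Qed.

Lemma glue_dcol u : dcol glueC (gidx u) = ec (tag u) (tagged u).
Proof. by rewrite /dcol /= (nth_map (0, 0)) ?gidx_lt // nth_gidx. Qed.

Lemma glue_realizes : realizes glueC (glue_color ec) (ext T) gidx.
Proof.
apply: Realizes => //.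
- by move=> u; rewrite glue_dcol.
- by move=> u; rewrite ndisc_glue gidx_lt.
- move=> u w e; apply: gpair_inj; by rewrite -!nth_gidx e.
- move=> n; rewrite ndisc_glue => hn; have := mem_nth (0, 0) hn.
  case E: (nth _ _ _) => [d e]; rewrite mem_gdiscs => /andP[hd he].
  exists (Tagged (fun d : 'I_(ndisc T) => 'I_(ndisc (piece d.+1)))
    (Ordinal he : 'I_(ndisc (piece (Ordinal hd : 'I_(ndisc T)).+1)))).
  by rewrite /gidx /gpair /= -E index_uniq // uniq_gdiscs.
Qed.

Lemma piece_realizes (d : 'I_(ndisc T)) : realizes (piece d.+1) (ec d) (dcol T d) (fun e => e).
Proof.
by apply: Realizes => //; [rewrite piece_ext|exact: ord_inj|move=> k h; exists (Ordinal h)].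
Qed.

Definition tT := tangle_of hT (std_realizes T).
Definition tS (d : 'I_(ndisc T)) := tangle_of (piece_planar d.+1) (piece_realizes d).
Definition tU := tangle_of hU glue_realizes.

Lemma ns_gt0 j : 0 < ns j. Proof. exact: nstr_gt0 (piece_planar j). Qed.
Lemma nr_gt0 j : 0 < nr j. Proof. exact: nreg_gt0 (piece_planar j). Qed.

Lemma nstr_glue : nstr glueC = size (labels (ndisc T) ns sedges).
Proof. by rewrite /nstr size_map. Qed.
Lemma nreg_glue : nreg glueC = size (labels (ndisc T) nr redges).
Proof. by rewrite /nreg size_map. Qed.

Definition tphi (x : strand tT + {d & strand (tS d)}) : strand tU :=
  inord (gphi (node_of (k := ndisc T) (m := ns) x)).
Definition trho (x : region tT + {d & region (tS d)}) : region tU :=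
  inord (grho (node_of (k := ndisc T) (m := nr) x)).

Lemma quotient_inord (A : Type) n n' (e : n = n') (s : A -> A -> Prop) (g : A -> nat) :
  quotient_by s (fun x => inord (g x) : 'I_n.-1.+1) -> quotient_by s (fun x => inord (g x) : 'I_n'.-1.+1).
Proof. by rewrite e. Qed.

Lemma tphi_quotient : quotient_by (@strand_seam _ _ _ tT _ ec tS) tphi.
Proof.
apply: (quotient_inord (esym nstr_glue)); apply: (part_quotient (fun j _ => ns_gt0 j)).
  move=> _ _ [d i]; apply/flatten_mapP; exists (d : nat); first by rewrite mem_iota /=.
  apply/mapP; exists (i : nat); first by rewrite mem_iota /= colS.
  have e1 := @val_str _ _ _ _ _ hT (std_realizes T) (Some d) i.
  have e2 := @val_str _ _ _ _ _ (piece_planar d.+1) (piece_realizes d) None i.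
  by congr ((_, _), (_, _)); [rewrite -e1|rewrite -e2].
move=> a b /flatten_mapP[d dm /mapP[i im [-> ->]]].
move: dm im; rewrite !mem_iota !add0n => hd; rewrite colS // => hi.
pose d' := Ordinal hd; pose i' : bpt (dcol T d') := Ordinal hi.
have e1 := @val_str _ _ _ _ _ hT (std_realizes T) (Some d') i'.
have e2 := @val_str _ _ _ _ _ (piece_planar d.+1) (piece_realizes d') None i'.
exists (inl (strand_at tT (Some d') i')),
  (inr (Tagged (fun d => strand (tS d)) (strand_at (tS d') None i'))).
split; first exact: StrandSeam.
  exact: (f_equal (pair 0) e1).
exact: (f_equal (pair d.+1) e2).
Qed.

Lemma trho_quotient : quotient_by (@region_seam _ _ _ tT _ ec tS) trho.
Proof.
apply: (quotient_inord (esym nreg_glue)); apply: (part_quotient (fun j _ => nr_gt0 j)).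
  move=> _ _ [d i]; apply/flatten_mapP; exists (d : nat); first by rewrite mem_iota /=.
  apply/mapP; exists (i : nat); first by rewrite mem_iota /= colS.
  have e1 := @val_reg _ _ _ _ _ hT (std_realizes T) (Some d) i.
  have e2 := @val_reg _ _ _ _ _ (piece_planar d.+1) (piece_realizes d) None i.
  by congr ((_, _), (_, _)); [rewrite -e1|rewrite -e2].
move=> a b /flatten_mapP[d dm /mapP[i im [-> ->]]].
move: dm im; rewrite !mem_iota !add0n => hd; rewrite colS // => hi.
pose d' := Ordinal hd; pose i' : bint (dcol T d') := Ordinal hi.
have e1 := @val_reg _ _ _ _ _ hT (std_realizes T) (Some d') i'.
have e2 := @val_reg _ _ _ _ _ (piece_planar d.+1) (piece_realizes d') None i'.
exists (inl (region_at tT (Some d') i')),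
  (inr (Tagged (fun d => region (tS d)) (region_at (tS d') None i'))).
split; first exact: RegionSeam.
  exact: (f_equal (pair 0) e1).
exact: (f_equal (pair d.+1) e2).
Qed.

Lemma str_glue0 i : i \in pts T 0 -> str glueC 0 i = gphi (0, str T 0 i).
Proof. by rewrite mem_iota => h; exact: (nth_mkseq 0 (fun i => gphi (0, str T 0 i))). Qed.

Lemma reg_glue0 i : i \in ints T 0 -> reg glueC 0 i = grho (0, reg T 0 i).
Proof.
rewrite mem_iota add0n => /andP[_ h].
exact: (@nth_mkseq _ 0 (fun i => grho (0, reg T 0 i)) _ _ h).
Qed.

Lemma str_glueS (u : D) i : i \in pts (piece (tag u).+1) (tagged u).+1 ->
  str glueC (gidx u).+1 i = gphi ((tag u).+1, str (piece (tag u).+1) (tagged u).+1 i).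
Proof.
rewrite mem_iota add0n => /andP[_ h]; have -> : str glueC (gidx u).+1 i = nth 0 (nth [::]
  [seq mkseq (fun i => gphi (p.1.+1, str (piece p.1.+1) p.2.+1 i))
         (npts (col (piece p.1.+1) p.2.+1)) | p <- gdiscs] (gidx u)) i by [].
by rewrite (nth_map (0, 0)) ?gidx_lt // nth_gidx nth_mkseq.
Qed.

Lemma reg_glueS (u : D) i : i \in ints (piece (tag u).+1) (tagged u).+1 ->
  reg glueC (gidx u).+1 i = grho ((tag u).+1, reg (piece (tag u).+1) (tagged u).+1 i).
Proof.
rewrite mem_iota add0n => /andP[_ h]; have -> : reg glueC (gidx u).+1 i = nth 0 (nth [::]
  [seq mkseq (fun i => grho (p.1.+1, reg (piece p.1.+1) p.2.+1 i))
         ((npts (col (piece p.1.+1) p.2.+1)).-1.+1) | p <- gdiscs] (gidx u)) i by [].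
by rewrite (nth_map (0, 0)) ?gidx_lt // nth_gidx nth_mkseq.
Qed.

Lemma side_glue (e : strand tU) b x :
  e = tphi x -> sid glueC (gphi (node_of (k := ndisc T) (m := ns) x)) b =
    grho (let a := node_of (k := ndisc T) (m := ns) x in (a.1, sid (piece a.1) a.2 b)).
Proof.
move=> _; case/andP: ok => _ /allP/(_ _ (node_of_mem (fun j _ => ns_gt0 j) x))/allP/(_ b).
by rewrite !inE => /(_ _)/eqP; apply; case: b.
Qed.

Lemma glue_glued : glued (ec := ec) tT tS tU.
Proof.
exists tphi, trho.
have sphiE x : gphi (node_of (k := ndisc T) (m := ns) x) < nstr glueC.
  by rewrite nstr_glue; apply/part_lt/node_of_mem => j _; exact: ns_gt0.
have vphi x : tphi x = gphi (node_of (k := ndisc T) (m := ns) x) :> nat.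
  by rewrite /tphi inordK //; apply: leq_trans (sphiE x) (leqSpred _).
split; [exact: tphi_quotient|exact: trho_quotient|split|split|split].
- move=> i; congr (inord _).
  have e1 := @val_str _ _ _ _ _ hT (std_realizes T) None i.
  by rewrite str_glue0 ?mem_iota //= e1.
- move=> i; congr (inord _).
  have e1 := @val_reg _ _ _ _ _ hT (std_realizes T) None i.
  by rewrite reg_glue0 ?mem_iota //= e1.
- move=> u i; congr (inord _).
  have e1 := @val_str _ _ _ _ _ (piece_planar (tag u).+1) (piece_realizes (tag u)) (Some (tagged u)) i.
  by rewrite str_glueS ?mem_iota ?colS //= e1.
- move=> u i; congr (inord _).
  have e1 := @val_reg _ _ _ _ _ (piece_planar (tag u).+1) (piece_realizes (tag u)) (Some (tagged u)) i.
  by rewrite reg_glueS ?mem_iota ?colS //= e1.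
- move=> e b; congr (inord _); rewrite vphi (side_glue b (erefl (tphi (inl e)))).
  by have e1 := @val_side _ _ _ _ _ hT e b; rewrite /= e1.
- move=> d e b; congr (inord _); rewrite vphi (side_glue b (erefl (tphi _))).
  by have e1 := @val_side _ _ _ _ _ (piece_planar d.+1) e b; rewrite /= e1.
Qed.

(** Substitution of diagrams is computed by [glueC]. *)
Lemma ev_glue (R : realType) (P : planarAlgebra R) (vs : nat -> nat -> value P) :
  inj (ev glueC (fun n => let p := nth (0, 0) gdiscs n in vs p.1 p.2)) =
  inj (ev T (fun d => inj (ev (piece d.+1) (vs d)))).
Proof.
rewrite -(act_realizes hU glue_realizes) (evE hT); congr inj.
have := act_glued glue_glued (fun d (e : 'I_(ndisc (piece d.+1))) => vs d e (ec d e)).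
move=> E; transitivity (act P tU (fun u => vs (tag u) (tagged u) (ec (tag u) (tagged u)))).
  by congr (act _ _ _); apply: functional_extensionality_dep => u; rewrite nth_gidx.
rewrite E; congr (act _ _ _); apply: functional_extensionality_dep => d.
by rewrite -(act_realizes (piece_planar d.+1) (piece_realizes d)) injE.
Qed.
End Glue.

(** * Reflecting codes, and diagram terms *)

(** Even labels [l.*2] stand for the variable [l], odd ones for its adjoint, so a
    reflection exchanges neighbouring labels. *)
Definition flip l := if odd l then l.-1 else l.+1.

Lemma odd_flip l : odd (flip l) = ~~ odd l.
Proof. by rewrite /flip; case: ifP => h; lia. Qed.

Lemma half_flip l : (flip l)./2 = l./2.
Proof. by rewrite /flip; case: ifP => h; lia. Qed.

(** Points and intervals are reversed as in [mirror]: by [rev_ord] and [Zp_opp]. *)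
Definition mirC C : code := {|
  ext := ext C;
  discs := [seq (p.1, flip p.2) | p <- discs C];
  strs := [seq [seq str C v (npts (col C v) - i.+1) | i <- pts C v] | v <- bnds C];
  regs := [seq let m := (npts (col C v)).-1.+1 in
     [seq reg C v ((m - j) %% m) | j <- ints C v] | v <- bnds C];
  sides := sides C; shades := shades C |}.

Section Mirror.
Context (C : code).

Lemma mir_realizes (D : finType) (dc : D -> color) c idx :
  realizes C dc c idx -> realizes (mirC C) dc c idx.
Proof.
case=> e1 e2 e3 e4 e5; apply: Realizes => //; rewrite /ndisc ?size_map //.
by move=> d; rewrite e2 /dcol /= (nth_map ((0, true), 0)) //; exact: e3.
Qed.

Lemma str_mir v i : v \in bnds C -> i \in pts C v -> str (mirC C) v i = str C v (npts (col C v) - i.+1).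
Proof.
rewrite !mem_iota !add0n => /andP[_ hv] /andP[_ hi].
rewrite [LHS]/str (_ : strs (mirC C) =
  [seq mkseq (fun i => str C v (npts (col C v) - i.+1)) (npts (col C v)) | v <- bnds C]) //.
by rewrite (nth_map 0) ?size_iota // nth_iota // nth_mkseq.
Qed.

Lemma reg_mir v j : v \in bnds C -> j \in ints C v ->
  reg (mirC C) v j = reg C v (((npts (col C v)).-1.+1 - j) %% (npts (col C v)).-1.+1).
Proof.
rewrite !mem_iota !add0n => /andP[_ hv] /andP[_ hi].
rewrite [LHS]/reg (_ : regs (mirC C) = [seq let m := (npts (col C v)).-1.+1 in
  mkseq (fun j => reg C v ((m - j) %% m)) m | v <- bnds C]) //.
by rewrite (nth_map 0) ?size_iota // nth_iota // nth_mkseq.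
Qed.

Lemma mir_mirror (h : planarC C) (h' : planarC (mirC C)) (D : finType) (dc : D -> color) c idx
  (r : realizes C dc c idx) (r' : realizes (mirC C) dc c idx) :
  mirror (tangle_of h r) (tangle_of h' r').
Proof.
exists id, id; split=> //; try by exists id.
- move=> v i; have e := bcolorE r v; congr (inord _).
  have vb := vx_bnd r v; have ip := pt_mem r i; have ip' := pt_mem r (rev_ord i).
  rewrite (str_mir vb ip') /=; move: (nat_of_ord i) ip => k.
  rewrite e mem_iota => ip; congr (str _ _ _); lia.
- move=> v i; have e := bcolorE r v; congr (inord _).
  have vb := vx_bnd r v; have ip := int_mem r i; have ip' := int_mem r (Zp_opp i).
  rewrite (reg_mir vb ip') /=; move: (nat_of_ord i) ip => k.
  rewrite e mem_iota add0n => /andP[_]; set m := (npts _).-1.+1 => km; congr (reg _ _ _).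
  case: (posnP k) => [->|k0]; first by rewrite subn0 modnn subn0 modnn.
  by rewrite (@modn_small (m - k)) ?(@modn_small (m - (m - k))); lia.
Qed.

Lemma ev_mir (R : realType) (P : planarAlgebra R) (vs : nat -> value P) :
  planarC C -> planarC (mirC C) ->
  star (ev C vs) = ev (mirC C) (fun d c => star (vs d c)).
Proof.
move=> h h'; rewrite (evE h).
rewrite (act_mirror (mir_mirror h h' (std_realizes C) (mir_realizes (std_realizes C)))).
have := act_realizes h' (mir_realizes (std_realizes C)) (fun d c => star (vs d c)).
by move/(congr1 (fun g => g (ext C))); rewrite !injE.
Qed.
End Mirror.

Definition idC (c : color) (l : nat) : code :=
  let n := npts c in let m := n.-1.+1 in {|
  ext := c; discs := [:: (c, l)];
  strs := [:: iota 0 n; iota 0 n]; regs := [:: iota 0 m; iota 0 m];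
  sides := [seq if c.2 (+) odd i then (i, i.+1 %% m) else (i.+1 %% m, i) | i <- iota 0 n];
  shades := [seq c.2 (+) odd j | j <- iota 0 m] |}.

Section Terms.
Context (R : realType) (P : planarAlgebra R).

Lemma star0 c : star (0 : P c)%R = 0%R.
Proof.
have := star_semilinear (1%R : R[i]) (0 : P c)%R 0%R.
rewrite scaler0 addr0 rmorph1 scale1r => /(congr1 (fun z => z - star 0)%R).
by rewrite subrr addrK => <-.
Qed.

Lemma star_inj c (x : P c) c' : star (inj x c') = inj (star x) c'.
Proof. by rewrite /inj; case: eqP => [e|_]; [case: _ / e|exact: star0]. Qed.

Lemma ev_id c l (vs : nat -> value P) : planarC (idC c l) -> ev (idC c l) vs = vs 0 c.
Proof.
move=> h; have r : realizes (idC c l) (fun _ : unit => c) c (fun _ => 0).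
  apply: Realizes => //; first by move=> [] [].
  by case=> // _; exists tt.
have := act_realizes h r (fun d => vs d) => /(congr1 (fun g => g c)); rewrite !injE => <-.
apply: (@act_identity _ _ _ _ _ (vs 0 c)); split=> [//|e].
have ns : nstr (idC c l) = npts c by rewrite /nstr size_map size_iota.
have he : e < npts c.
  by rewrite -ns; have := str_mem h (e : strand (tangle_of h r)); rewrite mem_iota.
by exists (Ordinal he); rewrite /= /str /= nth_iota // add0n inord_val.
Qed.

(** Expressions in the operations of a planar star algebra; every one denotes a single
    diagram, which [run] computes. *)
Inductive term := Var of color & nat | Op of code & seq term | Star of term.

Fixpoint sem (rho : nat -> value P) t : value P :=
  match t with
  | Var c l => inj (rho l c)
  | Op C ts => inj (ev C (fun d => nth (fun c => 0%R : P c) [seq sem rho t | t <- ts] d))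
  | Star t => fun c => star (sem rho t c)
  end.

Definition starred (rho : nat -> value P) l : value P :=
  fun c => if odd l then star (rho l./2 c) else rho l./2 c.

Lemma starred_flip rho l c : starred rho (flip l) c = star (starred rho l c).
Proof. by rewrite /starred odd_flip half_flip; case: (odd l) => //=; rewrite starK. Qed.

(** The boolean records that all intermediate codes are planar and glue properly. *)
Fixpoint run t : code * bool :=
  match t with
  | Var c l => let C := idC c l.*2 in (C, planarC C)
  | Op C ts => let rs := [seq run t | t <- ts] in let Ss := [seq r.1 | r <- rs] in
     let U := glueC C Ss in
     (U, [&& all (fun r => r.2) rs, planarC C, size ts == ndisc C, planarC U & glue_ok C Ss U])
  | Star t => let r := run t in let U := mirC r.1 in (U, r.2 && planarC U)
  end.

Lemma term_ind' (Q : term -> Prop) : (forall c l, Q (Var c l)) ->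
  (forall C ts, (forall i, i < size ts -> Q (nth (Var (0, true) 0) ts i)) -> Q (Op C ts)) ->
  (forall t, Q t -> Q (Star t)) -> forall t, Q t.
Proof.
move=> QV QO QS; fix IH 1; case=> [c l|C ts|t]; [exact: QV| |exact: QS].
apply: QO; elim: ts => [|t ts IHs] i; first (rewrite ltn0 => i0; case: (notF i0)).
by case: i => [|i] hi; [exact: (IH t)|exact: (IHs i)].
Qed.

Lemma sem_run rho t : (run t).2 ->
  planarC (run t).1 /\ sem rho t = inj (ev (run t).1 (fun d => starred rho (dlab (run t).1 d))).
Proof.
elim/term_ind': t => [c l|C ts IH|t IH] /=.
- move=> h; split=> //; rewrite (@ev_id c l.*2) // /starred /dlab /=.
  by rewrite odd_double doubleK.
- pose Ss := [seq r.1 | r <- [seq run t | t <- ts]]; pose U := glueC C Ss; rewrite -/Ss -/U.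
  case/and5P=> rts hC /eqP sz hU ok; split=> //.
  have sS : size Ss = ndisc C by rewrite /Ss !size_map.
  have nS d : d < ndisc C -> piece C Ss d.+1 = (run (nth (Var (0, true) 0) ts d)).1.
    by move=> hd; rewrite /piece /Ss -map_comp (nth_map (Var (0, true) 0)) ?sz.
  have ok1 d : d < ndisc C -> (run (nth (Var (0, true) 0) ts d)).2.
    move=> hd; move: rts; rewrite all_map => /(all_nthP (Var (0, true) 0))/(_ d).
    by rewrite sz; exact.
  have hS : all planarC Ss.
    apply/(all_nthP C) => d; rewrite sS => hd; rewrite -/(piece C Ss d.+1) nS //.
    by have sd : d < size ts by [rewrite sz]; have [] := IH d sd (ok1 d hd).
  pose vs d e := starred rho (dlab (piece C Ss d.+1) e).
  rewrite (_ : ev U _ = ev U (fun n => let p := nth (0, 0) (gdiscs C Ss) n in vs p.1 p.2)); last first.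
    apply: ev_ext => d hd; rewrite /vs; congr starred.
    rewrite ndisc_glue in hd; by rewrite /dlab /= (nth_map (0, 0)).
  rewrite (ev_glue hC hS hU ok vs); congr inj; apply: ev_ext => d hd.
  rewrite (nth_map (Var (0, true) 0)) ?sz // {1}/vs nS //.
  by have sd : d < size ts by [rewrite sz]; have [_ ->] := IH d sd (ok1 d hd).
case/andP=> r1 h'; have [h e] := IH r1; split=> //.
apply: functional_extensionality_dep => c; rewrite e star_inj ev_mir //.
have -> : ev (mirC (run t).1) (fun d c' => star (starred rho (dlab (run t).1 d) c')) =
    ev (mirC (run t).1) (fun d => starred rho (dlab (mirC (run t).1) d)); last by [].
apply: ev_ext => d; rewrite /ndisc size_map => hd; apply: functional_extensionality_dep => c'.
by rewrite -starred_flip /dlab /= (nth_map ((0, true), 0)).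
Qed.

Definition matching C C' : seq nat :=
  [seq index (dlab C d) [seq dlab C' e | e <- iota 0 (ndisc C')] | d <- iota 0 (ndisc C)].

Lemma matchingE C C' d : perm_eq (matching C C') (iota 0 (ndisc C)) -> ndisc C = ndisc C' ->
  d < ndisc C -> dlab C' (nth 0 (matching C C') d) = dlab C d.
Proof.
move=> pm e hd; have mm : nth 0 (matching C C') d < ndisc C.
  have : nth 0 (matching C C') d \in matching C C' by rewrite mem_nth // size_map size_iota.
  by rewrite (perm_mem pm) mem_iota.
move: mm; rewrite (nth_map 0) ?size_iota // nth_iota // add0n; set l := map _ _ => mm.
have il : dlab C d \in l by rewrite -index_mem size_map size_iota -e.
rewrite -[RHS](nth_index 0 il) {2}/l (nth_map 0) ?size_iota -?e // nth_iota -?e //.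
Qed.

Definition equiv_terms t t' : bool :=
  let r := run t in let r' := run t' in
  [&& r.2, r'.2 & same r.1 r'.1 (matching r.1 r'.1)].

Definition sphere_terms s t s' t' : bool :=
  let r := run t in let r' := run t' in
  [&& r.2, r'.2, ext r.1 == (0, s), ext r'.1 == (0, s') & same_inner r.1 r'.1 (matching r.1 r'.1)].

(** For concrete terms the hypothesis is closed by evaluation. *)
Lemma sem_eq t t' rho : equiv_terms t t' -> sem rho t = sem rho t'.
Proof.
case/and3P=> r1 r2 sm; have [h ->] := sem_run rho r1; have [h' ->] := sem_run rho r2.
rewrite -(ev_same _ h h' sm); congr inj; apply: ev_ext => d hd; rewrite matchingE //.
  by case/and3P: sm => /and3P[].
by case/and3P: sm => /and3P[/eqP].
Qed.
End Terms.

(** For closed diagrams sphericality permits isotopies on the sphere. *)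
Lemma sem_sphere (R : realType) (P : subfactorPlanarAlgebra R) s t s' t' (rho : nat -> value P) :
  sphere_terms s t s' t' ->
  scalar_of (sem rho t (0, s)) = scalar_of (sem rho t' (0, s')).
Proof.
case/and5P=> r1 r2 /eqP e /eqP e' sm; have [h ->] := sem_run rho r1; have [h' ->] := sem_run rho r2.
rewrite -(scalar_same _ h h' sm e e'); congr (scalar_of (inj _ _)).
apply: ev_ext => d hd; rewrite matchingE //.
  by case/and3P: sm.
by case/and3P: sm => /eqP.
Qed.

(** * Codes of the standard tangles *)

(** An injective numbering of the strands and regions of a tangle that is compatible
    with a code is bijective by counting, hence an isotopy. *)
Lemma present C (h : planarC C) (D : finType) (dc : D -> color) c idx (r : realizes C dc c idx)
    (T : tangle dc c) (psi : strand T -> nat) (psr : region T -> nat) :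
  injective psi -> injective psr -> (forall e, psi e < nstr C) -> (forall r, psr r < nreg C) ->
  #|strand T| = nstr C -> #|region T| = nreg C ->
  (forall v (i : bpt (bcolor dc c v)), str C (vix idx v) i = psi (strand_at T v i)) ->
  (forall v (i : bint (bcolor dc c v)), reg C (vix idx v) i = psr (region_at T v i)) ->
  (forall e b, sid C (psi e) b = psr (side e b)) ->
  forall (R : realType) (P : planarAlgebra R) (vs : nat -> value P),
    inj (act P T (fun d => vs (idx d) (dc d))) = inj (ev C vs).
Proof.
move=> i1 i2 l1 l2 c1 c2 hs hr hd R P vs; rewrite -(act_realizes h r); congr inj.
have l1' e : psi e < (nstr C).-1.+1 by exact: leq_trans (l1 e) (leqSpred _).
have l2' e : psr e < (nreg C).-1.+1 by exact: leq_trans (l2 e) (leqSpred _).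
pose phi (e : strand T) : strand (tangle_of h r) := inord (psi e).
pose rho (e : region T) : region (tangle_of h r) := inord (psr e).
apply: (act_isotopic (f := id)); first by exists id.
exists phi, rho; split; last 2 first.
- by move=> i; rewrite /phi -hs.
- by move=> i; rewrite /rho -hr.
split.
- apply: inj_card_bij => [e e' /(congr1 (@nat_of_ord _))|]; first by rewrite !inordK // => /i1.
  by rewrite c1 /= card_ord prednK // (nstr_gt0 h).
- apply: inj_card_bij => [e e' /(congr1 (@nat_of_ord _))|]; first by rewrite !inordK // => /i2.
  by rewrite c2 /= card_ord prednK // (nreg_gt0 h).
- by move=> d i; rewrite /phi -hs.
- by move=> d i; rewrite /rho -hr.
by move=> e b; rewrite /rho -hd /= /phi inordK.
Qed.

Definition ncolumn n p := if p < n then p else n.*2 - p.+1.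
Definition ngap n j := if j <= n then j else n.*2 - j.

Definition traceC n s : code := {|
  ext := (0, s); discs := [:: ((n, s), 0)];
  strs := [:: [::]; [seq ncolumn n p | p <- iota 0 n.*2]];
  regs := [:: [:: 0]; [seq ngap n j | j <- iota 0 n.*2.-1.+1]];
  sides := [seq if s (+) odd k then (k, k.+1) else (k.+1, k) | k <- iota 0 n];
  shades := [seq s (+) odd g | g <- iota 0 n.+1] |}.

Definition mlev (l : option bool) := if l is Some b then if b then 0 else 2 else 1.
Definition mgap n g (l : option bool) :=
  if l is Some b then if 0 < g < n then n.+1 + (g.-1.*2 + b) else g else g.
Definition mtab n v := [seq ncolumn n p + n * mlev (mul_level v (p < n)) | p <- iota 0 n.*2].
Definition mrtab n v := [seq mgap n (ngap n j) (mul_level v (j <= n)) | j <- iota 0 n.*2.-1.+1].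

(** Strands are numbered [k + n * mlev l], for the column [k] and the level [l].  The gaps
    at level [None], [n.+1] in number, precede those of the two other levels, which exist
    for inner gaps only. *)
Definition mulC n s : code := {|
  ext := (n, s); discs := [:: ((n, s), 0); ((n, s), 1)];
  strs := [:: mtab n None; mtab n (Some false); mtab n (Some true)];
  regs := [:: mrtab n None; mrtab n (Some false); mrtab n (Some true)];
  sides := flatten [seq [seq let g b := mgap n (if b == s (+) odd k then k else k.+1) l in
      (g true, g false) | k <- iota 0 n] | l <- [:: Some true; None; Some false]];
  shades := [seq s (+) odd g | g <- iota 0 n.+1] ++
     flatten [seq [seq s (+) ~~ odd k | b <- [:: false; true]] | k <- iota 0 n.-1] |}.

Definition rotC s : code := {|
  ext := (2, ~~ s); discs := [:: ((2, s), 0)];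
  strs := [:: [:: 3; 0; 1; 2]; [:: 0; 1; 2; 3]];
  regs := [:: [:: 3; 0; 1; 2]; [:: 0; 1; 2; 3]];
  sides := [seq if s (+) odd e then (e, e.+1 %% 4) else (e.+1 %% 4, e) | e <- iota 0 4];
  shades := [seq s (+) odd r | r <- iota 0 4] |}.

Definition coprodC s : code := {|
  ext := (2, s); discs := [:: ((2, s), 0); ((2, s), 1)];
  strs := [:: [:: 0; 1; 2; 3]; [:: 0; 4; 5; 3]; [:: 4; 1; 2; 5]];
  regs := [:: [:: 0; 1; 2; 3]; [:: 0; 1; 4; 3]; [:: 4; 1; 2; 3]];
  sides := [seq if s (+) odd e then (e, e.+1 %% 4) else (e.+1 %% 4, e) | e <- iota 0 4] ++
     [:: if s then (4, 1) else (1, 4); if s then (4, 3) else (3, 4)];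
  shades := [seq s (+) odd r | r <- iota 0 4] ++ [:: s] |}.

Lemma nth_flatten_const (A : Type) (x0 : A) n (F : nat -> nat -> A) m i j : i < m -> j < n ->
  nth x0 (flatten [seq [seq F i j | j <- iota 0 n] | i <- iota 0 m]) (i * n + j) = F i j.
Proof.
move=> hi hj; elim: m i F hi => [|m IH] i F //= hi.
rewrite nth_cat size_map size_iota; case: i hi => [|i] hi.
  by rewrite mul0n add0n hj (nth_map 0) ?size_iota // nth_iota.
rewrite ifF; last by rewrite mulSn -addnA ltnNge leq_addr.
rewrite mulSn -addnA addKn -(addn0 1) iotaDl -map_comp.
exact: (IH i (fun i => F i.+1)).
Qed.

Section StandardTangles.
Context (R : realType) (P : planarAlgebra R).

Lemma trace_present n s (vs : nat -> value P) : planarC (traceC n s) ->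
  inj (act P (trace_tangle n s) (fun d => vs 0 (n, s))) = inj (ev (traceC n s) vs).
Proof.
move=> h; have r : realizes (traceC n s) (fun _ : unit => (n, s)) (0, s) (fun _ => 0).
  by apply: Realizes => //; [case=> -[]|case=> // _; exists tt].
apply: (present h r (T := trace_tangle n s) (psi := @nat_of_ord n) (psr := @nat_of_ord n.+1)).
- exact: ord_inj.
- exact: ord_inj.
- by move=> e; rewrite /nstr size_map size_iota.
- by move=> e; rewrite /nreg size_map size_iota.
- by rewrite card_ord /nstr size_map size_iota.
- by rewrite card_ord /nreg size_map size_iota.
- case=> [[]|] i; last by case: i.
  have hi := ltn_ord i; rewrite /str /= (nth_map 0) ?size_iota // nth_iota //.
- case=> [[]|] i; last by rewrite ord1.
  have hi := ltn_ord i; rewrite [RHS]gapE /reg /=.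
  rewrite -[X in nth _ X]/(mkseq (ngap n) n.*2.-1.+1) nth_mkseq //.
- move=> e b; rewrite /sid /sides /= (nth_map 0) ?size_iota // nth_iota // add0n.
  rewrite inordK; first by case: (s (+) odd e); case: b.
  by have := ltn_ord e; case: ifP; lia.
Qed.

Lemma mul_present n s (vs : nat -> value P) : planarC (mulC n s) ->
  inj (act P (mul_tangle n s) (fun d : bool => vs d (n, s))) = inj (ev (mulC n s) vs).
Proof.
move=> h; have r : realizes (mulC n s) (fun _ : bool => (n, s)) (n, s) (fun d : bool => d : nat).
  apply: Realizes => //; [by case|by case|by case=> -[]|].
  by case=> [|[|//]] _; [exists false|exists true].
have ns : nstr (mulC n s) = 3 * n.
  by rewrite /nstr /= cats0 !size_cat !size_map !size_iota; lia.
pose psi (e : 'I_n * option bool) := e.1 + n * mlev e.2.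
pose psr (x : 'I_n.+1 + 'I_n.-1 * bool) :=
  match x with inl g => g : nat | inr (k, b) => n.+1 + (k.*2 + b) end.
have nr : nreg (mulC n s) = n.+1 + n.-1 * 2.
  rewrite /nreg /= size_cat !size_map size_iota size_flatten /shape -map_comp sumnE big_map.
  by rewrite (eq_bigr (fun=> 2)) // big_const_seq count_predT size_iota iter_addn_0; lia.
have psrE g l : g <= n -> psr (mul_gap n g l) = mgap n g l.
  move=> gn; rewrite /mul_gap /mgap; case: l => [b|] /=; last by rewrite inordK.
  case: posnP => [->|g0] /=; first by rewrite inordK.
  case: insubP => [k hk /= ek|hk]; first by rewrite ek (_ : g < n) //; lia.
  by rewrite (_ : g < n = false) /= ?inordK //; lia.
have lev3 l : mlev l < 3 by case: l => [[]|].
have ltP : forall e, psi e < nstr (mulC n s).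
  move=> [k l]; rewrite ns /psi /=; have := ltn_ord k; case: l => [[]|] /=; lia.
apply: (present h r (T := mul_tangle n s) (psi := psi) (psr := psr)) => //.
- move=> [k l] [k' l'] /=; rewrite /psi /= => e.
  have hk := ltn_ord k; have hk' := ltn_ord k'.
  have el : mlev l = mlev l' by move: e; case: l => [[]|]; case: l' => [[]|] //=; lia.
  have ek : k = k' by apply: ord_inj; move: e; rewrite el; lia.
  by rewrite ek; congr (_, _); case: l el {e} => [[]|]; case: l' => [[]|].
- move=> [g|[k b]] [g'|[k' b']] /=.
  + by move/ord_inj ->.
  + by have := ltn_ord g; lia.
  + by have := ltn_ord g'; lia.
  + move=> e; have eb : b = b' by move: e; case: (b); case: (b'); lia.
    by rewrite eb in e *; congr (inr (_, _)); apply: ord_inj; lia.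
- rewrite nr => -[g|[k b]] /=; first by have := ltn_ord g; lia.
  by have := ltn_ord k; case: b; lia.
- by rewrite ns card_prod card_option card_bool card_ord mulnC.
- by rewrite nr card_sum card_prod !card_ord card_bool.
- have tab v (p : 'I_(n.*2)) : nth 0 (mtab n v) p = psi (mul_strand v p).
    by rewrite (nth_map 0) ?size_iota // nth_iota.
  by case=> [[]|] i; exact: tab.
- have tab v (j : 'I_(n.*2.-1.+1)) : nth 0 (mrtab n v) j = psr (mul_region v j).
    rewrite /mul_region psrE; last by rewrite -ltnS.
    have -> : nth 0 (mrtab n v) j = mgap n (ngap n j) (mul_level v (j <= n)).
      exact: (@nth_mkseq _ 0 (fun j => mgap n (ngap n j) (mul_level v (j <= n))) _ _ (ltn_ord j)).
    by congr (mgap n _ _); rewrite gapE.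
  by case=> [[]|] i; exact: tab.
- move=> [k l] b; rewrite psrE; last by have := ltn_ord k; case: ifP => /=; lia.
  rewrite /sid; pose G i k :=
    let g b := mgap n (if b == s (+) odd k then k else k.+1)
                 (nth None [:: Some true; None; Some false] i) in (g true, g false).
  rewrite (_ : sides _ = flatten [seq [seq G i k | k <- iota 0 n] | i <- iota 0 3]) //.
  rewrite (_ : psi (k, l) = mlev l * n + k); last by rewrite /psi /=; lia.
  rewrite nth_flatten_const //; rewrite /G (_ : nth None _ (mlev l) = l); last by case: (l) => [[]|].
  by case: b.
Qed.

Lemma rot_present s t (st : t = ~~ s) (vs : nat -> value P) : planarC (rotC s) ->
  inj (act P (rot_tangle st) (fun d : unit => vs 0 (2, s))) = inj (ev (rotC s) vs).
Proof.
move=> h; have r : realizes (rotC s) (fun _ : unit => (2, s)) (2, t) (fun _ => 0).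
  by apply: Realizes => //; [rewrite st|case=> -[]|case=> // _; exists tt].
apply: (present h r (T := rot_tangle st) (psi := @nat_of_ord 4) (psr := @nat_of_ord 4)) => //.
- exact: ord_inj.
- exact: ord_inj.
- by rewrite card_ord.
- by rewrite card_ord.
- by case=> [[]|] [[|[|[|[|]]]]].
- by case=> [[]|] [[|[|[|[|]]]]].
- by case=> [[|[|[|[|]]]]] // i [] /=; rewrite /sid /=; case: (s).
Qed.

Lemma coprod_present s (vs : nat -> value P) : planarC (coprodC s) ->
  inj (act P (coprod_tangle s) (fun d : bool => vs (~~ d) (2, s))) = inj (ev (coprodC s) vs).
Proof.
move=> h; have r : realizes (coprodC s) (fun _ : bool => (2, s)) (2, s) (fun d : bool => ~~ d : nat).
  apply: Realizes => //; [by case|by case|by case=> -[]|].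
  by case=> [|[|//]] _; [exists true|exists false].
pose psi (x : 'I_4 + bool) := match x with inl p => p : nat | inr b => 5 - b end.
pose psr (x : option 'I_4) := if x is Some p then p : nat else 4.
apply: (present h r (T := coprod_tangle s) (psi := psi) (psr := psr)) => //.
- move=> [p|[]] [q|[]] //=; try by [move/ord_inj ->|have := ltn_ord p; lia|have := ltn_ord q; lia].
- move=> [p|] [q|] //=; try by [move/ord_inj ->|have := ltn_ord p; lia|have := ltn_ord q; lia].
- by case=> [p|[]] //=; have := ltn_ord p; rewrite /nstr /=; lia.
- by case=> [p|] //=; have := ltn_ord p; rewrite /nreg /=; lia.
- by rewrite card_sum card_ord card_bool.
- by rewrite card_option card_ord.
- by case=> [[]|] [[|[|[|[|]]]]].
- by case=> [[]|] [[|[|[|[|]]]]].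
- case=> [[e he]|[]] []; rewrite /sid /=; try by case: (s).
  + by case: e he => [|[|[|[|]]]] //=; case: (s).
  + by case: e he => [|[|[|[|]]]] //=; case: (s).
Qed.

Context (rho : nat -> value P).

Lemma sem_trace n s t : planarC (traceC n s) ->
  scalar_of (sem rho (Op (traceC n s) [:: t]) (0, s)) = tr (sem rho t (n, s)).
Proof.
move=> h; rewrite /= /tr; congr scalar_of.
have -> : ev (traceC n s) (fun d => nth (fun c => 0%R : P c) [:: sem rho t] d) =
  ev (traceC n s) (fun=> sem rho t) by apply: ev_ext => -[|d].
by rewrite -(trace_present (fun _ => sem rho t) h) injE.
Qed.

Lemma sem_mul n s t t' : planarC (mulC n s) ->
  sem rho (Op (mulC n s) [:: t; t']) (n, s) = Defs.mul (sem rho t (n, s)) (sem rho t' (n, s)).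
Proof.
move=> h; have := mul_present (fun d => nth (fun c => 0%R : P c) [:: sem rho t; sem rho t'] d) h.
move/(congr1 (fun g => g (n, s))); rewrite injE /= => <-; congr (act _ _ _).
by apply: functional_extensionality_dep => -[].
Qed.

Lemma sem_rot s s' (st : s' = ~~ s) t : planarC (rotC s) ->
  sem rho (Op (rotC s) [:: t]) (2, s') = fourier_to st (sem rho t (2, s)).
Proof.
move=> h; rewrite /=; have -> : ev (rotC s) (fun d => nth (fun c => 0%R : P c) [:: sem rho t] d) =
  ev (rotC s) (fun=> sem rho t) by apply: ev_ext => -[|d].
by rewrite -(rot_present st (fun _ => sem rho t) h) injE.
Qed.

Lemma sem_coprod s t t' : planarC (coprodC s) ->
  sem rho (Op (coprodC s) [:: t; t']) (2, s) = coprod (sem rho t (2, s)) (sem rho t' (2, s)).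
Proof.
move=> h; have := coprod_present (fun d => nth (fun c => 0%R : P c) [:: sem rho t; sem rho t'] d) h.
move/(congr1 (fun g => g (2, s))); rewrite injE /= => <-; congr (act _ _ _).
by apply: functional_extensionality_dep => -[].
Qed.

End StandardTangles.

(** * Diagrammatic identities for two-boxes *)

(** Most diagrams are determined by the table [tab] of strands at boundary points.  The
    flanks [(e, b)] of the [n] strands are merged when they share a boundary interval,
    and the classes serve as regions; [planarC] tests the outcome. *)
Definition autoC (c : color) (ds : seq color) (tab : seq (seq nat)) (n : nat) : code :=
  let cs := c :: ds in
  let shade_at v i := (nth (0, true) cs v).2 (+) odd i in
  let end_of v i := nth 0 (nth [::] tab v) i in
  let E := flatten [seq let m := npts (nth (0, true) cs v) in
     [seq ((end_of v i, ~~ shade_at v i), (end_of v (i.+1 %% m), ~~ shade_at v i)) | i <- iota 0 m]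
     | v <- iota 0 (size cs)] in
  let cl := classes E in
  let ls := undup [seq cl x | x <- flatten [seq [:: (e, true); (e, false)] | e <- iota 0 n]] in
  let rho x := index (cl x) ls in {|
  ext := c; discs := [seq (d, 0) | d <- ds]; strs := tab;
  regs := [seq [seq rho (end_of v i, shade_at v i) | i <- iota 0 (npts (nth (0, true) cs v))]
    | v <- iota 0 (size cs)];
  sides := [seq (rho (e, true), rho (e, false)) | e <- iota 0 n];
  shades := [seq x.2 | x <- ls] |}.

(** The codes below: one and two vertical strings; the partial trace of a two-box on its
    right strings; a one-box with a vertical string to its right; and three-boxes built
    from two or three two-boxes, any two of which share one string. *)
Definition unit1C s := autoC (1, s) [::] [:: [:: 0; 0]] 1.
Definition unit2C s := autoC (2, s) [::] [:: [:: 0; 1; 1; 0]] 2.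
Definition rptC s := autoC (1, s) [:: (2, s)] [:: [:: 0; 1]; [:: 0; 2; 2; 1]] 3.
Definition padC s := autoC (2, s) [:: (1, s)] [:: [:: 0; 1; 1; 2]; [:: 0; 2]] 3.
Definition linkC s := autoC (3, ~~ s) [:: (2, s); (2, ~~ s)]
  [:: [:: 1; 2; 3; 4; 5; 6]; [:: 0; 1; 2; 3]; [:: 5; 6; 0; 4]] 7.
Definition link'C s := autoC (3, ~~ s) [:: (2, s); (2, ~~ s)]
  [:: [:: 1; 2; 3; 4; 5; 6]; [:: 4; 0; 2; 3]; [:: 5; 6; 1; 0]] 7.
Definition triC s := autoC (3, s) [:: (2, s); (2, s); (2, s)]
  [:: [:: 3; 4; 5; 6; 7; 8]; [:: 2; 0; 3; 4]; [:: 0; 1; 7; 8]; [:: 5; 6; 1; 2]] 9.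

Notation bX s i := (Var (2, s) i).
Notation tM s a b := (Op (mulC 2 s) [:: a; b]).
Notation tM3 s a b := (Op (mulC 3 s) [:: a; b]).
Notation tF s a := (Op (rotC s) [:: a]).
Notation tC s a b := (Op (coprodC s) [:: a; b]).
Notation tTr n s a := (Op (traceC n s) [:: a]).
Notation tOne s := (Op (unit2C s) [::]).

Definition loopC s : code := {|
  ext := (0, s); discs := [::]; strs := [:: [::]]; regs := [:: [:: s : nat]];
  sides := [:: (1, 0)]; shades := [:: false; true] |}.

Lemma planar_mul n s : 0 < n < 4 -> planarC (mulC n s).
Proof. by case: n => [|[|[|[|n]]]] // _; case: s; vm_compute. Qed.

Lemma planar_trace n s : 0 < n < 4 -> planarC (traceC n s).
Proof. by case: n => [|[|[|[|n]]]] // _; case: s; vm_compute. Qed.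

Lemma planar_rot s : planarC (rotC s). Proof. by case: s; vm_compute. Qed.
Lemma planar_coprod s : planarC (coprodC s). Proof. by case: s; vm_compute. Qed.
Lemma planar_loop s : planarC (loopC s). Proof. by case: s; vm_compute. Qed.

Section Diagrams.
Context (R : realType) (P : planarAlgebra R).

Lemma loop_present s (vs : nat -> value P) :
  inj (act P (loop_tangle s) (fun d : void => match d with end)) = inj (ev (loopC s) vs).
Proof.
have r : realizes (loopC s) (of_void color) (0, s) (fun d : void => match d with end).
  by apply: Realizes => // -[].
have H := present (planar_loop s) r (T := loop_tangle s) (psi := fun=> 0) (psr := nat_of_bool).
rewrite -H.
- by congr (inj (act _ _ _)); apply: functional_extensionality_dep => -[].
- by move=> [] [].
- by move=> [] [].
- by [].
- by case.
- by rewrite card_unit.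
- by rewrite card_bool.
- by case=> [[]|] [].
- by case=> [[]|] i //; rewrite ord1.
- by move=> e [].
Qed.

Definition env (l : seq (value P)) i := nth (fun c => 0%R : P c) l i.

Lemma sem_var rho c i : sem rho (Var c i) c = rho i c :> P c.
Proof. exact: injE. Qed.

Lemma sem_star rho c t : sem rho (Star t) c = star (sem rho t c) :> P c.
Proof. by []. Qed.

End Diagrams.

Section TwoBoxIdentities.
Context (R : realType) (P : subfactorPlanarAlgebra R).
Local Notation mul := Defs.mul.
Local Notation A s := (P (2, s)).
Implicit Types s t : bool.

Definition one s : A s := ev (unit2C s) (fun _ _ => 0%R).
Definition strand1 s : P (1, s) := ev (unit1C s) (fun _ _ => 0%R).

Lemma sem_one rho s : sem rho (Op (unit2C s) [::]) (2, s) = one s.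
Proof. by rewrite /= (@ev_ext _ _ _ _ (fun _ _ => 0%R)) //; exact: injE. Qed.

Lemma sem_strand1 rho s : sem rho (Op (unit1C s) [::]) (1, s) = strand1 s.
Proof. by rewrite /= (@ev_ext _ _ _ _ (fun _ _ => 0%R)) //; exact: injE. Qed.

(** This proof and those that follow have one pattern: both sides are terms, the diagrams
    are compared by evaluation, and the operations are read back. *)
Lemma box_mulA s (x y z : A s) : mul (mul x y) z = mul x (mul y z).
Proof.
have chk : equiv_terms (tM s (tM s (bX s 0) (bX s 1)) (bX s 2)) (tM s (bX s 0) (tM s (bX s 1) (bX s 2))).
  by case: (s); vm_compute.
have := congr1 (fun g => g (2, s)) (sem_eq (env [:: inj x; inj y; inj z]) chk).
by rewrite !sem_mul ?planar_mul // !sem_var /env /= !injE.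
Qed.

Lemma box_mulx1 s (x : A s) : mul x (one s) = x.
Proof.
have chk : equiv_terms (tM s (bX s 0) (tOne s)) (bX s 0) by case: (s); vm_compute.
have := congr1 (fun g => g (2, s)) (sem_eq (env [:: inj x]) chk).
by rewrite !sem_mul ?planar_mul // sem_one !sem_var /env /= !injE.
Qed.

Lemma box_mul1x s (x : A s) : mul (one s) x = x.
Proof.
have chk : equiv_terms (tM s (tOne s) (bX s 0)) (bX s 0) by case: (s); vm_compute.
have := congr1 (fun g => g (2, s)) (sem_eq (env [:: inj x]) chk).
by rewrite !sem_mul ?planar_mul // sem_one !sem_var /env /= !injE.
Qed.

Lemma star_boxM s (x y : A s) : star (mul x y) = mul (star y) (star x).
Proof.
have chk : equiv_terms (Star (tM s (bX s 0) (bX s 1))) (tM s (Star (bX s 1)) (Star (bX s 0))).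
  by case: (s); vm_compute.
have := congr1 (fun g => g (2, s)) (sem_eq (env [:: inj x; inj y]) chk).
by rewrite sem_star !sem_mul ?planar_mul // !sem_star !sem_var /env /= !injE.
Qed.

Lemma star_box1 s : star (one s) = one s.
Proof.
have chk : equiv_terms (Star (tOne s)) (tOne s) by case: (s); vm_compute.
have := congr1 (fun g => g (2, s)) (sem_eq (env (P := P) [::]) chk).
by rewrite sem_star sem_one.
Qed.

Lemma tr_boxC s (x y : A s) : tr (mul x y) = tr (mul y x).
Proof.
have chk : sphere_terms s (tTr 2 s (tM s (bX s 0) (bX s 1))) s (tTr 2 s (tM s (bX s 1) (bX s 0))).
  by case: (s); vm_compute.
have := sem_sphere (env [:: inj x; inj y]) chk.
by rewrite !sem_trace ?planar_trace // !sem_mul ?planar_mul // !sem_var /env /= !injE.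
Qed.

Lemma rot4 s t (st : t = ~~ s) (ts : s = ~~ t) (x : A s) :
  fourier_to ts (fourier_to st (fourier_to ts (fourier_to st x))) = x.
Proof.
have chk : equiv_terms (tF t (tF s (tF t (tF s (bX s 0))))) (bX s 0) by rewrite st; case: (s); vm_compute.
have := congr1 (fun g => g (2, s)) (sem_eq (env [:: inj x]) chk).
by rewrite !(sem_rot _ ts, sem_rot _ st) ?planar_rot // !sem_var /env /= !injE.
Qed.

Lemma rot_star s t (st : t = ~~ s) (ts : s = ~~ t) (x : A s) :
  fourier_to ts (star (fourier_to st x)) = star x.
Proof.
have chk : equiv_terms (tF t (Star (tF s (bX s 0)))) (Star (bX s 0)) by rewrite st; case: (s); vm_compute.
have := congr1 (fun g => g (2, s)) (sem_eq (env [:: inj x]) chk).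
by rewrite (sem_rot _ ts) ?planar_rot // !sem_star (sem_rot _ st) ?planar_rot // !sem_var /env /= !injE.
Qed.

Lemma rot_mul s t (st : t = ~~ s) (x y : A s) :
  fourier_to st (mul x y) = coprod (fourier_to st x) (fourier_to st y).
Proof.
have chk : equiv_terms (tF s (tM s (bX s 0) (bX s 1))) (tC t (tF s (bX s 0)) (tF s (bX s 1))).
  by rewrite st; case: (s); vm_compute.
have := congr1 (fun g => g (2, t)) (sem_eq (env [:: inj x; inj y]) chk).
by rewrite sem_coprod ?planar_coprod // !(sem_rot _ st) ?planar_rot // sem_mul ?planar_mul //
  !sem_var /env /= !injE.
Qed.

Lemma tr_rot s t (st : t = ~~ s) (ts : s = ~~ t) (x : A s) (y : A t) :
  tr (mul (fourier_to st x) y) = tr (mul x (fourier_to ts y)).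
Proof.
have chk : sphere_terms t (tTr 2 t (tM t (tF s (bX s 0)) (bX t 1))) s (tTr 2 s (tM s (bX s 0) (tF t (bX t 1)))).
  by rewrite st; case: (s); vm_compute.
have := sem_sphere (env [:: inj x; inj y]) chk.
by rewrite !sem_trace ?planar_trace // !sem_mul ?planar_mul // (sem_rot _ st) ?planar_rot //
  (sem_rot _ ts) ?planar_rot // !sem_var /env /= !injE.
Qed.

Lemma rot2_mul s t (st : t = ~~ s) (ts : s = ~~ t) (x y : A s) :
  fourier_to ts (fourier_to st (mul x y)) =
  mul (fourier_to ts (fourier_to st y)) (fourier_to ts (fourier_to st x)).
Proof.
have chk : equiv_terms (tF t (tF s (tM s (bX s 0) (bX s 1))))
    (tM s (tF t (tF s (bX s 1))) (tF t (tF s (bX s 0)))) by rewrite st; case: (s); vm_compute.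
have := congr1 (fun g => g (2, s)) (sem_eq (env [:: inj x; inj y]) chk).
by rewrite !sem_mul ?planar_mul // !(sem_rot _ ts, sem_rot _ st) ?planar_rot // sem_mul ?planar_mul //
  !sem_var /env /= !injE.
Qed.

Lemma star_coprod s (x y : A s) : star (coprod x y) = coprod (star x) (star y).
Proof.
have chk : equiv_terms (Star (tC s (bX s 0) (bX s 1))) (tC s (Star (bX s 0)) (Star (bX s 1))).
  by case: (s); vm_compute.
have := congr1 (fun g => g (2, s)) (sem_eq (env [:: inj x; inj y]) chk).
by rewrite sem_star !sem_coprod ?planar_coprod // !sem_star !sem_var /env /= !injE.
Qed.

(** Two ways of joining a two-box [g] to a two-box [y] of the opposite shading into a
    three-box.  Their pairings with themselves and with each other are the traces in the
    four lemmas below, whose Cauchy-Schwarz inequality gives [young]. *)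
Definition link s (g : A s) (y : P (2, ~~ s)) : P (3, ~~ s) :=
  sem (env [:: inj g; inj y]) (Op (linkC s) [:: bX s 0; bX (~~ s) 1]) (3, ~~ s).
Definition link' s (g : A s) (y : P (2, ~~ s)) : P (3, ~~ s) :=
  sem (env [:: inj g; inj y]) (Op (link'C s) [:: bX s 0; bX (~~ s) 1]) (3, ~~ s).
Definition triangle s (u v y : A s) : P (3, s) :=
  sem (env [:: inj u; inj v; inj y]) (Op (triC s) [:: bX s 0; bX s 1; bX s 2]) (3, s).

Lemma link_link s (g : A s) (y : P (2, ~~ s)) :
  let t := ~~ s in let ts := esym (negbK s) in
  let g' := fourier_to (erefl t) g in let y' := fourier_to (erefl t) (fourier_to ts y) in
  tr (mul (star (link g y)) (link g y)) = tr (coprod (mul (star g') g') (mul (star y') y')).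
Proof.
move=> t ts g' y'.
pose V := Op (linkC s) [:: bX s 0; bX t 1]; pose G := tF s (bX s 0); pose Y := tF s (tF t (bX t 1)).
have chk : sphere_terms t (tTr 3 t (tM3 t (Star V) V)) t (tTr 2 t (tC t (tM t (Star G) G) (tM t (Star Y) Y))).
  by rewrite /V /G /Y /t; case: (s); vm_compute.
(* Without a body for [V] the next steps cannot unfold the diagram. *)
have eV : link g y = sem (env [:: inj g; inj y]) V (3, t) := erefl; rewrite eV; clearbody V.
have := sem_sphere (env [:: inj g; inj y]) chk.
rewrite !sem_trace ?planar_trace // sem_coprod ?planar_coprod // !sem_mul ?planar_mul // !sem_star.
rewrite /G /Y.
by rewrite !(sem_rot _ (erefl t)) ?planar_rot // (sem_rot _ ts) ?planar_rot // !sem_var /env /= !injE.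
Qed.

Lemma link'_link' s (g : A s) (y : P (2, ~~ s)) :
  let y' := fourier_to (esym (negbK s)) y in
  tr (mul (star (link' g y)) (link' g y)) = tr (coprod (mul (star g) g) (mul (star y') y')).
Proof.
move=> y'; pose t := ~~ s.
pose V := Op (link'C s) [:: bX s 0; bX t 1]; pose Y := tF t (bX t 1).
have chk : sphere_terms t (tTr 3 t (tM3 t (Star V) V)) s
    (tTr 2 s (tC s (tM s (Star (bX s 0)) (bX s 0)) (tM s (Star Y) Y))).
  by rewrite /V /Y /t; case: (s); vm_compute.
have eV : link' g y = sem (env [:: inj g; inj y]) V (3, t) := erefl; rewrite eV; clearbody V.
have := sem_sphere (env [:: inj g; inj y]) chk.
rewrite !sem_trace ?planar_trace // sem_coprod ?planar_coprod // !sem_mul ?planar_mul // !sem_star.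
rewrite /Y.
by rewrite (sem_rot _ (esym (negbK s))) ?planar_rot // !sem_var /env /= !injE.
Qed.

Lemma link'_link s (g : A s) (y : P (2, ~~ s)) :
  tr (mul (star (link' g y)) (link g y)) =
  tr (mul (fourier (mul (star g) g)) (mul y (star y))).
Proof.
pose t := ~~ s.
pose V := Op (linkC s) [:: bX s 0; bX t 1]; pose V' := Op (link'C s) [:: bX s 0; bX t 1].
have chk : sphere_terms t (tTr 3 t (tM3 t (Star V') V)) t
    (tTr 2 t (tM t (tF s (tM s (Star (bX s 0)) (bX s 0))) (tM t (bX t 1) (Star (bX t 1))))).
  by rewrite /V /V' /t; case: (s); vm_compute.
have eV : link g y = sem (env [:: inj g; inj y]) V (3, t) := erefl.
have eV' : link' g y = sem (env [:: inj g; inj y]) V' (3, t) := erefl.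
rewrite eV eV'; clearbody V V'.
have := sem_sphere (env [:: inj g; inj y]) chk.
rewrite !sem_trace ?planar_trace // !sem_mul ?planar_mul // (sem_rot _ (erefl t)) ?planar_rot //.
rewrite sem_star.
by rewrite !sem_mul ?planar_mul // !sem_star !sem_var /env /= !injE.
Qed.

Lemma link_link' s (g : A s) (y : P (2, ~~ s)) :
  tr (mul (star (link g y)) (link' g y)) =
  tr (mul (mul y (star y)) (star (fourier (mul (star g) g)))).
Proof.
pose t := ~~ s.
pose V := Op (linkC s) [:: bX s 0; bX t 1]; pose V' := Op (link'C s) [:: bX s 0; bX t 1].
have chk : sphere_terms t (tTr 3 t (tM3 t (Star V) V')) t
    (tTr 2 t (tM t (tM t (bX t 1) (Star (bX t 1))) (Star (tF s (tM s (Star (bX s 0)) (bX s 0)))))).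
  by rewrite /V /V' /t; case: (s); vm_compute.
have eV : link g y = sem (env [:: inj g; inj y]) V (3, t) := erefl.
have eV' : link' g y = sem (env [:: inj g; inj y]) V' (3, t) := erefl.
rewrite eV eV'; clearbody V V'.
have := sem_sphere (env [:: inj g; inj y]) chk.
rewrite !sem_trace ?planar_trace // !sem_mul ?planar_mul // !sem_star (sem_rot _ (erefl t)) ?planar_rot //.
by rewrite !sem_mul ?planar_mul // !sem_star !sem_var /env /= !injE.
Qed.

(** The three-box pairs with itself to the value of a coproduct of squares against a
    square, so this value is nonnegative ([schur]). *)
Lemma tri_tri s (u v y : A s) :
  tr (mul (star (triangle u v y)) (triangle u v y)) =
  tr (mul (coprod (mul (star u) u) (mul (star v) v)) (mul y (star y))).
Proof.
pose V := Op (triC s) [:: bX s 0; bX s 1; bX s 2].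
have chk : sphere_terms s (tTr 3 s (tM3 s (Star V) V)) s
    (tTr 2 s (tM s (tC s (tM s (Star (bX s 0)) (bX s 0)) (tM s (Star (bX s 1)) (bX s 1)))
       (tM s (bX s 2) (Star (bX s 2))))).
  by rewrite /V; case: (s); vm_compute.
have eV : triangle u v y = sem (env [:: inj u; inj v; inj y]) V (3, s) := erefl; rewrite eV; clearbody V.
have := sem_sphere (env [:: inj u; inj v; inj y]) chk.
rewrite !sem_trace ?planar_trace // !sem_mul ?planar_mul // sem_coprod ?planar_coprod //.
rewrite sem_star.
by rewrite !sem_mul ?planar_mul // !sem_star !sem_var /env /= !injE.
Qed.

Lemma mul_strand1 s (u : P (1, s)) : mul u (strand1 s) = u.
Proof.
have chk : equiv_terms (Op (mulC 1 s) [:: Var (1, s) 0; Op (unit1C s) [::]]) (Var (1, s) 0).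
  by case: (s); vm_compute.
have := congr1 (fun g => g (1, s)) (sem_eq (env [:: inj u]) chk).
by rewrite !sem_mul ?planar_mul // sem_strand1 !sem_var /env /= !injE.
Qed.

Lemma star_strand1 s : star (strand1 s) = strand1 s.
Proof.
have chk : equiv_terms (Star (Op (unit1C s) [::])) (Op (unit1C s) [::]) by case: (s); vm_compute.
have := congr1 (fun g => g (1, s)) (sem_eq (env (P := P) [::]) chk).
by rewrite sem_star sem_strand1.
Qed.

Lemma tr_strand1 s : tr (strand1 s) = loop_value P.
Proof.
have chk : sphere_terms s (tTr 1 s (Op (unit1C s) [::])) true (Op (loopC true) [::]).
  by case: (s); vm_compute.
have := sem_sphere (env (P := P) [::]) chk; rewrite sem_trace ?planar_trace // sem_strand1 => ->.
rewrite /loop_value; congr scalar_of.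
rewrite -[RHS]injE (loop_present true (fun=> fun=> 0%R)) /=.
by rewrite (@ev_ext _ P (loopC true) _ (fun=> fun=> 0%R)).
Qed.

Lemma tr_rot1 s t (st : t = ~~ s) : tr (fourier_to st (one s)) = loop_value P.
Proof.
have chk : sphere_terms t (tTr 2 t (tF s (tOne s))) s (tTr 1 s (Op (unit1C s) [::])).
  by rewrite st; case: (s); vm_compute.
have := sem_sphere (env (P := P) [::]) chk.
rewrite !sem_trace ?planar_trace // sem_strand1 tr_strand1 (sem_rot _ st) ?planar_rot //.
by rewrite sem_one.
Qed.

Definition partial_trace s (x : A s) : P (1, s) :=
  sem (env [:: inj x]) (Op (rptC s) [:: bX s 0]) (1, s).
Definition pad s (u : P (1, s)) : A s := ev (padC s) (fun=> inj u).

Lemma tr_partial_trace s (x : A s) : tr (partial_trace x) = tr x.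
Proof.
have chk : sphere_terms s (tTr 1 s (Op (rptC s) [:: bX s 0])) s (tTr 2 s (bX s 0)).
  by case: (s); vm_compute.
have := sem_sphere (env [:: inj x]) chk.
by rewrite !sem_trace ?planar_trace // -/(partial_trace x) sem_var /env /= injE.
Qed.

Lemma sem_pad rho s (t : term) : sem rho (Op (padC s) [:: t]) (2, s) = pad (sem rho t (1, s)).
Proof.
rewrite /= /pad; have h : planarC (padC s) by case: (s); vm_compute.
rewrite [LHS]injE (evE h) (evE h); congr (act _ _ _).
apply: functional_extensionality_dep => -[[|d] hd] //=.
by rewrite /dcol /= injE.
Qed.

Lemma pad_strand1 s : pad (strand1 s) = one s.
Proof.
have chk : equiv_terms (Op (padC s) [:: Op (unit1C s) [::]]) (tOne s) by case: (s); vm_compute.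
have := congr1 (fun g => g (2, s)) (sem_eq (env (P := P) [::]) chk).
by rewrite sem_pad sem_strand1 sem_one.
Qed.

(** Joining [x] to two vertical strings closes its right strings up. *)
Lemma coprod_one s (x : A s) : coprod x (one s) = pad (partial_trace x).
Proof.
have chk : equiv_terms (tC s (bX s 0) (tOne s)) (Op (padC s) [:: Op (rptC s) [:: bX s 0]]).
  by case: (s); vm_compute.
have := congr1 (fun g => g (2, s)) (sem_eq (env [:: inj x]) chk).
by rewrite sem_pad -/(partial_trace x) sem_coprod ?planar_coprod // sem_one sem_var /env /= injE.
Qed.

Lemma pad_linear s (a : R[i]) (u v : P (1, s)) : pad (a *: u + v)%R = (a *: pad u + pad v)%R.
Proof.
have h : planarC (padC s) by case: (s); vm_compute.
rewrite /pad !(evE h).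
pose o : 'I_(ndisc (padC s)) := Ordinal (erefl : 0 < ndisc (padC s)).
have upd (w : P (1, s)) : (fun d : 'I_(ndisc (padC s)) => inj w (dcol (padC s) d)) =
    @dfwith 'I_(ndisc (padC s)) (fun d => P (dcol (padC s) d)) (fun d => 0%R) o w.
  apply: functional_extensionality_dep => d.
  have -> : d = o by apply: ord_inj; case: d => -[].
  by rewrite dfwithin; exact: injE.
by rewrite !upd; exact: (@act_multilinear R P _ _ _ (tangle_of h (std_realizes (padC s))) (fun=> 0%R) o).
Qed.
End TwoBoxIdentities.

(** * The algebra of two-boxes *)

Local Open Scope ring_scope.

Section Linearity.
Context (R : realType) (P : planarAlgebra R).
Local Notation mul := Defs.mul.

Lemma linear_at0 (V W : lmodType R[i]) (f : V -> W) : linear f -> f 0 = 0.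
Proof.
move=> lf; have := lf 1 0 0; rewrite scaler0 addr0 scale1r.
by move/(congr1 (fun z => z - f 0)); rewrite subrr addrK => <-.
Qed.

Lemma mul_linear_top n s (x : P (n, s)) a (y z : P (n, s)) :
  mul x (a *: y + z) = a *: mul x y + mul x z.
Proof.
have upd (w : P (n, s)) : (fun top : bool => if top then w else x) =
    @dfwith bool (fun=> P (n, s)) (fun=> x) true w.
  apply: functional_extensionality_dep => -[]; first by rewrite dfwithin.
  by rewrite dfwithout.
by rewrite /mul !upd; exact: (@act_multilinear R P _ (fun=> (n, s)) _ (mul_tangle n s)).
Qed.

Lemma mul_linear_bottom n s (x : P (n, s)) a (y z : P (n, s)) :
  mul (a *: y + z) x = a *: mul y x + mul z x.
Proof.
have upd (w : P (n, s)) : (fun top : bool => if top then x else w) =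
    @dfwith bool (fun=> P (n, s)) (fun=> x) false w.
  apply: functional_extensionality_dep => -[]; last by rewrite dfwithin.
  by rewrite dfwithout.
by rewrite /mul !upd; exact: (@act_multilinear R P _ (fun=> (n, s)) _ (mul_tangle n s)).
Qed.

Lemma act_unit_linear (c c' : color) (T : tangle (fun _ : unit => c) c') a (y z : P c) :
  act P T (fun=> a *: y + z) = a *: act P T (fun=> y) + act P T (fun=> z).
Proof.
have upd (w : P c) : (fun _ : unit => w) = @dfwith unit (fun=> P c) (fun=> w) tt w.
  by apply: functional_extensionality_dep => -[]; rewrite dfwithin.
have upd' (w w' : P c) : @dfwith unit (fun=> P c) (fun=> w) tt w' = (fun=> w').
  by apply: functional_extensionality_dep => -[]; rewrite dfwithin.
have := @act_multilinear R P _ (fun=> c) _ T (fun=> 0) tt a y z.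
by rewrite !upd'.
Qed.

Lemma tr_linear n s a (y z : P (n, s)) : tr (a *: y + z) = a * tr y + tr z.
Proof. by rewrite /tr act_unit_linear /scalar_of linearP. Qed.

Lemma rot_linear s t (st : t = ~~ s) a (y z : P (2, s)%N) :
  fourier_to st (a *: y + z) = a *: fourier_to st y + fourier_to st z.
Proof. exact: act_unit_linear. Qed.

Lemma mulx0 n s (x : P (n, s)) : mul x 0 = 0.
Proof. exact: (linear_at0 (mul_linear_top x)). Qed.

Lemma tr0 n s : tr (0 : P (n, s)) = 0.
Proof. exact: (linear_at0 (W := R[i]^o) (@tr_linear n s)). Qed.

Lemma fourier0 s t (st : t = ~~ s) : fourier_to st (0 : P (2, s)%N) = 0.
Proof. exact: (linear_at0 (rot_linear st)). Qed.
End Linearity.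

Section TwoBox.
Context (R : realType) (P : subfactorPlanarAlgebra R) (irrP : irreducible P).
Local Notation mul := Defs.mul.

(** If the vertical string were zero, so would be every one-box [u] = [u 1]. *)
Lemma strand1_neq0 s : strand1 P s != 0.
Proof.
apply/eqP => e; have /vspaceP H : fullv = 0%VS :> {vspace P (1, s)%N}.
  apply/vspaceP => u; rewrite memvf memv0; apply/esym/eqP.
  by rewrite -(mul_strand1 u) e mulx0.
have := irrP s; have -> : fullv = 0%VS :> {vspace P (1, s)%N} by exact/vspaceP.
by rewrite dimv0.
Qed.

Lemma loop_gt0 : 0 < loop_value P.
Proof.
have := trace_posdef (strand1_neq0 true).
by rewrite mul_strand1 star_strand1 tr_strand1.
Qed.

Lemma one_neq0 s : one P s != 0.
Proof.
apply/eqP => e; have := tr_rot1 P (erefl (~~ s)); rewrite e fourier0 tr0 => l0.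
by have := loop_gt0; rewrite -l0 ltxx.
Qed.

Lemma one_box (s : bool) (u : P (1, s)%N) : exists a, u = a *: strand1 P s.
Proof.
have /vspaceP/(_ u) : <[strand1 P s]>%VS = fullv.
  apply/eqP; rewrite -(dimv_leqif_eq (subvf _)) dim_vline strand1_neq0; exact/eqP/esym/irrP.
by rewrite memvf => /vlineP.
Qed.

(** The partial trace of [x] is a multiple of the string, as one-boxes have dimension 1. *)
Lemma coprod_box1 s (x : P (2, s)%N) : coprod x (one P s) = (tr x / loop_value P) *: one P s.
Proof.
have [a e] := one_box (partial_trace x).
have tx : tr x = a * loop_value P.
  by rewrite -tr_partial_trace e -[a *: _]addr0 tr_linear tr_strand1 tr0 addr0.
rewrite coprod_one e tx mulfK; last by rewrite gt_eqF // loop_gt0.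
rewrite -pad_strand1 -[a *: _ in LHS]addr0 pad_linear.
by rewrite (linear_at0 (@pad_linear _ P s)) addr0.
Qed.

(** A name for the two-box space on which the algebra structure is declared. *)
Definition tbox (irr : irreducible P) (s : bool) : Type := P (2, s)%N.

End TwoBox.

HB.instance Definition _ R P irrP s := Vector.copy (@tbox R P irrP s) (P (2, s)%N).

Section Algebra.
Context (R : realType) (P : subfactorPlanarAlgebra R) (irrP : irreducible P).
Local Notation A s := (tbox irrP s).

Definition tone s : A s := one P s.
Definition tmul s (x y : A s) : A s := Defs.mul x y.

Fact tmulA s : associative (@tmul s). Proof. by move=> x y z; rewrite /tmul box_mulA. Qed.
Fact tmul1x s : left_id (tone s) (@tmul s). Proof. exact: box_mul1x. Qed.
Fact tmulx1 s : right_id (tone s) (@tmul s). Proof. exact: box_mulx1. Qed.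
Fact tmulDl s : left_distributive (@tmul s) +%R.
Proof. by move=> x y z; have := mul_linear_bottom z 1 x y; rewrite !scale1r. Qed.
Fact tmulDr s : right_distributive (@tmul s) +%R.
Proof. by move=> x y z; have := mul_linear_top x 1 y z; rewrite !scale1r. Qed.
Fact tone_neq0 s : tone s != 0. Proof. exact: one_neq0. Qed.

HB.instance Definition _ s := GRing.Zmodule_isNzRing.Build (A s)
  (@tmulA s) (@tmul1x s) (@tmulx1 s) (@tmulDl s) (@tmulDr s) (@tone_neq0 s).

Fact tscaleAl s a (x y : A s) : a *: (x * y) = (a *: x) * y.
Proof.
have e0 : Defs.mul (0 : P (2, s)%N) y = 0 by exact: (mul0r (y : A s)).
have := mul_linear_bottom (y : P (2, s)%N) a x 0; rewrite addr0 e0 addr0 => /esym; exact.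
Qed.
HB.instance Definition _ s := GRing.Lmodule_isLalgebra.Build R[i] (A s) (@tscaleAl s).

Fact tscaleAr s a (x y : A s) : a *: (x * y) = x * (a *: y).
Proof.
have := mul_linear_top (x : P (2, s)%N) a y 0; rewrite addr0 mulx0 addr0 => /esym; exact.
Qed.
HB.instance Definition _ s := GRing.Lalgebra_isAlgebra.Build R[i] (A s) (@tscaleAr s).

Definition adj s (x : A s) : A s := star x.
Definition tau s (x : A s) : R[i] := tr x.
Definition rot s t (st : t = ~~ s) (x : A s) : A t := fourier_to st x.
Definition conv s (x y : A s) : A s := coprod x y.
Local Notation delta := (loop_value P).

HB.instance Definition _ s := GRing.isLinear.Build R[i] (A s) R[i] *%R (@tau s)
  (fun a x y => tr_linear a x y).
HB.instance Definition _ s t st := GRing.isLinear.Build R[i] (A s) (A t) *:%R (@rot s t st)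
  (fun a x y => rot_linear st a x y).

Lemma adj_linear s a (x y : A s) : adj (a *: x + y) = conjc a *: adj x + adj y.
Proof. exact: star_semilinear. Qed.
Fact adj_zmod s : zmod_morphism (@adj s).
Proof.
move=> x y; have := adj_linear (-1) y x; rewrite !scaleN1r addrC => ->.
by rewrite rmorphN rmorph1 scaleN1r addrC.
Qed.
HB.instance Definition _ s := GRing.isZmodMorphism.Build (A s) (A s) (@adj s) (@adj_zmod s).

Lemma adjZ s a (x : A s) : adj (a *: x) = a^* *: adj x.
Proof. by have := adj_linear a x 0; rewrite !addr0 raddf0 addr0. Qed.
Lemma adjK s : involutive (@adj s). Proof. exact: starK. Qed.
Lemma adjM s (x y : A s) : adj (x * y) = adj y * adj x. Proof. exact: star_boxM. Qed.
Lemma adj1 s : adj 1 = 1 :> A s. Proof. exact: star_box1. Qed.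

Lemma tauC s (x y : A s) : tau (x * y) = tau (y * x). Proof. exact: tr_boxC. Qed.
Lemma tau_gt0 s (x : A s) : x != 0 -> 0 < tau (adj x * x). Proof. exact: trace_posdef. Qed.

Section Rotation.
Context (s t : bool) (st : t = ~~ s) (ts : s = ~~ t).
Lemma rotK4 (x : A s) : rot ts (rot st (rot ts (rot st x))) = x. Proof. exact: rot4. Qed.
Lemma rot_adj (x : A s) : rot ts (adj (rot st x)) = adj x. Proof. exact: rot_star. Qed.
Lemma rotM (x y : A s) : rot st (x * y) = conv (rot st x) (rot st y). Proof. exact: rot_mul. Qed.
Lemma tau_rot (x : A s) (y : A t) : tau (rot st x * y) = tau (x * rot ts y).
Proof. exact: tr_rot. Qed.
Lemma rot2M (x y : A s) : rot ts (rot st (x * y)) = rot ts (rot st y) * rot ts (rot st x).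
Proof. exact: rot2_mul. Qed.
Lemma tau_rot1 : tau (rot st 1) = delta. Proof. exact: tr_rot1. Qed.
End Rotation.

Lemma conv1 s (x : A s) : conv x 1 = (tau x / delta) *: 1. Proof. exact: coprod_box1. Qed.

Lemma adj_conv s (x y : A s) : adj (conv x y) = conv (adj x) (adj y). Proof. exact: star_coprod. Qed.

End Algebra.

(** * Positivity *)

Section Positivity.
Context (R : realType) (P : subfactorPlanarAlgebra R) (irrP : irreducible P).
Local Notation A s := (tbox irrP s).
Local Notation delta := (loop_value P).
Local Notation C := R[i].
Implicit Types (s t : bool).

Lemma adjD s (x y : A s) : adj (x + y) = adj x + adj y. Proof. exact: raddfD. Qed.
Lemma adjN s (x : A s) : adj (- x) = - adj x. Proof. exact: raddfN. Qed.
Lemma adjB s (x y : A s) : adj (x - y) = adj x - adj y. Proof. exact: raddfB. Qed.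
Lemma adj0 s : adj 0 = 0 :> A s. Proof. exact: raddf0. Qed.
Lemma tauD s (x y : A s) : tau (x + y) = tau x + tau y. Proof. exact: raddfD. Qed.
Lemma tauN s (x : A s) : tau (- x) = - tau x. Proof. exact: raddfN. Qed.
Lemma tauB s (x y : A s) : tau (x - y) = tau x - tau y. Proof. exact: raddfB. Qed.
Lemma tau0 s : tau (0 : A s) = 0. Proof. exact: (raddf0 (@tau R P irrP s)). Qed.

Lemma tau_ge0 s (x : A s) : 0 <= tau (adj x * x).
Proof. by have [->|/tau_gt0/ltW//] := eqVneq x 0; rewrite mulr0 raddf0. Qed.

Lemma tau_eq0 s (x : A s) : tau (adj x * x) = 0 -> x = 0.
Proof. by move=> e; apply/eqP; apply/negPn/negP => /tau_gt0; rewrite e ltxx. Qed.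

Lemma tauZ s a (x : A s) : tau (a *: x) = a * tau x. Proof. exact: linearZ. Qed.

Lemma conj_of_real (p q : C) : (p + q)^* = p + q -> ('i * (p - q))^* = 'i * (p - q) -> q = p^*.
Proof.
rewrite rmorphM rmorphB rmorphD /= conjCi mulNr -mulrN => h1 /(mulfI (neq0Ci _)) h2.
have : q *+ 2 = p^* *+ 2.
  rewrite !mulr2n; transitivity ((p + q) - (p - q)); first by ring.
  by rewrite -h1 -h2; ring.
by move/eqP; rewrite eqrMn2r /= => /eqP.
Qed.

(** Polarization: the traces of all [z^* z] are real. *)
Lemma tau_adj s (x : A s) : tau (adj x) = (tau x)^*.
Proof.
have h0 := geC0_conj (tau_ge0 x); have h3 := geC0_conj (tau_ge0 (1 : A s)).
rewrite adj1 mulr1 in h3.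
have h1 := geC0_conj (tau_ge0 (x + 1)); have h2 := geC0_conj (tau_ge0 (x - 'i *: 1)).
have e1 : tau (adj (x + 1) * (x + 1)) - tau (adj x * x) - tau (1 : A s) = tau x + tau (adj x).
  rewrite adjD adj1 mulrDl !mulrDr !mulr1 mul1r !tauD; ring.
have e2 : tau (adj (x - 'i *: 1) * (x - 'i *: 1)) - tau (adj x * x) - tau (1 : A s) = 'i * (tau x - tau (adj x)).
  rewrite adjB adjZ conjCi adj1 mulrDl !mulrDr !(mulrN, mulNr) -!scalerAl -!scalerAr.
  rewrite !mulr1 !mul1r scaleNr !(tauD, tauN, tauZ).
  have := sqrCi C; move: (tau x) (tau (adj x)) (tau 1) => p q r; move: 'i => i ii; ring: ii.
by apply: conj_of_real; rewrite -(e1, e2) !rmorphB /= h0 h3 (h1, h2).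
Qed.

Lemma polar s (d : A s) : (forall y, tau (d * (y * adj y)) = 0) -> d = 0.
Proof.
move=> h; suff tz z : tau (d * z) = 0 by apply: tau_eq0; rewrite tauC tz.
have e1 : tau (d * z) + tau (d * adj z) = 0.
  transitivity (tau (d * ((z + 1) * adj (z + 1))) - tau (d * (z * adj z)) - tau (d * (1 * adj 1))).
    by rewrite adjD adj1 !mulrDl !mulrDr !mulr1 !mul1r !tauD; ring.
  by rewrite !h !subrr.
have e2 : 'i * (tau (d * z) - tau (d * adj z)) = 0.
  transitivity (tau (d * ((z - 'i *: 1) * adj (z - 'i *: 1))) - tau (d * (z * adj z)) - tau (d * (1 * adj 1))).
    rewrite adjB adjZ conjCi adj1 !mulrDl !mulrDr !(mulrN, mulNr) -!scalerAl -!scalerAr.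
    rewrite !mulr1 !mul1r !(tauD, tauN, tauZ).
    have := sqrCi C; move: (tau (d * z)) (tau (d * adj z)) (tau d) (tau _) => p q r r'.
    by move: 'i => i ii; ring: ii.
  by rewrite !h !subrr.
move/eqP: e2; rewrite mulf_eq0 (negbTE (neq0Ci _)) /= subr_eq0 => /eqP e2.
by move: e1; rewrite -e2 -mulr2n => /eqP; rewrite mulrn_eq0 /= => /eqP.
Qed.

(** Positivity tested against squares rather than by exhibiting a square: the pairing with
    [y y^*] is what diagrams compute, and the condition is closed under limits.  The two
    notions agree by [psd_root4]. *)
Definition psd s (x : A s) := forall y, 0 <= tau (x * (y * adj y)).

Lemma psd_adj s (x : A s) : psd x -> adj x = x.
Proof.
move=> h; apply/eqP; rewrite -subr_eq0; apply/eqP/polar => y.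
rewrite mulrBl tauB -[X in X - _](conjCK) -tau_adj !adjM !adjK tauC.
by rewrite (geC0_conj (h y)) subrr.
Qed.

Lemma psd_sq s (k : A s) : psd (adj k * k).
Proof.
move=> y.
have -> : tau (adj k * k * (y * adj y)) = tau (adj (k * y) * (k * y)).
  by rewrite adjM [in LHS]mulrA tauC !mulrA.
exact: tau_ge0.
Qed.

Lemma psd_sq' s (k : A s) : psd (k * adj k).
Proof. by rewrite -{1}[k]adjK; exact: psd_sq. Qed.

Lemma psd0 s : psd (0 : A s). Proof. by move=> y; rewrite mul0r tau0. Qed.

Lemma psdD s (x y : A s) : psd x -> psd y -> psd (x + y).
Proof. by move=> h h' z; rewrite mulrDl tauD addr_ge0. Qed.

Lemma psdZ s a (x : A s) : 0 <= a -> psd x -> psd (a *: x).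
Proof. by move=> a0 h z; rewrite -scalerAl tauZ mulr_ge0. Qed.

Lemma psd_tau s (x : A s) : psd x -> 0 <= tau x.
Proof. by move/(_ 1); rewrite adj1 !mulr1. Qed.

Lemma delta_gt0 : 0 < delta. Proof. exact: loop_gt0. Qed.
Lemma delta_neq0 : delta != 0. Proof. by rewrite gt_eqF // delta_gt0. Qed.

Lemma tr_sq_ge0 n s (x : P (n, s)) : 0 <= tr (Defs.mul (star x) x).
Proof.
by have [->|/trace_posdef/ltW//] := eqVneq x 0; rewrite mulx0 tr0.
Qed.

Lemma tri_ge0 s (u v y : A s) : 0 <= tau (conv (adj u * u) (adj v * v) * (y * adj y)).
Proof.
have := @tri_tri _ P s u v y; rewrite -[RHS]/(tau (conv (adj u * u) (adj v * v) * (y * adj y))) => <-.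
exact: tr_sq_ge0.
Qed.

(** A Schur product theorem for the coproduct: pairing with [y y^*] gives the squared
    length of the three-box [triangle u v y]. *)
Lemma schur s (u v : A s) : psd (conv (adj u * u) (adj v * v)).
Proof. by move=> y; exact: tri_ge0. Qed.

Section Rot.
Context (s t : bool) (st : t = ~~ s) (ts : s = ~~ t).
Local Notation F := (@rot _ P irrP s t st).
Local Notation G := (@rot _ P irrP t s ts).

Lemma rotB (x y : A s) : F (x - y) = F x - F y. Proof. exact: raddfB. Qed.
Lemma rotD (x y : A s) : F (x + y) = F x + F y. Proof. exact: raddfD. Qed.
Lemma rotZ a (x : A s) : F (a *: x) = a *: F x. Proof. exact: linearZ. Qed.

Lemma rot_inj : injective F.
Proof. by move=> x y e; rewrite -(rotK4 st ts x) e rotK4. Qed.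

Lemma bar1 : G (F 1) = 1.
Proof. by have := rot2M st ts 1 (G (F 1)); rewrite !mul1r rotK4 mul1r => <-. Qed.

Lemma bar_adj x : G (F (adj x)) = adj (G (F x)).
Proof.
have h y : F (adj (G y)) = adj y by exact: rot_adj.
have := h (F (G (F x))); rewrite rotK4 => /(congr1 G).
by rewrite rot_adj.
Qed.

Lemma tau_norm_rot (x : A s) : tau (adj (F x) * F x) = tau (adj x * x).
Proof. by rewrite tauC (tau_rot _ ts) rot_adj tauC. Qed.
End Rot.

Section Jones.
Context (s t : bool) (st : t = ~~ s) (ts : s = ~~ t).
Local Notation F := (@rot _ P irrP s t st).
Local Notation G := (@rot _ P irrP t s ts).

(** The cup-cap diagram, which is [delta] times the Jones projection.  Being the Fourier
    transform of the identity, it is a unit for the coproduct, and any product with it is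
    a multiple of it. *)
Definition jones : A s := G 1.

Lemma rot_jones : F jones = 1. Proof. exact: (bar1 ts st). Qed.

Lemma mul_jones u : u * jones = (tau (F u) / delta) *: jones.
Proof. by apply: (rot_inj (st := st) ts); rewrite rotM rot_jones conv1 linearZ /= rot_jones. Qed.

Lemma tau_jones : tau jones = delta. Proof. exact: tau_rot1. Qed.

Lemma adj_jones : adj jones = jones.
Proof. by apply: (rot_inj (st := st) ts); rewrite /jones rot_adj rot_jones adj1. Qed.

Lemma jones_mul : jones * jones = (tau (1 : A t) / delta) *: jones.
Proof. by rewrite mul_jones rot_jones. Qed.

Lemma tau_conv_rot u v : tau (conv (F u) (F v)) = tau (F u) * tau (F v) / delta.
Proof.
rewrite -rotM -[F _]mulr1 tau_rot -/jones -mulrA mul_jones -scalerAr tauZ mul_jones tauZ tau_jones.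
by field; exact: delta_neq0.
Qed.
End Jones.

Section Rot2.
Context (s t : bool) (st : t = ~~ s) (ts : s = ~~ t).
Local Notation F := (@rot _ P irrP s t st).
Local Notation G := (@rot _ P irrP t s ts).

Lemma tau_conv (x y : A s) : tau (conv x y) = tau x * tau y / delta.
Proof. by rewrite -(rotK4 st ts x) -(rotK4 st ts y) (tau_conv_rot ts st). Qed.

Lemma convE (x y : A s) : conv x y = G (F (G (F x)) * F (G (F y))).
Proof. by rewrite rotM rotK4 rotK4. Qed.

Lemma convBl (x y z : A s) : conv (x - y) z = conv x z - conv y z.
Proof. by rewrite !convE !rotB mulrBl rotB. Qed.
Lemma convBr (x y z : A s) : conv z (x - y) = conv z x - conv z y.
Proof. by rewrite !convE !rotB mulrBr rotB. Qed.
Lemma convZl c (x z : A s) : conv (c *: x) z = c *: conv x z.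
Proof. by rewrite !convE !rotZ -scalerAl rotZ. Qed.
Lemma convZr c (x z : A s) : conv z (c *: x) = c *: conv z x.
Proof. by rewrite !convE !rotZ -scalerAr rotZ. Qed.

Lemma conv_jones (x : A s) : conv x (jones ts) = x.
Proof. by rewrite -{1}(rotK4 st ts x) /jones -rotM mulr1 rotK4. Qed.

End Rot2.

Definition pairing n s' (X Y : P (n, s')) : C := tr (Defs.mul (star X) Y).

Lemma pairing_sub_ge0 n s' (V W : P (n, s')) :
  pairing V W + pairing W V <= pairing V V + pairing W W.
Proof.
rewrite -subr_ge0; have := tr_sq_ge0 (-1 *: W + V).
rewrite star_semilinear mul_linear_top !mul_linear_bottom tr_linear.
have -> : conjc (-1 : C) = -1 by rewrite rmorphN rmorph1.
have lin b X Y Z : tr (b *: Defs.mul (star X) Z + Defs.mul (star Y) Z) = b * pairing X Z + pairing Y Z.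
  by exact: tr_linear.
by rewrite !lin; congr (0 <= _); ring.
Qed.
(** The inequality [<V, W> + <W, V> <= <V, V> + <W, W>] for the three-boxes
    [V = link g y] and [W = link' g y], which have the same length.  It bounds a positive
    element whose inverse Fourier transform is positive by a multiple of the identity. *)
Lemma young s t (st : t = ~~ s) (g : A s) (y : A t) :
  tau (rot st (adj g * g) * (y * adj y)) + tau ((y * adj y) * adj (rot st (adj g * g))) <=
  (tau (adj g * g) * tau (adj y * y) / delta) *+ 2.
Proof.
subst t.
pose F := @rot _ P irrP s (~~ s) erefl; pose G := @rot _ P irrP (~~ s) s (esym (negbK s)).
pose h := rot erefl (adj g * g); rewrite -/h; have := pairing_sub_ge0 (@link _ P s g y) (@link' _ P s g y).
rewrite /pairing; move: (@link_link _ P s g y) (@link'_link' _ P s g y).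
move: (@link'_link _ P s g y) (@link_link' _ P s g y).
move: (@link _ P s g y) (@link' _ P s g y) => V V' -> -> -> ->.
rewrite -[X in _ <= X + _]/(tau (conv (adj (F g) * F g) (adj (F (G y)) * F (G y)))).
rewrite -[X in _ <= _ + X]/(tau (conv (adj g * g) (adj (G y) * G y))).
rewrite -[X in X + _ <= _]/(tau ((y * adj y) * adj h)) -[X in _ + X <= _]/(tau (h * (y * adj y))).
rewrite (tau_conv (esym (negbK s)) erefl) (tau_conv erefl (esym (negbK s))).
by rewrite !(tau_norm_rot erefl (esym (negbK s))) !(tau_norm_rot (esym (negbK s)) erefl) addrC -mulr2n.
Qed.

Section Submult.
Context (s t : bool) (st : t = ~~ s) (ts : s = ~~ t).

(** With [c] such that [c^-1 E] is the Jones projection, [v = 1 - c^-1 E] is a projection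
    and [conv (u^* u) v] is [tau (u^* u) / delta] minus [u^* u / c]; it is positive by
    [schur].  So a positive element is dominated by its trace, whence all norms below are
    submultiplicative up to a constant. *)
Lemma tau_mul_le (u y : A s) :
  tau ((adj u * u) * (y * adj y)) <= tau (1 : A t) / delta ^+ 2 * (tau (adj u * u) * tau (y * adj y)).
Proof.
have := delta_gt0; have d0 := delta_neq0.
set c := tau (1 : A t) / delta; move=> dg.
have c0 : 0 < c.
  by rewrite divr_gt0 // -[1]mulr1 -{1}adj1 tau_gt0 ?oner_neq0.
pose E : A s := jones ts; pose v : A s := 1 - c^-1 *: E.
have cr : c^-1^* = c^-1 by rewrite geC0_conj // invr_ge0 ltW.
have EE : E * E = c *: E by exact: (jones_mul st).
have vv : adj v * v = v.
  have -> : adj v = v by rewrite /v adjB adjZ cr adj1 (adj_jones st).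
  rewrite /v mulrBl mul1r mulrBr mulr1 -!scalerAl -scalerAr EE !scalerA -mulrA mulVf ?gt_eqF //.
  by rewrite mulr1 subrr subr0.
have H := tri_ge0 u v y; rewrite vv /v in H.
have cE : conv (adj u * u) (1 - c^-1 *: E) = (tau (adj u * u) / delta) *: 1 - c^-1 *: (adj u * u).
  by rewrite (convBr st ts) (convZr st ts) conv1 (conv_jones st ts).
rewrite cE mulrBl tauB -!scalerAl !tauZ mul1r subr_ge0 -ler_pdivlMl ?invr_gt0 // invrK in H.
apply: (le_trans H); rewrite le_eqVlt /c; apply/orP; left; apply/eqP; field.
exact: d0.
Qed.
End Submult.

End Positivity.

(** * Roots of positive elements *)

Lemma interpolation (F : fieldType) (rs : seq F) (phi : F -> F) : uniq rs ->
  exists f : {poly F}, forall z, z \in rs -> f.[z] = phi z.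
Proof.
elim: rs => [|z rs IH] /=; first by exists 0.
case/andP=> zrs /IH[f fE]; pose m := \prod_(w <- rs) ('X - w%:P).
have mz : m.[z] != 0 by rewrite -rootE root_prod_XsubC.
exists (f + ((phi z - f.[z]) / m.[z]) *: m) => w; rewrite hornerD hornerZ inE => /orP[/eqP ->|wrs].
  by rewrite divfK // addrC subrK.
have /eqP -> : root m w by rewrite root_prod_XsubC.
by rewrite mulr0 addr0 fE.
Qed.

Section Spectral.
Context (R : realType) (P : subfactorPlanarAlgebra R) (irrP : irreducible P) (s : bool).
Local Notation A := (tbox irrP s).
Local Notation C := R[i].
Implicit Types (x w : A) (p f g : {poly C}).

(** The powers of [x] are linearly dependent. *)
Lemma annihilator x : exists2 p, p != 0 & horner_alg x p = 0.
Proof.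
pose n := \dim {:A}; pose e := [tuple x ^+ i | i < n.+1].
have nf : ~~ free e.
  apply/negP => fe; have := dimvS (subvf <<e>>%VS).
  by rewrite (eqP fe) size_tuple ltnn.
have [k [i ki] k0] : exists2 k : 'I_n.+1 -> C, (exists i, k i != 0) & \sum_i k i *: e`_i = 0.
  apply: contrapT => H; case/negP: nf; apply/freeP => k k0 i.
  by apply/eqP/negPn/negP => ki; apply: H; exists k => //; exists i.
pose p := \poly_(j < n.+1) k (inord j).
exists p.
  by apply/eqP => /(congr1 (fun q : {poly C} => q`_i)); rewrite coef_poly ltn_ord inord_val coef0; apply/eqP.
rewrite /p poly_def raddf_sum /= -[RHS]k0; apply: eq_bigr => j _.
have -> : e`_j = x ^+ j by rewrite -(tnth_nth 0) tnth_mktuple.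
by rewrite linearZ /= rmorphXn /= horner_algX mulr_algl inord_val.
Qed.

Lemma horner_XsubC x z : horner_alg x ('X - z%:P) = x - z *: 1.
Proof. by rewrite rmorphB /= horner_algX horner_algC. Qed.

Lemma horner_comm x p q : horner_alg x p * horner_alg x q = horner_alg x q * horner_alg x p.
Proof. by rewrite -!rmorphM mulrC. Qed.

(** If [z] is not nonnegative then [x - z] is injective: for [x w = z w] with [w] nonzero,
    the trace of [x w w^*] would be [z] times a positive number. *)
Lemma drop_root x z g : psd x -> ~~ (0 <= z) ->
  horner_alg x (('X - z%:P) * g) = 0 -> horner_alg x g = 0.
Proof.
move=> wx z0; set w := horner_alg x g; rewrite rmorphM /= horner_XsubC -/w mulrBl -scalerAl mul1r.
move/eqP; rewrite subr_eq0 => /eqP e; apply/eqP/negPn/negP => w0.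
have tw : 0 < tau (w * adj w) by rewrite tauC tau_gt0.
case/negP: z0; have := wx w; rewrite mulrA e -scalerAl tauZ.
by rewrite pmulr_lge0.
Qed.

(** A self-adjoint element whose square kills [w] already kills [w]. *)
Lemma merge_root x z g : psd x -> 0 <= z ->
  horner_alg x (('X - z%:P) * (('X - z%:P) * g)) = 0 -> horner_alg x (('X - z%:P) * g) = 0.
Proof.
move=> wx z0 h; apply: tau_eq0; set g' := _ * g in h *.
have -> : horner_alg x g' = (x - z *: 1) * horner_alg x g by rewrite rmorphM /= horner_XsubC.
have -> : adj ((x - z *: 1) * horner_alg x g) = adj (horner_alg x g) * (x - z *: 1).
  by rewrite adjM adjB adjZ adj1 (psd_adj wx) (geC0_conj z0).
rewrite -mulrA -horner_XsubC.
have -> : horner_alg x ('X - z%:P) * (horner_alg x ('X - z%:P) * horner_alg x g) = 0.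
  by rewrite -h /g' !rmorphM.
by rewrite mulr0 tau0.
Qed.

(** Starting from any annihilating polynomial, bad roots are dropped and repeated ones
    merged. *)
Lemma nonneg_roots x : psd x -> exists rs : seq C,
  [/\ uniq rs, all (fun z => 0 <= z) rs & horner_alg x (\prod_(z <- rs) ('X - z%:P)) = 0].
Proof.
move=> wx; have [p p0 px] := annihilator x; have [rs pE] := closed_field_poly_normal p.
suff gen (l acc : seq C) : uniq acc -> all (fun z => 0 <= z) acc ->
    horner_alg x (\prod_(z <- l) ('X - z%:P) * \prod_(z <- acc) ('X - z%:P)) = 0 ->
    exists rs : seq C, [/\ uniq rs, all (fun z => 0 <= z) rs &
      horner_alg x (\prod_(z <- rs) ('X - z%:P)) = 0].
  apply: (gen rs [::]) => //; rewrite big_nil mulr1.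
  move: px; rewrite pE linearZ /= mulr_algl => /eqP; rewrite scaler_eq0 lead_coef_eq0 (negbTE p0) /=.
  by move/eqP.
elim: l acc => [|z l IH] acc ua pa; first by rewrite big_nil mul1r => h; exists acc.
rewrite big_cons -mulrA => h.
have [z0|z0] := boolP (0 <= z); last by apply: (IH acc) => //; exact: (drop_root wx z0 h).
have [zacc|zacc] := boolP (z \in acc).
  apply: (IH acc) => //; move: h; rewrite (perm_big _ (perm_to_rem zacc)) big_cons /=.
  by rewrite !(mulrCA _ ('X - z%:P)); exact: merge_root.
apply: (IH (z :: acc)); rewrite /= ?zacc ?z0 //.
by rewrite big_cons mulrCA.
Qed.

Lemma adj_horner x f : adj x = x -> adj (horner_alg x f) = horner_alg x (map_poly Num.conj f).
Proof.
move=> xa; elim/poly_ind: f => [|f c IH]; first by rewrite !rmorph0 /= adj0.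
rewrite !rmorphD !rmorphM /= !map_polyX !map_polyC /= !horner_algX !horner_algC adjD adjM IH xa adjZ adj1.
by rewrite -{1}(horner_algX x) horner_comm horner_algX.
Qed.

Lemma horner_dvd x f g (rs : seq C) : uniq rs -> horner_alg x (\prod_(z <- rs) ('X - z%:P)) = 0 ->
  (forall z, z \in rs -> f.[z] = g.[z]) -> horner_alg x f = horner_alg x g.
Proof.
move=> u h0 fg; apply/eqP; rewrite -subr_eq0 -rmorphB /=; apply/eqP.
have /dvdpP[q ->] : \prod_(z <- rs) ('X - z%:P) %| f - g.
  apply: uniq_roots_dvdp; last by rewrite uniq_rootsE.
  by apply/allP => z zr; rewrite rootE hornerD hornerN fg ?subrr.
by rewrite rmorphM /= h0 mulr0.
Qed.

(** Interpolating the fourth root at the spectrum.  A fourth root rather than a square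
    root, so that its square is a square root that is visibly of the form [y^* y]. *)
Lemma psd_root4 x : psd x -> exists2 k : A, adj k = k & k ^+ 4 = x.
Proof.
move=> wx; have [rs [u pr h0]] := nonneg_roots wx.
have [f fE] := interpolation (fun z => sqrtC (sqrtC z)) u.
exists (horner_alg x f).
  rewrite (adj_horner _ (psd_adj wx)); apply: (horner_dvd u h0) => z zr.
  have z0 := allP pr _ zr.
  by rewrite -{1}(geC0_conj z0) horner_map /= fE // geC0_conj ?sqrtC_ge0 ?fE.
rewrite -rmorphXn -[RHS]horner_algX; apply: (horner_dvd u h0) => z zr.
by rewrite horner_exp fE // hornerX (exprM _ 2 2) !sqrtCK.
Qed.
End Spectral.

(** * The norm of the trace form *)

Section Norms.
Context (R : realType) (P : subfactorPlanarAlgebra R) (irrP : irreducible P).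
Local Notation A s := (tbox irrP s).
Local Notation C := R[i].
Local Notation delta := (loop_value P).
Implicit Types s t : bool.

Lemma ge0_RRe (z : C) : 0 <= z -> z = (complex.Re z)%:C%C.
Proof. by case: z => x y; rewrite lecE /= => /andP[/eqP -> _]. Qed.

Lemma ge0_Re (z : C) : 0 <= z -> 0 <= complex.Re z.
Proof. by case: z => x y; rewrite lecE /= => /andP[_]. Qed.

Lemma gt0_Re (z : C) : 0 < z -> 0 < complex.Re z.
Proof. by case: z => x y; rewrite ltcE /= => /andP[_]. Qed.

Lemma le_Re (z w : C) : z <= w -> complex.Re z <= complex.Re w.
Proof. by case: z => x y; case: w => x' y'; rewrite lecE /= => /andP[_]. Qed.

Lemma ReD (z w : C) : complex.Re (z + w) = complex.Re z + complex.Re w.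
Proof. by case: z; case: w. Qed.

Lemma ReN (z : C) : complex.Re (- z) = - complex.Re z. Proof. by case: z. Qed.

Lemma ReZ (r : R) (z : C) : complex.Re (r%:C%C * z) = r * complex.Re z.
Proof. by case: z => x y /=; rewrite mul0r subr0. Qed.

Definition dlt : R := complex.Re delta.
Lemma dltE : delta = dlt%:C%C. Proof. exact: ge0_RRe (ltW (@delta_gt0 _ P irrP)). Qed.
Lemma dlt_gt0 : 0 < dlt. Proof. exact: gt0_Re (@delta_gt0 _ P irrP). Qed.
Lemma dlt_neq0 : dlt != 0. Proof. by rewrite gt_eqF // dlt_gt0. Qed.

Definition rt s (x : A s) : R := complex.Re (tau x).

Lemma rtD s (x y : A s) : rt (x + y) = rt x + rt y. Proof. by rewrite /rt tauD ReD. Qed.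
Lemma rtN s (x : A s) : rt (- x) = - rt x. Proof. by rewrite /rt tauN ReN. Qed.
Lemma rtB s (x y : A s) : rt (x - y) = rt x - rt y. Proof. by rewrite rtD rtN. Qed.
Lemma rt0 s : rt (0 : A s) = 0. Proof. by rewrite /rt tau0. Qed.
Lemma rtZ s (r : R) (x : A s) : rt (r%:C%C *: x) = r * rt x. Proof. by rewrite /rt tauZ ReZ. Qed.
Lemma rtC s (x y : A s) : rt (x * y) = rt (y * x). Proof. by rewrite /rt tauC. Qed.
Lemma rt_adj s (x : A s) : rt (adj x) = rt x. Proof. by rewrite /rt tau_adj; case: (tau x). Qed.
Lemma adjZr s (r : R) (x : A s) : adj (r%:C%C *: x) = r%:C%C *: adj x.
Proof. by rewrite adjZ; congr (_ *: _); exact: conjc_real. Qed.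

Lemma psd_tauE s (x : A s) : psd x -> tau x = (rt x)%:C%C.
Proof. by move=> h; exact: ge0_RRe (psd_tau h). Qed.

Lemma psd_rt s (x y : A s) : psd x -> 0 <= rt (x * (y * adj y)).
Proof. by move=> h; exact: ge0_Re (h y). Qed.

Lemma psd_rt0 s (x : A s) : psd x -> 0 <= rt x.
Proof. by move=> h; exact: ge0_Re (psd_tau h). Qed.

Lemma psdZr s (r : R) (x : A s) : 0 <= r -> psd x -> psd (r%:C%C *: x).
Proof. by move=> r0; apply: psdZ; rewrite lecR. Qed.

Lemma psdI s (x : A s) : adj x = x -> (forall y, 0 <= rt (x * (y * adj y))) -> psd x.
Proof.
move=> xa h y; have := h y; rewrite /rt.
have : (tau (x * (y * adj y)))^* = tau (x * (y * adj y)).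
  by rewrite -tau_adj !adjM adjK xa tauC.
case: (tau _) => p q /= [/eqP]; rewrite eq_sym -subr_eq0 opprK -mulr2n mulrn_eq0 /= => /eqP -> p0.
by rewrite lecE /= eqxx.
Qed.

Definition N2 s (x : A s) : R := rt (adj x * x).
Definition nrm s (x : A s) : R := Num.sqrt (N2 x).

Lemma tau_sq s (x : A s) : tau (adj x * x) = (N2 x)%:C%C.
Proof. exact: ge0_RRe (tau_ge0 x). Qed.
Lemma N2_ge0 s (x : A s) : 0 <= N2 x. Proof. exact: ge0_Re (tau_ge0 x). Qed.
Lemma N2_eq0 s (x : A s) : N2 x = 0 -> x = 0.
Proof. by move=> h; apply: tau_eq0; rewrite tau_sq h. Qed.
Lemma nrm_ge0 s (x : A s) : 0 <= nrm x. Proof. exact: sqrtr_ge0. Qed.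
Lemma nrm_sq s (x : A s) : nrm x ^+ 2 = N2 x. Proof. by rewrite sqr_sqrtr ?N2_ge0. Qed.
Lemma nrm_eq0 s (x : A s) : nrm x = 0 -> x = 0.
Proof. by move=> h; apply: N2_eq0; rewrite -nrm_sq h expr0n. Qed.
Lemma N2_adj s (x : A s) : N2 (adj x) = N2 x. Proof. by rewrite /N2 adjK rtC. Qed.
Lemma nrm_adj s (x : A s) : nrm (adj x) = nrm x. Proof. by rewrite /nrm N2_adj. Qed.
Lemma N2Z s (r : R) (x : A s) : N2 (r%:C%C *: x) = r ^+ 2 * N2 x.
Proof. by rewrite /N2 adjZr -scalerAl -scalerAr !rtZ mulrA. Qed.
Lemma nrmZ s (r : R) (x : A s) : nrm (r%:C%C *: x) = `|r| * nrm x.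
Proof. by rewrite /nrm N2Z sqrtrM ?sqr_ge0 // sqrtr_sqr. Qed.
Lemma nrmN s (x : A s) : nrm (- x) = nrm x.
Proof. by rewrite /nrm /N2 adjN mulrNN. Qed.
Lemma nrm0 s : nrm (0 : A s) = 0. Proof. by rewrite /nrm /N2 mulr0 rt0 sqrtr0. Qed.
Lemma N2D s (x y : A s) : N2 (x + y) = N2 x + rt (adj x * y) *+ 2 + N2 y.
Proof.
rewrite /N2 adjD mulrDl !mulrDr !rtD mulr2n.
have -> : rt (adj y * x) = rt (adj x * y) by rewrite -rt_adj adjM adjK.
by ring.
Qed.

Lemma cauchy_schwarz s (x y : A s) : rt (adj x * y) <= nrm x * nrm y.
Proof.
have [y0|yn] := eqVneq (N2 y) 0.
  by rewrite (N2_eq0 y0) mulr0 rt0 nrm0 mulr0.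
have yp : 0 < N2 y by rewrite lt_def yn N2_ge0.
have := N2_ge0 (x + (- (rt (adj x * y) / N2 y))%:C%C *: y).
rewrite N2D N2Z -scalerAr rtZ.
set b := rt _; set c := N2 y; set a := N2 x => h.
have {}h : b ^+ 2 <= a * c.
  have := mulr_ge0 h (ltW yp); rewrite -/c.
  have -> : (a + - (b / c) * b *+ 2 + (- (b / c)) ^+ 2 * c) * c = a * c - b ^+ 2 by field.
  by rewrite subr_ge0.
rewrite /nrm -sqrtrM ?N2_ge0 //; apply: le_trans (ler_norm b) _.
by rewrite -sqrtr_sqr ler_sqrt // mulr_ge0 ?N2_ge0.
Qed.

Lemma nrmD s (x y : A s) : nrm (x + y) <= nrm x + nrm y.
Proof.
rewrite -(@ler_pXn2r _ 2) ?nnegrE ?addr_ge0 ?nrm_ge0 // nrm_sq N2D sqrrD !nrm_sq.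
by rewrite lerD2r lerD2l ler_pMn2r // cauchy_schwarz.
Qed.

Lemma nrmB s (x y : A s) : nrm (x - y) <= nrm x + nrm y.
Proof. by apply: le_trans (nrmD _ _) _; rewrite nrmN. Qed.

Section Rot.
Context (s t : bool) (st : t = ~~ s) (ts : s = ~~ t).
Local Notation F := (@rot _ P irrP s t st).
Local Notation G := (@rot _ P irrP t s ts).

Lemma N2_rot (x : A s) : N2 (F x) = N2 x.
Proof. by rewrite /N2 /rt (tau_norm_rot st ts). Qed.
Lemma nrm_rot (x : A s) : nrm (F x) = nrm x. Proof. by rewrite /nrm N2_rot. Qed.
End Rot.

(** A constant with [nrm (x * y) <= kap * (nrm x * nrm y)]; the sum serves both shadings
    at once. *)
Definition kap : R := Num.sqrt (complex.Re (tau (1 : A true) / delta ^+ 2)) +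
  Num.sqrt (complex.Re (tau (1 : A false) / delta ^+ 2)).

Lemma kap_ge0 : 0 <= kap. Proof. by rewrite addr_ge0 ?sqrtr_ge0. Qed.

Lemma nrmM s (x y : A s) : nrm (x * y) <= kap * (nrm x * nrm y).
Proof.
have := tau_mul_le (erefl (~~ s)) (esym (negbK s)) x y.
set k := tau 1 / _.
have -> : tau (adj x * x * (y * adj y)) = tau (adj (x * y) * (x * y)).
  by rewrite adjM [in LHS]mulrA [in LHS]tauC !mulrA.
rewrite [tau (y * adj y)]tauC !tau_sq => h.
have k0 : 0 <= k.
  have d0 := @delta_gt0 _ P irrP; rewrite mulr_ge0 ?invr_ge0 ?exprn_ge0 ?(ltW d0) //.
  by have := tau_ge0 (1 : A (~~ s)); rewrite adj1 mulr1.
have {}h : N2 (x * y) <= complex.Re k * (N2 x * N2 y).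
  by have := le_Re h; rewrite (ge0_RRe k0) -!rmorphM.
have sk : Num.sqrt (complex.Re k) <= kap.
  by rewrite /kap /k; case: (s); rewrite /= ?lerDl ?lerDr sqrtr_ge0.
apply: le_trans (_ : Num.sqrt (complex.Re k) * (nrm x * nrm y) <= _); last first.
  by rewrite ler_wpM2r ?mulr_ge0 ?nrm_ge0.
rewrite /nrm -!sqrtrM ?N2_ge0 ?ge0_Re // ler_sqrt // mulr_ge0 ?ge0_Re //.
by rewrite mulr_ge0 ?N2_ge0.
Qed.

Lemma nrm_conv s (x y : A s) : nrm (conv x y) <= kap * (nrm x * nrm y).
Proof.
rewrite (convE (erefl (~~ s)) (esym (negbK s))) (nrm_rot _ (erefl (~~ s))).
apply: le_trans (nrmM _ _) _.
by rewrite !(nrm_rot (erefl (~~ s)) (esym (negbK s))) !(nrm_rot (esym (negbK s)) (erefl (~~ s)))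
   !(nrm_rot (erefl (~~ s)) (esym (negbK s))).
Qed.

Lemma psd_sqrt s (x : A s) : psd x -> exists2 k : A s, adj k = k & k * k = x.
Proof.
move=> /psd_root4[k ka kx]; exists (k * k); first by rewrite adjM ka.
by rewrite -kx !exprS expr0 mulr1 !mulrA.
Qed.

(** Since [x = k k], its norm is at most a constant times [tau (k k)]. *)
Lemma psd_nrm s (x : A s) : psd x -> nrm x <= kap * rt x.
Proof.
move=> /psd_sqrt[k ka <-]; apply: le_trans (nrmM _ _) _.
by rewrite -expr2 nrm_sq /N2 ka.
Qed.

Lemma psd_eq0 s (x : A s) : psd x -> rt x = 0 -> x = 0.
Proof.
move=> /psd_nrm h e; apply: nrm_eq0; apply/eqP; rewrite eq_le nrm_ge0 andbT.
by move: h; rewrite e mulr0.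
Qed.

Lemma norm_rt s (z x : A s) : `|rt (z * x)| <= nrm z * nrm x.
Proof.
rewrite ler_norml; apply/andP; split.
  by rewrite lerNl -rtN -mulrN -{1}[z]adjK -[nrm x]nrmN -[nrm z]nrm_adj cauchy_schwarz.
by rewrite -{1}[z]adjK -[nrm z]nrm_adj cauchy_schwarz.
Qed.
End Norms.

(** * The norms in the block maps *)

Section NormValues.
Context (R : realType) (P : subfactorPlanarAlgebra R) (irrP : irreducible P) (s : bool).
Local Notation A := (tbox irrP s).
Implicit Types (x a b : A).

(** With [d = a - b], [d (a + b) + (a + b) d = 2 (a^2 - b^2) = 0]; multiplying by [d] and
    taking traces, two nonnegative numbers add up to zero. *)
Lemma sqrt_uniq a b : psd a -> psd b -> a * a = b * b -> a = b.
Proof.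
move=> wa wb ab; have [u ua uu] := psd_sqrt wa; have [v va vv] := psd_sqrt wb.
have [d dE] : exists d : A, d = a - b by exists (a - b).
have dd : adj d = d by rewrite dE adjB (psd_adj wa) (psd_adj wb).
have e0 : rt (d * a * d) + rt (d * b * d) = 0.
  have e : d * (a + b) + (a + b) * d = 0.
    have -> : d * (a + b) = a * b - b * a.
      by rewrite dE mulrBl !mulrDr ab opprD addrACA addrC addrA subrK addrC.
    have -> : (a + b) * d = b * a - a * b.
      by rewrite dE mulrBr !mulrDl ab opprD addrACA addrC addrA subrK addrC.
    by rewrite -[b * a - _]opprB subrr.
  have : rt (d * (d * (a + b) + (a + b) * d)) = 0 by rewrite e mulr0 rt0.
  rewrite mulrDr rtD [rt (d * (d * _))]rtC -[d * (a + b) * d]mulrA -mulr2n => /eqP.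
  by rewrite mulrn_eq0 /= mulrDl mulrDr rtD => /eqP; rewrite !mulrA.
have nn c : psd c -> 0 <= rt (d * c * d).
  by move=> wc; rewrite rtC mulrA rtC -{2}dd; exact: psd_rt.
move/eqP: e0; rewrite paddr_eq0 ?nn // => /andP[/eqP e1 /eqP e2].
have z k c : adj k = k -> k * k = c -> rt (d * c * d) = 0 -> c * d = 0.
  move=> ka kc; rewrite -kc !mulrA -{1}dd -{1}ka -adjM -mulrA => h.
  by rewrite -mulrA (N2_eq0 (x := k * d)) ?mulr0.
have d2 : d * d = 0 by rewrite {1}dE mulrBl (z _ _ ua uu e1) (z _ _ va vv e2) subr0.
by apply/eqP; rewrite -subr_eq0 -dE; apply/eqP/N2_eq0; rewrite /N2 dd d2 rt0.
Qed.

Lemma positive_psd (a : P (2, s)%N) : positive a -> psd (a : A).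
Proof. by case=> y ->; exact: (psd_sq (y : A)). Qed.

Lemma modulusP x : psd (modulus x : A) /\ (modulus x : A) * modulus x = adj x * x.
Proof.
rewrite /modulus; case: xgetP => [a -> [pa e]|none]; first by split; [exact: positive_psd|].
have [k ka kx] := psd_root4 (psd_sq x).
exfalso; apply: (none (k * k : A)); split; first by exists (k : P (2, s)%N); rewrite -{1}ka.
by rewrite -[LHS]/(k * k * (k * k)) -[RHS]/(adj x * x) -kx !exprS expr0 mulr1 !mulrA.
Qed.

Lemma modulus_psd x : psd x -> modulus x = x.
Proof.
move=> wx; have [w e] := modulusP x; apply: (sqrt_uniq w wx).
by rewrite e (psd_adj wx).
Qed.

Lemma pnorm_ge0 p (x : P (2, s)%N) : 0 <= pnorm p x. Proof. exact: powR_ge0. Qed.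

Lemma pnorm1E x : psd x -> pnorm 1 x = rt x.
Proof.
move=> wx; rewrite /pnorm /= modulus_psd // invr1 powRr1 //; exact: psd_rt0 wx.
Qed.

Lemma pnorm2E x : pnorm 2 x = nrm x.
Proof.
have [_ e] := modulusP x; rewrite /pnorm /= powR12_sqrt; first by rewrite /nrm /N2 -e.
by rewrite -[Defs.mul _ _]/((modulus x : A) * modulus x) e; exact: N2_ge0.
Qed.

Lemma opnorm_ge0 (x : P (2, s)%N) : 0 <= opnorm x.
Proof.
rewrite /opnorm; set S := (X in sup X); have [hs|/sup_out ->//] := pselect (has_sup S).
have S0 : S (pnorm 2 (Defs.mul x 0)).
  by exists 0 => //=; rewrite (pnorm2E (0 : A)) nrm0.
apply: le_trans (ub_le_sup _ S0); first exact: pnorm_ge0.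
by case: hs.
Qed.

(** An upper bound that is attained at a nonzero vector. *)
Lemma opnormE x (M : R) : 0 <= M -> (forall y : A, nrm (x * y) <= M * nrm y) ->
  (exists2 e : A, e != 0 & x * e = M%:C%C *: e) -> opnorm x = M.
Proof.
move=> M0 ub [e e0 xe]; rewrite /opnorm; set S := (X in sup X).
have uS : ubound S M.
  move=> _ [y /= y1 <-]; rewrite (pnorm2E (x * y : A)); apply: le_trans (ub _) _.
  by rewrite -{2}[M]mulr1 ler_wpM2l // -(pnorm2E y).
have ne0 : 0 < nrm e by rewrite lt_def nrm_ge0 andbT; apply: contra_neq e0 => /nrm_eq0.
have SM : S M.
  have [f fE] : exists f : A, f = (nrm e)^-1%:C%C *: e by exists ((nrm e)^-1%:C%C *: e).
  have nf : nrm f = 1 by rewrite fE nrmZ ger0_norm ?invr_ge0 ?nrm_ge0 // mulVf ?gt_eqF.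
  have f1 : pnorm 2 f <= 1 by rewrite pnorm2E nf.
  have xf : nrm (x * f) = M.
    rewrite fE -scalerAr xe !nrmZ !ger0_norm ?invr_ge0 ?nrm_ge0 //.
    by rewrite mulrCA mulVf ?mulr1 ?gt_eqF.
  by exists f => //; exact: etrans (pnorm2E (x * f)) xf.
apply/eqP; rewrite eq_le; apply/andP; split; first by apply: ge_sup => //; exists M.
by apply: ub_le_sup => //; exists M.
Qed.
End NormValues.

(** * Bipositive elements *)

Section Bipositive.
Context (R : realType) (P : subfactorPlanarAlgebra R) (irrP : irreducible P).
Local Notation A s := (tbox irrP s).
Local Notation C := R[i].
Local Notation d := (dlt P).
Local Notation K := (kap irrP).

Let d0 : 0 < d := dlt_gt0 irrP.
Let dn : d != 0 := dlt_neq0 irrP.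

(** The block maps produce such elements, and on them every norm that they use is a
    trace. *)
Definition bipos s t (st : t = ~~ s) (x : A s) := psd x /\ psd (rot st x).

Section Element.
Context (s t : bool) (st : t = ~~ s) (ts : s = ~~ t).
Local Notation F := (@rot _ P irrP s t st).
Local Notation G := (@rot _ P irrP t s ts).
Context (x : A s) (bx : bipos st x).
Let wx : psd x := proj1 bx.
Let wX : psd (F x) := proj2 bx.
Local Notation a := (rt x).
Local Notation b := (rt (F x)).
Local Notation q := (N2 x).
Local Notation M := (b / d).

(** A self-adjoint Fourier transform means that [x] is its own contragredient. *)
Lemma bipos_bar : G (F x) = x.
Proof. by rewrite -{1}(psd_adj wX) rot_adj (psd_adj wx). Qed.

Lemma bipos_dual : bipos ts (F x).
Proof. by split=> //; rewrite bipos_bar. Qed.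

Lemma bipos_M0 : 0 <= M. Proof. by rewrite divr_ge0 ?psd_rt0 // ltW // d0. Qed.

(** [young] for a square root of [F x], whose square has Fourier transform [x]; the two
    pairings agree as [x] is self-adjoint. *)
Lemma bipos_bound (y : A s) : rt (x * (y * adj y)) <= M * rt (y * adj y).
Proof.
have [k ka kk] := psd_sqrt wX; have := young ts k y.
rewrite ka kk bipos_bar (psd_adj wx) [tau (_ * x)]tauC -mulr2n ler_pMn2r // => /le_Re.
rewrite (psd_tauE wX) [tau (adj y * y)]tauC (psd_tauE (psd_sq' y)) (dltE irrP).
rewrite -!rmorphM -fmorphV -rmorphM /=.
by rewrite /rt [b * _ / _]mulrAC.
Qed.

Lemma bipos_sqN : q = rt (x * x). Proof. by rewrite /N2 (psd_adj wx). Qed.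

Lemma bipos_opbound (y : A s) : nrm (x * y) <= M * nrm y.
Proof.
have [k ka kk] := psd_sqrt wx; have B := bipos_bound; have := bipos_M0.
move: (b / d) B => m B m0.
have e1 : N2 (x * y) = rt (x * ((k * y) * adj (k * y))).
  rewrite /N2 !adjM (psd_adj wx) ka -kk !mulrA [RHS]rtC !mulrA.
  by rewrite [RHS]rtC !mulrA.
have e2 : rt ((k * y) * adj (k * y)) = rt (x * (y * adj y)).
  by rewrite adjM ka !mulrA [LHS]rtC !mulrA kk.
rewrite -(@ler_pXn2r _ 2) ?nnegrE ?mulr_ge0 ?nrm_ge0 // nrm_sq exprMn nrm_sq e1.
apply: le_trans (B _) _; rewrite e2 expr2 -[X in _ <= X]mulrA ler_wpM2l //.
by rewrite /N2 [rt (adj y * y)]rtC B.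
Qed.

(** Positive, since [x] is at most [b / d]; it vanishes exactly if [x] is a multiple of a
    projection. *)
Definition defect : A s := M%:C%C *: x - x * x.

Lemma psd_defect : psd defect.
Proof.
have [k ka kk] := psd_sqrt wx.
apply: psdI; first by rewrite adjB adjZr adjM (psd_adj wx).
move=> y; rewrite mulrBl rtB -scalerAl rtZ subr_ge0.
have e1 : rt (x * x * (y * adj y)) = rt (x * ((k * y) * adj (k * y))).
  by rewrite adjM ka -kk !mulrA [RHS]rtC !mulrA.
have e2 : rt ((k * y) * adj (k * y)) = rt (x * (y * adj y)).
  by rewrite adjM ka !mulrA [LHS]rtC !mulrA kk.
by rewrite e1 -e2 bipos_bound.
Qed.

Lemma rt_defect : rt defect = a * b / d - q.
Proof. by rewrite rtB rtZ -bipos_sqN mulrC mulrA. Qed.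

Lemma bipos_q_le : d * q <= a * b.
Proof.
have := psd_rt0 psd_defect; rewrite rt_defect subr_ge0 ler_pdivlMr ?d0 //.
by rewrite mulrC.
Qed.

Lemma bipos_jones : x * jones irrP ts = M%:C%C *: jones irrP ts.
Proof.
rewrite (mul_jones st) (psd_tauE wX) (dltE irrP); congr (_ *: _).
by rewrite -fmorphV -rmorphM.
Qed.

(** The bound [b / d] is attained at the Jones element. *)
Lemma bipos_opnorm : opnorm x = M.
Proof.
apply: opnormE; [exact: bipos_M0|exact: bipos_opbound|exists (jones irrP ts); last exact: bipos_jones].
apply/eqP => e; have := tau_jones irrP ts; rewrite e tau0 => /esym/eqP.
by rewrite (negbTE (@delta_neq0 _ P irrP)).
Qed.
End Element.

Section Expansion.
Context (s t : bool) (st : t = ~~ s) (ts : s = ~~ t).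
Implicit Types x y z : A s.

(** If [x * x] and [conv x x] are multiples of [x] up to errors [r] and [g], then [Mc x] is
    a multiple of [x] up to terms that contain [r] or [g]. *)
Lemma conv_expand (m n : C) (x r g : A s) :
  x * x = m *: x - r -> conv x x = n *: x - g ->
  conv (x * x) (x * x) - (m * m * n) *: x = conv r r - m *: (conv x r + conv r x) - (m * m) *: g.
Proof.
move=> -> e2; rewrite (convBl st ts) !(convBr st ts) !(convZl st ts) !(convZr st ts).
rewrite e2 !scalerBr !scalerA scalerDr.
move: (_ *: x) (_ *: g) (_ *: conv x r) (_ *: conv r x) (conv r r) => u v w w' z.
rewrite opprB opprD !addrA (ACl ((1 * 6) * (4 * 3 * 5 * 2)))%AC /=.
by rewrite subrr add0r.
Qed.
End Expansion.

(** Up to a scalar these are [block_cm] and [block_mc] on bipositive elements. *)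
Definition Cm s (x : A s) : A s := conv x x * conv x x.
Definition Mc s (x : A s) : A s := conv (x * x) (x * x).

Section BlockError.
Context (s t : bool) (st : t = ~~ s) (ts : s = ~~ t).
Local Notation F := (@rot _ P irrP s t st).
Local Notation G := (@rot _ P irrP t s ts).
Context (x : A s) (bx : bipos st x).
Let wx : psd x := proj1 bx.
Let wX : psd (F x) := proj2 bx.
Let GF : G (F x) = x := bipos_bar ts bx.
Local Notation a := (rt x).
Local Notation b := (rt (F x)).
Local Notation q := (N2 x).

Lemma bipos_conv : conv x x = G (F x * F x). Proof. by rewrite rotM GF. Qed.

Lemma rot_bipos_conv : F (conv x x) = F x * F x.
Proof. by rewrite bipos_conv (rot2M ts st) GF. Qed.

(** The Fourier transform exchanges product and coproduct, hence the two block maps. *)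
Lemma rot_Cm : F (Cm x) = Mc (F x).
Proof. by rewrite /Cm /Mc rotM rot_bipos_conv. Qed.

Lemma rot_Mc : F (Mc x) = Cm (F x).
Proof.
have e : x * x = G (conv (F x) (F x)) by rewrite -rotM (rot2M st ts) GF.
have -> : Mc x = G (Cm (F x)) by rewrite /Mc /Cm rotM -e.
by rewrite /Cm (rot2M ts st) -e rotM.
Qed.

Lemma rt_Mc : rt (Mc x) = q ^+ 2 / d.
Proof.
have e : tau (x * x) = q%:C%C by rewrite -(tau_sq x) (psd_adj wx).
rewrite /rt /Mc (tau_conv st ts) e (dltE irrP) -rmorphM -fmorphV -rmorphM /=.
by rewrite expr2.
Qed.

(** The trace is the squared length of [F x * F x], and [F x] is bounded by [a / d]. *)
Lemma rt_Cm : rt (Cm x) <= (a / d) ^+ 2 * q.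
Proof.
have e : rt (Cm x) = nrm (F x * F x) ^+ 2.
  rewrite nrm_sq -(N2_rot ts st) -bipos_conv /N2 adj_conv (psd_adj wx) //.
rewrite e -nrm_sq -exprMn ler_pXn2r ?nnegrE ?nrm_ge0 //; last first.
  by rewrite mulr_ge0 ?nrm_ge0 // divr_ge0 ?psd_rt0 // ltW ?d0.
have := bipos_opbound st (bipos_dual ts bx) (F x).
by rewrite GF (nrm_rot st ts).
Qed.

Let r := defect st x.
Let rr := defect ts (F x).
Local Notation M := (b / d).
Local Notation eta := (a * b - d * q).

(** This difference measures how far [x] is from a biprojection: divided by [d] it is the
    trace of both defects, that of [x] and that of [F x]. *)
Lemma eta_ge0 : 0 <= eta. Proof. by rewrite subr_ge0; exact: (bipos_q_le ts bx). Qed.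

(** The defects are positive, so their norms are controlled by their traces. *)
Lemma nrm_r : nrm r <= K * (eta / d).
Proof.
apply: le_trans (psd_nrm (psd_defect ts bx)) _; rewrite (rt_defect bx).
by rewrite le_eqVlt; apply/orP; left; apply/eqP; field; exact: dn.
Qed.

Lemma nrm_rr : nrm rr <= K * (eta / d).
Proof.
apply: le_trans (psd_nrm (psd_defect st (bipos_dual ts bx))) _.
rewrite (rt_defect (bipos_dual ts bx)) GF.
rewrite (N2_rot st ts) [b * a]mulrC.
by rewrite le_eqVlt; apply/orP; left; apply/eqP; field; exact: dn.
Qed.

Lemma Mc_error0 : nrm (Mc x - (M ^+ 2 * (a / d))%:C%C *: x) <=
  K * (K * (eta / d)) ^+ 2 + M * ((K * (nrm x * (K * (eta / d)))) *+ 2) + M ^+ 2 * (K * (eta / d)).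
Proof.
have e1 : x * x = M%:C%C *: x - r by rewrite /r /defect opprB addrC subrK.
have e2 : conv x x = (a / d)%:C%C *: x - G rr.
  by rewrite bipos_conv /rr /defect rotB rotZ GF opprB addrC subrK.
have -> : (M ^+ 2 * (a / d))%:C%C = M%:C%C * M%:C%C * (a / d)%:C%C :> C by rewrite -!rmorphM expr2.
rewrite (conv_expand st ts e1 e2) -rmorphM -expr2 /=.
have M0 := bipos_M0 bx; have K0 := kap_ge0 irrP.
have h := nrm_r; have h' := nrm_rr; rewrite -(nrm_rot ts st) in h'.
have n0 := nrm_ge0 r; have n0' := nrm_ge0 x.
apply: le_trans (nrmB _ _) _; apply: lerD; last first.
  by rewrite nrmZ ger0_norm ?exprn_ge0 // ler_wpM2l ?exprn_ge0.
apply: le_trans (nrmB _ _) _; apply: lerD.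
  apply: le_trans (nrm_conv _ _) _; rewrite -expr2 ler_wpM2l // ler_pXn2r ?nnegrE //.
  exact: le_trans n0 h.
rewrite nrmZ ger0_norm // ler_wpM2l //; apply: le_trans (nrmD _ _) _; rewrite mulr2n; apply: lerD.
  by apply: le_trans (nrm_conv _ _) _; rewrite ler_wpM2l // ler_wpM2l.
by apply: le_trans (nrm_conv _ _) _; rewrite ler_wpM2l // mulrC ler_wpM2l.
Qed.

Lemma err_numeric (k dd e hi m n : R) : 0 <= k -> 0 < dd -> 0 <= e -> e <= hi ^+ 2 ->
  0 <= m -> m <= hi / dd -> 0 <= n -> n <= hi ->
  k * (k * (e / dd)) ^+ 2 + m * ((k * (n * (k * (e / dd)))) *+ 2) + m ^+ 2 * (k * (e / dd)) <=
  (k * (k / dd) ^+ 2 * hi ^+ 2 + (hi / dd * (k * hi * (k / dd))) *+ 2 + (hi / dd) ^+ 2 * (k / dd)) * e.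
Proof.
move=> k0 d0' e0 eh m0 mh n0 nh; have u0 : 0 <= k / dd by rewrite divr_ge0 // ltW.
have [u uE] : exists u, u = k / dd by exists (k / dd).
have [v vE] : exists v, v = hi / dd by exists (hi / dd).
have -> : k * (e / dd) = u * e by rewrite uE; ring.
rewrite -uE -vE; rewrite -vE in mh; rewrite -uE in u0.
rewrite mulrDl mulrDl; apply: lerD; first apply: lerD.
- have -> : k * (u * e) ^+ 2 = k * u ^+ 2 * e * e by ring.
  have -> : k * u ^+ 2 * hi ^+ 2 * e = k * u ^+ 2 * e * hi ^+ 2 by ring.
  by rewrite ler_wpM2l // !mulr_ge0 // sqr_ge0.
- have -> : m * ((k * (n * (u * e))) *+ 2) = (m * n) * (k * u * e *+ 2) by ring.
  have -> : (v * (k * hi * u)) *+ 2 * e = (v * hi) * (k * u * e *+ 2) by ring.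
  by rewrite ler_wpM2r ?mulrn_wge0 ?mulr_ge0 // ler_pM.
- rewrite -[X in _ <= X]mulrA ler_wpM2r ?mulr_ge0 //.
  by rewrite ler_pXn2r ?nnegrE // (le_trans m0 mh).
Qed.

(** Depends on [x] only through bounds [lo] and [hi], so it is constant along an orbit that
    stays away from zero. *)
Definition err_const (lo hi : R) : R :=
  d ^+ 2 / lo ^+ 2 *
    (K * (K / d) ^+ 2 * hi ^+ 2 + (hi / d * (K * hi * (K / d))) *+ 2 + (hi / d) ^+ 2 * (K / d))
  + hi / (d * lo).

Lemma Mc_error lo hi : 0 < lo -> lo <= b -> lo <= q -> a <= hi -> b <= hi -> nrm x <= hi ->
  nrm ((d ^+ 2 / (b * q))%:C%C *: Mc x - x) <= err_const lo hi * eta.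
Proof.
move=> lo0 lb lq ah bh nh; have e0 := eta_ge0; have D0 := d0; have K0 := kap_ge0 irrP.
have b0 : 0 < b := lt_le_trans lo0 lb; have q0 : 0 < q := lt_le_trans lo0 lq.
have a0 : 0 <= a := psd_rt0 wx; have n0 := nrm_ge0 x.
have hi0 : 0 < hi := lt_le_trans b0 bh.
set c := d ^+ 2 / (b * q).
have c0 : 0 <= c by rewrite divr_ge0 ?sqr_ge0 // mulr_ge0 ?ltW.
(* By the choice of [c], [c] times [M ^+ 2 * (a / d)] is [1 + eta / (d * q)]. *)
have -> : c%:C%C *: Mc x - x =
    c%:C%C *: (Mc x - (M ^+ 2 * (a / d))%:C%C *: x) + (eta / (d * q))%:C%C *: x.
  rewrite scalerBr scalerA -rmorphM -addrA; congr (_ + _).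
  rewrite -scaleNr -scalerDl -rmorphN -rmorphD /=.
  rewrite -[X in - X]scale1r -scaleNr; congr (_ *: _); rewrite -[1]/(1%:C%C) -rmorphN; congr (_%:C%C).
  by rewrite /c; field; rewrite !gt_eqF.
have f0 : 0 <= eta / (d * q) by rewrite divr_ge0 // ltW // mulr_gt0.
apply: le_trans (nrmD _ _) _; rewrite !nrmZ !ger0_norm //.
have M0 : 0 <= M := bipos_M0 bx; have Mh : M <= hi / d by rewrite ler_pM2r ?invr_gt0.
have h0 := ltW hi0; have u0 : 0 <= K / d by rewrite divr_ge0 // ltW.
have eh : eta <= hi ^+ 2.
  apply: le_trans (_ : a * b <= _); first by rewrite gerBl mulr_ge0 // ltW.
  by rewrite expr2 ler_pM // ltW.
have p2 : eta / (d * q) * nrm x <= hi / (d * lo) * eta.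
  have -> : hi / (d * lo) * eta = eta / (d * lo) * hi by ring.
  apply: ler_pM => //; rewrite ler_wpM2l // lef_pV2 ?posrE ?mulr_gt0 //.
  by rewrite ler_pM2l.
have p1 : c * nrm (Mc x - (M ^+ 2 * (a / d))%:C%C *: x) <= d ^+ 2 / lo ^+ 2 *
   ((K * (K / d) ^+ 2 * hi ^+ 2 + (hi / d * (K * hi * (K / d))) *+ 2 + (hi / d) ^+ 2 * (K / d)) * eta).
  apply: ler_pM => //; first exact: nrm_ge0.
    rewrite /c ler_pM2l ?exprn_gt0 // lef_pV2 ?posrE ?mulr_gt0 ?exprn_gt0 // expr2.
    by rewrite ler_pM // ltW.
  exact: le_trans Mc_error0 (err_numeric K0 D0 e0 eh M0 Mh n0 nh).
rewrite /err_const [X in _ <= X]mulrDl -[X in _ <= X + _]mulrA; exact: lerD.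
Qed.
End BlockError.
End Bipositive.

(** * One step of the block map *)

Section Block.
Context (R : realType) (P : subfactorPlanarAlgebra R) (irrP : irreducible P).
Local Notation A s := (tbox irrP s).
Local Notation C := R[i].
Local Notation d := (dlt P).
Context (lam : R) (lam0 : 0 <= lam) (lam1 : lam <= 1).
Let lam1' : 0 <= 1 - lam. Proof. by rewrite subr_ge0. Qed.

Section Positivity.
Context (s t : bool) (st : t = ~~ s) (ts : s = ~~ t).
Local Notation F := (@rot _ P irrP s t st).
Local Notation G := (@rot _ P irrP t s ts).

(** The Fourier transform of a coproduct is a product, here of [F x] and its adjoint. *)
Lemma rot_conv_bar (x : A s) : F (conv (G (F (adj x))) x) = F x * adj (F x).
Proof.
rewrite -{2}[x](rotK4 st ts) -rotM (rot2M ts st) (rotK4 st ts).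
by rewrite -[F (adj x)](rotK4 ts st) -(rot_adj st ts) !(rotK4 ts st).
Qed.

Lemma bipos_sum (p q : R) (x y : A s) : 0 <= p -> 0 <= q ->
  bipos st x -> bipos st y -> bipos st (p%:C%C *: x + q%:C%C *: y).
Proof.
move=> p0 q0 [wx wX] [wy wY]; split; first by apply: psdD; exact: psdZr.
by rewrite rotD !rotZ; apply: psdD; exact: psdZr.
Qed.

Lemma bipos_convmul (x : A s) :
  bipos st (conv (G (F (adj x))) x * conv (G (F x)) (adj x)).
Proof.
have e : adj (conv (G (F (adj x))) x) = conv (G (F x)) (adj x).
  by rewrite adj_conv (bar_adj st ts) adjK.
split; first by rewrite -e; exact: psd_sq'.
have e1 := rot_conv_bar x; have e2 := rot_conv_bar (adj x); rewrite adjK in e2.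
rewrite rotM e1 e2 -{1}[F x]adjK -{1}[F (adj x)]adjK; exact: schur.
Qed.

Lemma bipos_mulconv (x : A s) : bipos st (conv (G (F x) * G (F (adj x))) (adj x * x)).
Proof.
split; first by rewrite (bar_adj st ts) -{1}[G (F x)]adjK; exact: schur.
have -> : G (F x) * G (F (adj x)) = G (F (adj (adj x * x))).
  by rewrite adjM adjK (rot2M st ts).
by rewrite rot_conv_bar; exact: psd_sq'.
Qed.
End Positivity.

Context (s : bool).
Local Notation t := (~~ s).
Local Notation st := (erefl (~~ s)).
Local Notation ts := (esym (negbK s)).
Local Notation F := (@rot _ P irrP s t st).
Local Notation G := (@rot _ P irrP t s ts).
Implicit Types x : A s.
Local Notation B := (@block R P s lam).

Lemma block0 : B 0 = 0. Proof. by rewrite /block eqxx. Qed.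

Lemma block_unfold x : x != 0 -> B x =
  (lam * (d ^+ 2 / (pnorm 1 x * pnorm 2 x ^+ 2)))%:C%C *:
     (conv (G (F (adj x))) x * conv (G (F x)) (adj x)) +
  ((1 - lam) * (d / (opnorm x * pnorm 2 x ^+ 2)))%:C%C *:
     conv (G (F x) * G (F (adj x))) (adj x * x).
Proof.
move=> x0; rewrite /block (negbTE x0) /block_cm /block_mc (dltE irrP).
rewrite -rmorphXn -!fmorphV -!rmorphM.
have scl (c e : R) (y : A s) : c%:C%C *: (e%:C%C *: y) = (c * e)%:C%C *: y.
  by rewrite scalerA -rmorphM.
by congr (_ + _); exact: scl.
Qed.

(** [block_cm] yields a product [z z^*] whose Fourier transform is a coproduct of squares,
    and [block_mc] a coproduct of squares whose Fourier transform is of the form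
    [w w^*]. *)
Lemma block_bipos x : bipos st (B x : A s).
Proof.
have [->|x0] := eqVneq x 0.
  by rewrite block0; split; rewrite ?(raddf0 (@rot _ P irrP s t st)); exact: psd0.
have D0 := dlt_gt0 irrP; rewrite block_unfold //; apply: bipos_sum.
- by rewrite mulr_ge0 // divr_ge0 ?sqr_ge0 // mulr_ge0 ?exprn_ge0 // pnorm_ge0.
- by rewrite mulr_ge0 // divr_ge0 ?(ltW D0) // mulr_ge0 ?exprn_ge0 ?pnorm_ge0 // (opnorm_ge0 irrP).
- exact: bipos_convmul.
exact: bipos_mulconv.
Qed.

Section Step.
Context (x : A s) (bx : bipos st x).
Local Notation a := (rt x).
Local Notation b := (rt (F x)).
Local Notation q := (N2 x).
Local Notation eta := (a * b - d * q).
Let wx : psd x := proj1 bx.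
Let wX : psd (F x) := proj2 bx.
Let GF : G (F x) = x := bipos_bar ts bx.

Lemma bipos_gt0 : x != 0 -> [/\ 0 < a, 0 < b & 0 < q].
Proof.
move=> x0; split; rewrite lt_def.
- by rewrite psd_rt0 // andbT; apply: contra_neq x0; exact: psd_eq0.
- rewrite psd_rt0 // andbT; apply: contra_neq x0 => /(psd_eq0 wX) e.
  by rewrite -GF e raddf0.
by rewrite N2_ge0 andbT; apply: contra_neq x0 => /N2_eq0.
Qed.

Lemma block_biposE : x != 0 -> B x =
  (lam * (d ^+ 2 / (a * q)))%:C%C *: Cm x + ((1 - lam) * (d ^+ 2 / (b * q)))%:C%C *: Mc x.
Proof.
move=> x0; rewrite block_unfold // (psd_adj wx) GF pnorm1E // pnorm2E nrm_sq (bipos_opnorm ts bx).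
have [a0 b0 q0] := bipos_gt0 x0; congr (_ + (_ * _)%:C%C *: _).
by field; rewrite (dlt_neq0 irrP) (gt_eqF b0) (gt_eqF q0).
Qed.

Lemma rt_block : x != 0 -> rt (B x : A s) <= lam * a + (1 - lam) * (d * q / b).
Proof.
move=> x0; have [a0 b0 q0] := bipos_gt0 x0; have D := dlt_neq0 irrP.
rewrite block_biposE // rtD !rtZ; apply: lerD; last first.
  rewrite (rt_Mc ts bx) le_eqVlt; apply/orP; left; apply/eqP; field.
  by rewrite D ?(gt_eqF a0) ?(gt_eqF b0) ?(gt_eqF q0).
have -> : lam * a = lam * (d ^+ 2 / (a * q)) * ((a / d) ^+ 2 * q).
  by field; rewrite D ?(gt_eqF a0) ?(gt_eqF b0) ?(gt_eqF q0).
rewrite ler_wpM2l ?(rt_Cm ts bx) // mulr_ge0 // divr_ge0 ?sqr_ge0 //.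
by rewrite mulr_ge0 ?ltW.
Qed.

Lemma rt_rot_block : x != 0 -> rt (F (B x : A s)) <= lam * (d * q / a) + (1 - lam) * b.
Proof.
move=> x0; have [a0 b0 q0] := bipos_gt0 x0; have D := dlt_neq0 irrP.
have bX := bipos_dual ts bx.
rewrite block_biposE // rotD !rotZ (rot_Cm ts bx) (rot_Mc ts bx) rtD !rtZ; apply: lerD.
  rewrite (rt_Mc st bX) (N2_rot st ts).
  rewrite le_eqVlt; apply/orP; left; apply/eqP; field.
  by rewrite D ?(gt_eqF a0) ?(gt_eqF b0) ?(gt_eqF q0).
have -> : (1 - lam) * b = (1 - lam) * (d ^+ 2 / (b * q)) * ((b / d) ^+ 2 * q).
  by field; rewrite D ?(gt_eqF a0) ?(gt_eqF b0) ?(gt_eqF q0).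
rewrite ler_wpM2l //; first by rewrite mulr_ge0 // divr_ge0 ?sqr_ge0 // mulr_ge0 ?ltW.
by have := rt_Cm st bX; rewrite (N2_rot st ts).
Qed.

(** The traces of [Mc x] and of [F (Cm x)] are known exactly; scaled as in the block map
    they are [d * q / b = a - eta / b] and [d * q / a = b - eta / a].  The other two
    traces do not increase.  Hence [eta] is paid for by the decrease of [a] and [b]. *)
Lemma block_decr :
  [/\ rt (B x : A s) <= a, rt (F (B x : A s)) <= b &
      eta <= b * (a - rt (B x : A s)) + a * (b - rt (F (B x : A s)))].
Proof.
have [x0|x0] := eqVneq x 0.
  have z : N2 (0 : A s) = 0 by rewrite /N2 mulr0 rt0.
  by rewrite x0 block0 !(raddf0 (@rot _ P irrP s t st)) !rt0 z !mul0r mulr0 subrr addr0.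
have [a0 b0 q0] := bipos_gt0 x0; have e0 := eta_ge0 ts bx.
have ha := rt_block x0; have hb := rt_rot_block x0; have D0 := dlt_gt0 irrP.
have la : d * q / b <= a by rewrite ler_pdivrMr // -subr_ge0.
have lb : d * q / a <= b by rewrite ler_pdivrMr // [b * a]mulrC -subr_ge0.
split.
- apply: le_trans ha _; rewrite [X in _ <= X](_ : a = lam * a + (1 - lam) * a); last by ring.
  by rewrite lerD2l ler_wpM2l.
- apply: le_trans hb _; rewrite [X in _ <= X](_ : b = lam * b + (1 - lam) * b); last by ring.
  by rewrite lerD2r ler_wpM2l.
rewrite [X in X <= _](_ : eta =
    b * (a - (lam * a + (1 - lam) * (d * q / b))) + a * (b - (lam * (d * q / a) + (1 - lam) * b))); last first.
  by field; rewrite (gt_eqF a0) (gt_eqF b0).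
by apply: lerD; rewrite ler_pM2l // lerD2l lerN2.
Qed.

(** The error of [Cm] for [x] is that of [Mc] for [F x], with [a] and [b] exchanged. *)
Lemma block_error lo hi : x != 0 -> 0 < lo -> lo <= a -> lo <= b -> lo <= q ->
  a <= hi -> b <= hi -> nrm x <= hi ->
  nrm (B x - x : A s) <= err_const irrP lo hi * eta.
Proof.
move=> x0 lo0 la lb lq ah bh nh; rewrite block_biposE //.
have bX := bipos_dual ts bx.
have hm := Mc_error ts bx lo0 lb lq ah bh nh.
have hc : nrm ((d ^+ 2 / (a * q))%:C%C *: Cm x - x) <= err_const irrP lo hi * eta.
  rewrite -(nrm_rot st ts) rotB rotZ (rot_Cm ts bx).
  have := @Mc_error _ _ irrP _ _ ts st _ bX lo hi lo0; rewrite GF (N2_rot st ts) (nrm_rot st ts).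
  by rewrite [b * a]mulrC; exact.
move: (d ^+ 2 / (a * q)) (d ^+ 2 / (b * q)) hm hc => u v hm hc.
have -> : (lam * u)%:C%C *: Cm x + ((1 - lam) * v)%:C%C *: Mc x - x =
   lam%:C%C *: (u%:C%C *: Cm x - x) + (1 - lam)%:C%C *: (v%:C%C *: Mc x - x).
  rewrite !scalerBr !scalerA -!rmorphM [RHS]addrACA; congr (_ + _).
  rewrite -opprD -scalerDl -rmorphD; congr (- _).
  by rewrite addrC subrK scale1r.
apply: le_trans (nrmD _ _) _; rewrite !nrmZ !ger0_norm //.
move: (err_const _ _ _ * _) hm hc => w hm hc.
rewrite [X in _ <= X](_ : w = lam * w + (1 - lam) * w); last by ring.
by apply: lerD; rewrite ler_wpM2l.
Qed.

(** Both defects are positive of trace zero, so [x] and [F x] are multiples of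
    projections. *)
Lemma eta0_biprojection : x != 0 -> eta = 0 -> positive_multiple_of_biprojection (x : P (2, s)%N).
Proof.
move=> x0 e0; have [a0 b0 q0] := bipos_gt0 x0; have D0 := dlt_gt0 irrP; have D := dlt_neq0 irrP.
have bX := bipos_dual ts bx.
have r0 : defect st x = 0.
  apply: psd_eq0 (psd_defect ts bx) _; rewrite (rt_defect bx).
  by have -> : a * b / d - q = eta / d; [field|rewrite e0 mul0r].
have R0 : defect ts (F x) = 0.
  apply: psd_eq0 (psd_defect st bX) _; rewrite (rt_defect bX) GF (N2_rot st ts).
  by have -> : b * a / d - q = eta / d; [field|rewrite e0 mul0r].
have norm (u : bool) (y : A u) (m : R) : 0 < m -> adj y = y -> m%:C%C *: y - y * y = 0 ->
    projection ((m^-1)%:C%C *: y : P (2, u)%N).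
  move=> m0 ya /eqP; rewrite subr_eq0 => /eqP yy; split; last first.
    by rewrite -[star _]/(adj ((m^-1)%:C%C *: y)) adjZr ya.
  rewrite -[Defs.mul _ _]/(((m^-1)%:C%C *: y) * ((m^-1)%:C%C *: y)).
  rewrite -scalerAl -scalerAr -yy !scalerA -!rmorphM; congr (_%:C%C *: _).
  by field; rewrite gt_eqF.
have m0 : 0 < b / d by rewrite divr_gt0.
have k0 : 0 < a / d by rewrite divr_gt0.
exists (b / d), ((b / d)^-1%:C%C *: x); split=> //; last first.
  by rewrite scalerA -rmorphM divff ?scale1r // gt_eqF.
split; first by apply: norm => //; exact: psd_adj wx.
exists (((b / d)^-1 * (a / d))%:C%C), ((a / d)^-1%:C%C *: F x); split.
  by apply: norm => //; [exact: psd_adj wX|rewrite /defect GF in R0].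
rewrite -[fourier _]/(F ((b / d)^-1%:C%C *: x)) rotZ.
by rewrite scalerA -rmorphM mulfK // gt_eqF.
Qed.
End Step.

Lemma psd_jones : psd (jones irrP ts).
Proof.
have D0 := @delta_gt0 _ P irrP.
have c0 : 0 < tau (1 : A t) / loop_value P.
  rewrite divr_gt0 //; have := tau_gt0 (oner_neq0 (A t)); by rewrite adj1 mulr1.
have -> : jones irrP ts = (tau (1 : A t) / loop_value P)^-1 *: (adj (jones irrP ts) * jones irrP ts).
  by rewrite (adj_jones irrP st) (jones_mul irrP st) scalerA mulVf ?scale1r // gt_eqF.
by apply: psdZ (psd_sq _); rewrite invr_ge0 ltW.
Qed.

Lemma projection_psd u (p : A u) : projection (p : P (2, u)%N) -> [/\ psd p, adj p = p & p * p = p].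
Proof.
move=> [pp pa]; have pa' : adj p = p by []; have pp' : p * p = p by [].
by split=> //; rewrite -pp' -{1}pa'; exact: psd_sq.
Qed.

(** A projection is positive, and the phase of [F p] is fixed by its trace, a pairing of
    [p] with the Jones element.  Since [p] acts on that element by the scalar
    [rt (F p) / d], which is nonzero and idempotent, the scalar is [1]. *)
Lemma biprojection_bipos x : positive_multiple_of_biprojection (x : P (2, s)%N) -> x != 0 ->
  bipos st x /\ rt x * rt (F x) - d * N2 x = 0.
Proof.
move=> [r [p [r0 [/projection_psd[wp pa pp] [al [q [/projection_psd[wq qa qq] Fp]]]] xE]]] x0.
have {}Fp : F p = al *: q by [].
have p0 : (p : A s) != 0 by apply: contra_neq x0 => e; rewrite xE e scaler0.
have Fp0 : F p != 0 by apply: contra_neq p0 => e; apply: (rot_inj (st := st) ts); rewrite e raddf0.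
have q0 : (q : A t) != 0 by apply: contra_neq Fp0 => e; rewrite Fp e scaler0.
have tq : 0 < tau (q : A t) by have := tau_gt0 q0; rewrite qa qq.
have al0 : 0 <= al.
  have : 0 <= tau (F p).
    rewrite -[F p]mulr1 (tau_rot st ts) tauC -pp -{1}pa tauC.
    by have := psd_jones (adj (p : A s)); rewrite adjK tauC.
  by rewrite Fp tauZ pmulr_lge0.
have bp : bipos st (p : A s) by split=> //; rewrite Fp; exact: psdZ.
have [a0 b0 _] := bipos_gt0 bp p0.
have E0 : jones irrP ts != 0.
  apply/eqP => e; have := tau_jones irrP ts; rewrite e tau0 => /esym/eqP.
  by rewrite (negbTE (@delta_neq0 _ P irrP)).
have eta0 : rt (p : A s) * rt (F p) - d * N2 (p : A s) = 0.
  have D := dlt_neq0 irrP; have := bipos_jones ts bp; have := rt_defect bp; rewrite /defect pp.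
  have m0 : rt (F p) / d != 0 by rewrite mulf_neq0 ?invr_neq0 ?gt_eqF // dlt_gt0.
  set a := rt (p : A s); set b := rt (F p) in m0 *; set N := N2 _.
  move mE : (b / d) m0 => m m0 hd pE.
  have m1 : m = 1.
    have : m%:C%C *: (m%:C%C *: jones irrP ts) = m%:C%C *: jones irrP ts.
      by rewrite -[in RHS]pE -[in RHS]pp -mulrA pE -scalerAr pE.
    rewrite scalerA -rmorphM => /eqP; rewrite -subr_eq0 -scalerBl scaler_eq0 (negbTE E0) orbF -rmorphB.
    rewrite -[0]/(0%:C%C) => /eqP[] /eqP; rewrite -{3}[m]mulr1 -mulrBr mulf_eq0 (negbTE m0) /= subr_eq0.
    by move/eqP.
  move: hd; rewrite m1 scale1r subrr rt0 => /esym/eqP; rewrite subr_eq0 => /eqP <-.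
  by field.
rewrite xE; split; first by split; rewrite ?rotZ; apply: psdZr; rewrite ?(ltW r0) //; case: bp.
rewrite rotZ !rtZ N2Z -[RHS](mulr0 (r ^+ 2)) -[in RHS]eta0.
by ring.
Qed.

(** A fixed point has [eta = 0] by [block_decr], and conversely [block_error] bounds the
    displacement by a multiple of [eta]. *)
Theorem block_fixed x : x != 0 -> (B x = x <-> positive_multiple_of_biprojection (x : P (2, s)%N)).
Proof.
move=> x0; split=> [e|pm].
  have bx : bipos st x by rewrite -e; exact: block_bipos.
  apply: (eta0_biprojection bx) => //.
  have [_ _] := block_decr bx; rewrite e !subrr !mulr0 addr0 => h.
  by apply/eqP; rewrite eq_le h (eta_ge0 ts bx).
have [bx e0] := biprojection_bipos pm x0; have [a0 b0 q0] := bipos_gt0 bx x0.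
pose lo := Num.min (rt x) (Num.min (rt (F x)) (N2 x)).
pose hi := Num.max (rt x) (Num.max (rt (F x)) (nrm x)).
have := @block_error x bx lo hi x0; rewrite e0 mulr0 /lo /hi.
rewrite !lt_min a0 b0 q0 !ge_min !le_max !lexx !orbT.
move=> /(_ isT isT isT isT isT isT isT) h.
by apply/eqP; rewrite -subr_eq0; apply/eqP/(nrm_eq0 (x := _ : A s))/eqP; rewrite eq_le h nrm_ge0.
Qed.
End Block.

(** * Limits of two-boxes *)

Section Limits.
Context (R : realType) (P : subfactorPlanarAlgebra R) (irrP : irreducible P) (s : bool).
Local Notation A := (tbox irrP s).
Local Notation C := R[i].
Local Open Scope classical_set_scope.

(** The bound makes [v + S] nonincreasing, and [v] bounded below. *)
Lemma summable_cvg (v S : nat -> R) : (forall n, 0 <= S n) ->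
  (forall n, `|v n.+1 - v n| <= S n - S n.+1) -> exists l : R, v @ \oo --> l.
Proof.
move=> S0 h.
have Sle : nonincreasing_seq S.
  by apply/nonincreasing_seqP => n; rewrite -subr_ge0 (le_trans _ (h n)).
have cS : cvgn S.
  by apply: nonincreasing_is_cvgn => //; exists 0 => _ [n _ <-].
have cW : cvgn (v + S).
  apply: nonincreasing_is_cvgn.
    apply/nonincreasing_seqP => n /=; have := h n; rewrite !fctE ler_norml => /andP[_ h'].
    by lra.
  exists (v 0%N - S 0%N) => _ [n _ <-] /=.
  have {}: v 0%N - S 0%N <= v n - S n.
    elim: n => [//|n IH]; apply: le_trans IH _; have := h n; rewrite ler_norml => /andP[+ _].
    by move=> h'; lra.
  by move/le_trans; apply; have := S0 n => ?; rewrite !fctE; lra.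
exists (limn (v + S) - limn S).
by rewrite -[X in X @ _](addrK S v); exact: cvgB.
Qed.

(** The endomorphism [phi] records the pairings of [y] with a basis; it is injective
    because the trace form is definite, hence onto. *)
Lemma tau_functional (l : 'I_(\dim {: A}) -> C) :
  exists y : A, forall i : 'I_(\dim {: A}), tau ((vbasis {: A})`_i * y) = l i.
Proof.
pose e := vbasis {: A}; pose phi (y : A) : A := \sum_(i < \dim {: A}) tau (e`_i * y) *: e`_i.
have phi_lin : linear phi.
  move=> a y z; rewrite /phi scaler_sumr -big_split /=; apply: eq_bigr => i _.
  by rewrite mulrDr tauD -scalerAr tauZ scalerDl scalerA.
pose phiL := GRing.isLinear.Build C A A *:%R phi phi_lin.
pose f : {linear A -> A} := HB.pack phi phiL.
have fE y : linfun f y = phi y by rewrite lfunE.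
have free_e : free e := basis_free (vbasisP _).
have coordE y (i : 'I_(\dim {: A})) : coord e i (phi y) = tau (e`_i * y).
  by rewrite /phi coord_sum_free.
have ker0 : lker (linfun f) == 0%VS.
  rewrite -subv0; apply/subvP => y; rewrite memv_ker fE => /eqP py; rewrite memv0.
  have z (i : 'I_(\dim {: A})) : tau (e`_i * y) = 0 by rewrite -coordE py linear0.
  apply/eqP/tau_eq0.
  rewrite (coord_vbasis (memvf (adj y))) mulr_suml raddf_sum big1 //= => i _.
  by rewrite -scalerAl tauZ z mulr0.
have /memv_imgP[y _ yE] : \sum_i l i *: e`_i \in limg (linfun f).
  by rewrite (lker0_limgf ker0) memvf.
exists y => i; rewrite -coordE -fE -yE coord_sum_free //.
Qed.

Lemma rt_ReIm (z w : A) (c : C) :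
  rt ((c *: z) * w) = complex.Re c * rt (z * w) + complex.Im c * rt (('i%C *: z) * w).
Proof.
rewrite /rt -!scalerAl !tauZ; case: c (tau (z * w)) => p q [x y] /=.
by rewrite !mul0r !mul1r !sub0r mulrN.
Qed.

(** Weak limits exist by [tau_functional]. *)
Lemma cvg_weak (u : nat -> A) :
  (forall z, exists l : R, (fun n => rt (z * u n)) @ \oo --> l) ->
  exists y, forall z, (fun n => rt (z * (u n - y))) @ \oo --> (0 : R).
Proof.
move=> h; pose e := vbasis {: A}; pose ell z := projT1 (cid (h z)).
have ellP z : (fun n => rt (z * u n)) @ \oo --> ell z by exact: projT2 (cid (h z)).
(* The functional is complex linear, so [ell] at [i z] is minus the imaginary part. *)
have [y yE] := tau_functional (fun i : 'I_(\dim {: A}) => Complex (ell e`_i) (- ell ('i%C *: e`_i))).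
have base z : rt (z * y) = ell z -> (fun n => rt (z * (u n - y))) @ \oo --> (0 : R).
  move=> E; rewrite -(subrr (ell z)).
  have -> : (fun n => rt (z * (u n - y))) = (fun n => rt (z * u n) - ell z).
    by apply/funext => n; rewrite mulrBr rtB E.
  by apply: cvgB => //; exact: cvg_cst.
have c0 (i : 'I_(\dim {: A})) : (fun n => rt (e`_i * (u n - y))) @ \oo --> (0 : R).
  by apply: base; rewrite /rt yE /=; ring.
have c1 (i : 'I_(\dim {: A})) : (fun n => rt (('i%C *: e`_i) * (u n - y))) @ \oo --> (0 : R).
  by apply: base; rewrite /rt -scalerAl tauZ yE /=; ring.
exists y => z; rewrite (coord_vbasis (memvf z)).
have -> : (fun n => rt ((\sum_(i < \dim {: A}) coord e i z *: e`_i) * (u n - y))) =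
    (fun n => \sum_(i < \dim {: A}) (complex.Re (coord e i z) * rt (e`_i * (u n - y)) +
       complex.Im (coord e i z) * rt (('i%C *: e`_i) * (u n - y)))).
  apply/funext => n; rewrite mulr_suml /rt raddf_sum /= raddf_sum; apply: eq_bigr => i _.
  exact: rt_ReIm.
have z0 : \sum_(i < \dim {: A}) (complex.Re (coord e i z) * 0 + complex.Im (coord e i z) * 0) = 0 :> R.
  by rewrite big1 // => i _; rewrite !mulr0 addr0.
rewrite -[X in _ --> X]z0; apply: cvg_big => [|i _]; first exact: add_continuous.
by apply: cvgD; apply: cvgMl_tmp.
Qed.

(** The weak limit is a strong one: pairing [u n - y] with its own adjoint, it is at most
    [nrm (u n - y)] times the tail of [S]. *)
Lemma summable_limit (u : nat -> A) (S : nat -> R) : (forall n, 0 <= S n) ->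
  (forall n, nrm (u n.+1 - u n) <= S n - S n.+1) ->
  exists y, (fun n => nrm (u n - y)) @ \oo --> (0 : R).
Proof.
move=> S0 h.
have [y yP] : exists y, forall z, (fun n => rt (z * (u n - y))) @ \oo --> (0 : R).
  apply: cvg_weak => z; apply: (@summable_cvg _ (fun n => nrm z * S n)) => n.
    by rewrite mulr_ge0 ?nrm_ge0.
  rewrite -rtB -mulrBr -mulrBr; apply: le_trans (norm_rt _ _) _.
  by rewrite ler_wpM2l ?nrm_ge0.
have Sle : nonincreasing_seq S.
  by apply/nonincreasing_seqP => n; rewrite -subr_ge0 (le_trans _ (h n)) ?nrm_ge0.
have cS : cvgn S.
  by apply: nonincreasing_is_cvgn => //; exists 0 => _ [n _ <-].
have far n m : (n <= m)%N -> nrm (u m - u n) <= S n - S m.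
  elim: m => [|m IH]; first by rewrite leqn0 => /eqP ->; rewrite !subrr nrm0.
  rewrite leq_eqVlt => /predU1P[->|/IH]; first by rewrite !subrr nrm0.
  move=> IHm; have -> : u m.+1 - u n = (u m.+1 - u m) + (u m - u n) by rewrite addrA subrK.
  apply: le_trans (nrmD _ _) _; have := h m; move: IHm; lra.
have close n : nrm (u n - y) <= S n - limn S.
  have [e0|e0] := eqVneq (nrm (u n - y)) 0.
    by rewrite e0 subr_ge0; exact: nonincreasing_cvgn_ge.
  rewrite -(ler_pM2l (x := nrm (u n - y))) ?lt_def ?e0 ?nrm_ge0 //.
  rewrite -expr2 nrm_sq /N2 -subr_ge0; set w := adj _.
  have cv : (fun m => rt (w * (u m - y)) + (nrm w * (S n - limn S) - rt (w * (u n - y)))) @ \oo -->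
      0 + (nrm w * (S n - limn S) - rt (w * (u n - y))).
    by apply: cvgD => //; exact: cvg_cst.
  rewrite -(nrm_adj (u n - y)) -/w -[X in 0 <= X]add0r -(cvg_lim _ cv) //.
  apply: limr_ge; first by apply/cvg_ex; eexists; exact: cv.
  near=> m; have nm : (n <= m)%N by near: m; exact: nbhs_infty_ge.
  have e1 : rt (w * (u n - y)) - rt (w * (u m - y)) <= nrm w * (S n - limn S).
    rewrite -rtB -mulrBr opprB addrA subrK; apply: le_trans (ler_norm _) _.
    apply: le_trans (norm_rt _ _) _; rewrite ler_wpM2l ?nrm_ge0 //.
    rewrite -nrmN opprB; apply: le_trans (far _ _ nm) _.
    by rewrite lerD2l lerN2; exact: nonincreasing_cvgn_ge.
  move: e1; lra.
exists y; apply: (@squeeze_cvgr _ _ _ _ (fun=> 0) (fun n => S n - limn S)).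
- by near=> n; rewrite nrm_ge0 close.
- exact: cvg_cst.
by rewrite -(subrr (limn S)); apply: cvgB => //; exact: cvg_cst.
Unshelve. all: by end_near.
Qed.

Section LimitPoint.
Context (u : nat -> A) (y : A) (uy : (fun n => nrm (u n - y)) @ \oo --> (0 : R)).

Lemma le0_of_cvg (r c : R) : (forall n, r <= c * nrm (u n - y)) -> r <= 0.
Proof.
move=> h; have cv : (fun n => c * nrm (u n - y)) @ \oo --> (0 : R).
  by rewrite -[X in _ --> X](mulr0 c); exact: cvgMl_tmp.
rewrite -(cvg_lim _ cv) //; apply: limr_ge; first by apply/cvg_ex; exists 0.
by apply: nearW.
Qed.

Lemma squeeze_limit (c l : R) (v : nat -> R) :
  (forall n, `|v n - l| <= c * nrm (u n - y)) -> v @ \oo --> l.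
Proof.
move=> h; have cv : (fun n => c * nrm (u n - y)) @ \oo --> (0 : R).
  by rewrite -[X in _ --> X](mulr0 c); exact: cvgMl_tmp.
apply: (@squeeze_cvgr _ _ _ _ (fun n => l - c * nrm (u n - y)) (fun n => l + c * nrm (u n - y))).
- by apply: nearW => n; rewrite -ler_distl.
- by rewrite -[X in _ --> X]subr0; apply: cvgB => //; exact: cvg_cst.
- by rewrite -[X in _ --> X]addr0; apply: cvgD => //; exact: cvg_cst.
Qed.

Lemma cvg_rt : (fun n => rt (u n)) @ \oo --> rt y.
Proof.
apply: (@squeeze_limit (nrm (1 : A))) => n.
by rewrite -rtB -[u n - y in leLHS]mul1r norm_rt.
Qed.

Lemma cvg_N2 : (fun n => N2 (u n)) @ \oo --> N2 y.
Proof.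
have cn : (fun n => nrm (u n)) @ \oo --> nrm y.
  apply: (@squeeze_limit 1) => n; rewrite mul1r ler_distl; apply/andP; split.
    by rewrite lerBlDr -[nrm (u n - y)]nrmN opprB -{1}[y](subrK (u n)) addrC nrmD.
  by rewrite -{1}[u n](subrK y) addrC nrmD.
have -> : (fun n => N2 (u n)) = (fun n => nrm (u n) * nrm (u n)).
  by apply/funext => n; rewrite -expr2 nrm_sq.
by rewrite -nrm_sq expr2; exact: cvgM.
Qed.

Lemma psd_limit : (forall n, psd (u n)) -> psd y.
Proof.
move=> w; apply: psdI.
  apply/eqP; rewrite -subr_eq0; apply/eqP/nrm_eq0/eqP; rewrite eq_le nrm_ge0 andbT.
  apply: (@le0_of_cvg _ 2) => n; rewrite mulr_natl mulr2n.
  have -> : adj y - y = (u n - y) - adj (u n - y).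
    by rewrite adjB (psd_adj (w n)) opprB [RHS]addrC addrA subrK.
  by rewrite -[X in _ <= _ + X]nrm_adj nrmB.
move=> z; rewrite -oppr_le0; set k := z * adj z.
apply: (@le0_of_cvg _ (nrm k)) => n.
have h := psd_rt z (w n); rewrite -/k in h.
apply: le_trans (_ : rt ((u n - y) * k) <= _); first by rewrite mulrBl rtB; lra.
by rewrite rtC; apply: le_trans (ler_norm _) (norm_rt _ _).
Qed.
End LimitPoint.
End Limits.

(** * Convergence of the iterates *)

Section Convergence.
Context (R : realType) (P : subfactorPlanarAlgebra R) (irrP : irreducible P).
Context (lam : R) (lam0 : 0 <= lam) (lam1 : lam <= 1) (s : bool).
Local Notation A s := (tbox irrP s).
Local Notation d := (dlt P).
Local Notation t := (~~ s).
Local Notation st := (erefl (~~ s)).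
Local Notation ts := (esym (negbK s)).
Local Notation F := (@rot _ P irrP s t st).
Local Notation B := (@block R P s lam).
Local Open Scope classical_set_scope.

Section Orbit.
Context (u : nat -> A s) (ub : forall n, bipos st (u n)) (uS : forall n, u n.+1 = B (u n)).
Local Notation a n := (rt (u n)).
Local Notation b n := (rt (F (u n))).
Let ua n : 0 <= a n := psd_rt0 (proj1 (ub n)).
Let ub0 n : 0 <= b n := psd_rt0 (proj2 (ub n)).

Lemma orbit_decr m n : (m <= n)%N -> a n <= a m /\ b n <= b m.
Proof.
elim: n => [|n IH]; first by rewrite leqn0 => /eqP ->.
rewrite leq_eqVlt => /predU1P[->//|/IH[ha hb]].
have [ha' hb' _] := block_decr lam0 lam1 (ub n).
by rewrite uS (le_trans ha') // (le_trans hb').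
Qed.

(** Since [d * N2 (u n) <= a n * b n], where one factor tends to zero. *)
Lemma orbit_to0 : (forall lo, 0 < lo -> exists n, a n < lo \/ b n < lo) ->
  (fun n => nrm (u n - 0)) @ \oo --> (0 : R).
Proof.
move=> h; have D0 := dlt_gt0 irrP; pose K := Num.max 1 (Num.max (a 0%N) (b 0%N)).
have K0 : 0 < K by rewrite lt_max ltr01.
have [aK bK] : a 0%N <= K /\ b 0%N <= K by rewrite !le_max !lexx !orbT.
apply/cvgr0Pnorm_le => e e0.
have eK : 0 < e ^+ 2 * d / K by rewrite divr_gt0 // mulr_gt0 // exprn_gt0.
have [n hn] := h _ eK; near=> m; have nm : (n <= m)%N by near: m; exact: nbhs_infty_ge.
have [ha hb] := orbit_decr nm; have [hA hB] := orbit_decr (leq0n m).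
rewrite subr0 ger0_norm ?nrm_ge0 // -(@ler_pXn2r _ 2) ?nnegrE ?nrm_ge0 ?(ltW e0) // nrm_sq.
rewrite -(ler_pM2l D0); apply: le_trans (bipos_q_le ts (ub m)) _.
have -> : d * e ^+ 2 = e ^+ 2 * d / K * K by field; rewrite gt_eqF.
case: hn => hn; last rewrite [X in X <= _]mulrC; apply: ler_pM => //.
- exact: le_trans ha (ltW hn).
- exact: le_trans hB bK.
- exact: le_trans hb (ltW hn).
- exact: le_trans hA aK.
Unshelve. all: by end_near.
Qed.

(** With [a] and [b] bounded below, so is the norm, and the error constant is uniform;
    the steps are then summable because [a + b] is a bounded potential.  In the limit
    [eta] vanishes, being dominated by the decrease of the potential. *)
Lemma orbit_pos lo : 0 < lo -> (forall n, lo <= a n /\ lo <= b n) ->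
  exists y, (fun n => nrm (u n - y)) @ \oo --> (0 : R) /\
    positive_multiple_of_biprojection (y : P (2, s)%N).
Proof.
move=> lo0 h; pose N := nrm (1 : A s); pose K := kap irrP.
have an n : a n <= N * nrm (u n) by rewrite -[u n in leLHS]mul1r (le_trans (ler_norm _)) // norm_rt.
have un0 n : u n != 0.
  by apply/eqP => e; have [+ _] := h n; rewrite e rt0 leNgt lo0.
have N0 : 0 < N.
  rewrite lt_def nrm_ge0 andbT; apply/eqP => e; have := an 0%N; rewrite e mul0r.
  by rewrite leNgt (lt_le_trans lo0) //; case: (h 0%N).
pose lo' := Num.min lo ((lo / N) ^+ 2).
pose hi := Num.max (a 0%N) (Num.max (b 0%N) (K * a 0%N)).
have lo'0 : 0 < lo' by rewrite lt_min lo0 exprn_gt0 ?divr_gt0.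
have qlo n : (lo / N) ^+ 2 <= N2 (u n).
  rewrite -nrm_sq ler_pXn2r ?nnegrE ?nrm_ge0 ?divr_ge0 ?(ltW lo0) ?(ltW N0) //.
  by rewrite ler_pdivrMr // mulrC; apply: le_trans (an n); case: (h n).
have hi0 : 0 < hi by rewrite lt_max (lt_le_trans lo0) //; case: (h 0%N).
have hia n : a n <= hi by rewrite !le_max; have [-> _] := orbit_decr (leq0n n).
have hib n : b n <= hi by rewrite !le_max; have [_ ->] := orbit_decr (leq0n n); rewrite orbT.
have hin n : nrm (u n) <= hi.
  rewrite !le_max; apply/orP; right; apply/orP; right.
  apply: le_trans (psd_nrm (proj1 (ub n))) _; rewrite ler_wpM2l ?kap_ge0 //.
  by case: (orbit_decr (leq0n n)).
pose c := `|err_const irrP lo' hi|; pose S n := c * (hi * (a n + b n)).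
pose eta n := a n * b n - d * N2 (u n).
have eta0 n : 0 <= eta n by exact: (eta_ge0 ts (ub n)).
have eta_le n : eta n <= hi * (a n + b n) - hi * (a n.+1 + b n.+1).
  have [ha hb he] := block_decr lam0 lam1 (ub n); rewrite -!uS in ha hb he.
  apply: le_trans he _; rewrite -mulrBr opprD addrACA [X in _ <= X]mulrDr.
  by apply: lerD; rewrite ler_wpM2r // subr_ge0.
have incr n : nrm (u n.+1 - u n) <= S n - S n.+1.
  have [la lb] := h n; rewrite uS -mulrBr.
  apply: le_trans (_ : err_const irrP lo' hi * eta n <= _).
    by apply: block_error => //; rewrite ?ge_min ?la ?lb ?qlo ?orbT.
  apply: le_trans (_ : c * eta n <= _); first by rewrite ler_wpM2r // ler_norm.
  by rewrite ler_wpM2l // normr_ge0.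
have S0 n : 0 <= S n by rewrite /S !mulr_ge0 ?addr_ge0 ?normr_ge0 ?(ltW hi0).
have [y uy] := summable_limit S0 incr.
have Fuy : (fun n => nrm (F (u n) - F y)) @ \oo --> (0 : R).
  have -> : (fun n => nrm (F (u n) - F y)) = (fun n => nrm (u n - y)) => //.
  by apply/funext => n; rewrite -rotB (nrm_rot st ts).
have by_ : bipos st y.
  by split; [apply: (psd_limit uy)|apply: (psd_limit Fuy)] => n; case: (ub n).
have ca := cvg_rt uy; have cb := cvg_rt Fuy; have cq := cvg_N2 uy.
have y0 : y != 0.
  apply/eqP => e; rewrite e rt0 in ca; have : lo <= lim (a n @[n --> \oo]).
    apply: limr_ge; first by apply/cvg_ex; exists 0.
    by apply: nearW => n; case: (h n).
  by rewrite (cvg_lim _ ca) // leNgt lo0.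
exists y; split=> //; apply: (eta0_biprojection by_ y0).
have ce : eta @ \oo --> rt y * rt (F y) - d * N2 y.
  by apply: cvgB; [exact: cvgM|exact: cvgMl_tmp].
have Sab : (fun n => hi * (a n + b n)) @ \oo --> hi * (rt y + rt (F y)).
  by apply: cvgMl_tmp; exact: cvgD.
have ce0 : eta @ \oo --> (0 : R).
  apply: (@squeeze_cvgr _ _ _ _ (fun=> 0) (fun n => hi * (a n + b n) - hi * (a n.+1 + b n.+1))).
  - by apply: nearW => n; rewrite eta0 eta_le.
  - exact: cvg_cst.
  rewrite -(subrr (hi * (rt y + rt (F y)))); apply: cvgB => //.
  by rewrite -(cvg_shiftS (fun n => hi * (a n + b n))) in Sab.
by rewrite -(cvg_lim _ ce) // (cvg_lim _ ce0).
Qed.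
End Orbit.

Lemma iter_converges (x : P (2, s)%N) : exists y : P (2, s)%N,
  converges_to (fun n => iter n B x) y /\ (y = 0 \/ positive_multiple_of_biprojection y).
Proof.
pose u n : A s := iter n.+1 B x.
have ub n : bipos st (u n) by exact: block_bipos.
have uS n : u n.+1 = B (u n) by [].
have shift (y : A s) : (fun n => nrm (u n - y)) @ \oo --> (0 : R) ->
    converges_to (fun n => iter n B x) (y : P (2, s)%N).
  move=> uy; rewrite /converges_to -cvg_shiftS /=.
  have -> // : (fun n => pnorm 2 (iter n.+1 B x - y : P (2, s)%N)) = (fun n => nrm (u n - y)).
  by apply/funext => n; exact: (pnorm2E (u n - y)).
have [[lo [lo0 h]]|h] := pselect (exists lo, 0 < lo /\ forall n, lo <= rt (u n) /\ lo <= rt (F (u n))).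
  by have [y [uy yb]] := orbit_pos ub uS lo0 h; exists y; split; [exact: shift|right].
exists 0; split; last by left.
apply: shift; apply: orbit_to0 => // lo lo0; apply: contrapT => h'; apply: h; exists lo; split=> // n.
rewrite !leNgt; split; apply/negP => l; apply: h'; exists n; [by left|by right].
Qed.
End Convergence.

Theorem theorem1p1 (R : realType) (P : subfactorPlanarAlgebra R)
    (irrP : irreducible P) (lam : R) (lam_ge0 : 0 <= lam) (lam_le1 : lam <= 1)
    (s : bool) :
  (forall x : P (2, s)%N,
     exists y : P (2, s)%N,
       converges_to (fun n => iter n (block lam) x) y /\
       (y = 0 \/ positive_multiple_of_biprojection y)) /\
  (forall x : P (2, s)%N, x != 0 ->
     (block lam x = x <-> positive_multiple_of_biprojection x)).
Proof.
split=> x; first exact: (iter_converges irrP lam_ge0 lam_le1).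
exact: (block_fixed (irrP := irrP) lam_ge0 lam_le1).
Qed.
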